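(* Any family of pairwise non-isomorphic leafless quantum graphs that are pairwise isospectral for the standard Laplacian $\Delta_0$, with common minimum edge length $1$ and total edge length $\mathcal{L}$, has size at most $$\left(\tfrac{2}{3}M+1\right)^{2M}\,M!\;M^{4\lfloor\mathcal{L}\rfloor},\qquad M:=\min\{\lfloor\mathcal{L}\rfloor,\;3\chi-3\},$$ where $\chi=|E|-|V|+1$ (common to all members of the family). Consequently the size of such a family is bounded by $\mathcal{L}^{7\mathcal{L}}=e^{7\mathcal{L}\log(\mathcal{L})}$.
   Context: Combinatorial graphs are finite; loops and multiple edges are allowed, and a loop contributes $2$ to the degree of its vertex. All graphs are assumed connected, without isolated vertices and without vertices of degree $2$. A graph is leafless if it has no vertex of degree $1$. A quantum graph $G$ is a combinatorial graph with vertex set $V$ and edge set $E$ together with a length function $L:E\to\mathbb{R}_{>0}$; each edge $e$ is identified with $[0,L(e)]$. Two quantum graphs are isomorphic if there is a graph isomorphism between them preserving edge lengths. The total edge length is $\mathcal{L}=\sum_{e\in E}L(e)$. Convention: a loop of length $l$ is counted as two edges of length $l/2$; the minimum edge length is taken with this convention. The number $\chi=|E|-|V|+1$ is determined by the spectrum of $\Delta_0$. The standard Laplacian $\Delta_0$ acts on each edge as $f\mapsto -f''$; its domain consists of all functions $f$ that are continuous on $G$, lie in the Sobolev space $W_2$ (two derivatives in $L^2$) on each edge, and satisfy the Kirchhoff condition $\sum_{e\sim v}\nu_{v,e}(f|_e)=0$ at every vertex $v$, where $\nu_{v,e}$ is the outward unit normal of the edge $e$ at $v$ (a loop at $v$ contributes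 at both of its ends). Two quantum graphs are isospectral if their operators $\Delta_0$ have the same eigenvalues including multiplicities. *)

(* Defs.v *)
From HB Require Import structures.
From mathcomp Require Import all_boot all_order all_algebra.
From mathcomp Require Import all_classical all_reals all_analysis.
From mathcomp Require Import complex.

Set Implicit Arguments.
Unset Strict Implicit.
Unset Printing Implicit Defensive.

Import Order.TTheory GRing.Theory Num.Theory.
Import numFieldNormedType.Exports.

Local Open Scope classical_set_scope.
Local Open Scope complex_scope.
Local Open Scope ring_scope.

(* Finite multigraph; loops ([src e = tgt e]) and parallel edges are allowed.
   The orientation src -> tgt only serves to identify e with [0, L e]. *)
Record graph := Graph {
  vertex : finType;
  edge : finType;
  src : edge -> vertex;
  tgt : edge -> vertex }.

Record qgraph (R : realType) := QGraph {
  qgraph_graph :> graph;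
  elen : edge qgraph_graph -> R;
  elen_gt0 : forall e, 0 < elen e }.

Arguments src {g}.
Arguments tgt {g}.
Arguments elen {R q}.

Section Combinatorics.
Local Open Scope nat_scope.
Variable G : graph.

(* Both terms count a loop, which thus contributes 2. *)
Definition degree (v : vertex G) : nat :=
  #|[set e : edge G | src e == v]%SET| + #|[set e : edge G | tgt e == v]%SET|.

Definition adjacent : rel (vertex G) := fun v w =>
  [exists e : edge G, ((src e == v) && (tgt e == w))
                      || ((src e == w) && (tgt e == v))].

Definition graph_connected : Prop :=
  0 < #|vertex G| /\ forall v w : vertex G, connect adjacent v w.

Definition admissible : Prop :=
  [/\ graph_connected,
      forall v : vertex G, degree v != 0
    & forall v : vertex G, degree v != 2].

Definition leafless : Prop := forall v : vertex G, degree v != 1.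

(* |E| - |V| + 1; the subtraction does not truncate for connected graphs. *)
Definition chi : nat := #|edge G| + 1 - #|vertex G|.

End Combinatorics.

(* Edges are undirected: an isomorphism may reverse the orientation of each
   edge independently. *)
Definition qgraph_iso (R : realType) (G H : qgraph R) : Prop :=
  exists (fV : vertex G -> vertex H) (fE : edge G -> edge H),
    [/\ bijective fV, bijective fE,
        forall e : edge G,
          (src (fE e) = fV (src e) /\ tgt (fE e) = fV (tgt e)) \/
          (src (fE e) = fV (tgt e) /\ tgt (fE e) = fV (src e))
      & forall e : edge G, elen (fE e) = elen e].

Section Lengths.
Variables (R : realType) (G : qgraph R).

Definition total_length : R := \sum_(e : edge G) elen e.

(* A loop of length l counts as two edges of length l / 2. *)
Definition split_elen (e : edge G) : R :=
  if src e == tgt e then elen e / 2 else elen e.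

Definition is_min_edge_length (m : R) : Prop :=
  (exists e, split_elen e = m) /\ (forall e, m <= split_elen e).

End Lengths.

Section Sobolev.
Variable R : realType.
Local Notation mu := (@lebesgue_measure R).

Definition square_integrable (l : R) (u : R -> R) : Prop :=
  measurable_fun `[0, l] u /\
  mu.-integrable `[0, l] (fun x => (u x ^+ 2)%:E).

(* u belongs to the Sobolev space W_2 of [0, l] (two derivatives in L^2), with
   continuous first derivative u1 and second derivative u2: u and u1 are the
   primitives of u1 and u2, so u is C^1 with absolutely continuous derivative,
   and u2 is its almost everywhere defined second derivative. *)
Definition sobolev2_real (l : R) (u u1 u2 : R -> R) : Prop :=
  [/\ square_integrable l u2,
      forall x, x \in `[0, l] -> u1 x = u1 0 + \int[mu]_(t in `[0, x]) u2 t
    & forall x, x \in `[0, l] -> u x = u 0 + \int[mu]_(t in `[0, x]) u1 t].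

Definition sobolev2 (l : R) (u u1 u2 : R -> R[i]) : Prop :=
  sobolev2_real l (@complex.Re R \o u) (@complex.Re R \o u1) (@complex.Re R \o u2) /\
  sobolev2_real l (@complex.Im R \o u) (@complex.Im R \o u1) (@complex.Im R \o u2).

End Sobolev.

Section Laplacian.
Variables (R : realType) (G : qgraph R).
Local Notation mu := (@lebesgue_measure R).
Implicit Types f g : edge G -> R -> R[i].

(* Functions on G are represented by f e x with x in [0, elen e]; the values
   outside that interval are set to 0, so that f is determined by the function
   on G it represents. *)
Definition on_graph f : Prop :=
  forall e x, x \notin `[0, elen e] -> f e x = 0.

(* At each vertex the values of f on all incident edge ends agree; continuity
   inside the edges is part of [sobolev2]. *)
Definition vertex_continuous f : Prop :=
  exists phi : vertex G -> R[i],
    forall e, f e 0 = phi (src e) /\ f e (elen e) = phi (tgt e).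

(* The outward derivative is f' at the end elen e of e and - f' at its end 0. *)
Definition kirchhoff (f1 : edge G -> R -> R[i]) : Prop :=
  forall v : vertex G,
    \sum_(e : edge G | tgt e == v) f1 e (elen e)
      - \sum_(e : edge G | src e == v) f1 e 0 = 0.

(* Graph of the operator: f is in the domain and Delta_0 f = g in L^2(G). *)
Definition standard_laplacian f g : Prop :=
  exists f1 f2 : edge G -> R -> R[i],
    [/\ on_graph f,
        vertex_continuous f,
        forall e, sobolev2 (elen e) (f e) (f1 e) (f2 e),
        kirchhoff f1
      & forall e, {ae mu, forall x, x \in `[0, elen e] -> g e x = - f2 e x}].

Definition eigenspace0 (lambda : R[i]) : set (edge G -> R -> R[i]) :=
  [set f | standard_laplacian f (fun e x => lambda * f e x)].

(* lambda has multiplicity n, i.e. its eigenspace has a basis b of n functions;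
   n = 0 means that lambda is not an eigenvalue. *)
Definition multiplicity (lambda : R[i]) (n : nat) : Prop :=
  exists b : 'I_n -> edge G -> R -> R[i],
    [/\ forall i, eigenspace0 lambda (b i),
        forall c : 'I_n -> R[i],
          (forall e x, \sum_(i < n) c i * b i e x = 0) -> forall i, c i = 0
      & forall f, eigenspace0 lambda f ->
          exists c : 'I_n -> R[i],
            forall e x, f e x = \sum_(i < n) c i * b i e x].

End Laplacian.

Definition isospectral (R : realType) (G H : qgraph R) : Prop :=
  forall (lambda : R[i]) (n : nat),
    multiplicity G lambda n <-> multiplicity H lambda n.

(* Main.v *)
Require Import Defs.
From HB Require Import structures.
From mathcomp Require Import all_boot all_order all_algebra.
From mathcomp Require Import all_classical all_reals all_analysis.
From mathcomp Require Import complex spectral measurable_realfun.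
From mathcomp Require Import ring lra zify.
Import Order.TTheory GRing.Theory Num.Theory.
Import numFieldNormedType.Exports.

(** Why the family is finite and how its size is bounded.

    Send waves along the two orientations (bonds) of every edge. An eigenvalue
    k^2 > 0 has an eigenfunction for each vector of bond amplitudes fixed by the
    unitary matrix [evol k] = D(k) S, where S holds the Kirchhoff scattering
    amplitudes and D(k) the phases exp(i k l) acquired along the edges
    ([multiplicity_mult1]). So isospectral graphs give matrices with the same
    multiplicity of the eigenvalue 1 at every k > 0.

    The sum of the arguments in [0, 2 pi) of the eigenvalues of [evol k] moves
    continuously in k except that it falls by 2 pi whenever an eigenvalue passes
    through 1 ([total_phase_limits]); its exponential is det (D(k) S), which
    depends on k only through the total length. Hence for two isospectral graphs
    of the same length the two sums differ by a constant
    ([phase_diff_constant]). Approximate the argument by trigonometric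
    polynomials ([Arg_trig_approx]): the sums become combinations of traces of
    powers of [evol k], that is, exponential sums over closed walks with the
    lengths of the walks as frequencies. Comparing their mean values against
    exp(- i k nu) ([bohr_compare]) gives a trace formula without any
    distributions. At nu = 0 it shows that |E| - |V| is common to both graphs
    ([isospectral_card]); at nu > 0 it shows that if the closed walks of length
    nu of one graph all have amplitudes of the same sign, then the other graph
    also has a closed walk of length nu ([closed_walk_transfer]).

    Fix one graph G0 of the family and let K be a set of edges of another one,
    H, whose lengths are already known. A shortest closed walk of H not inside K
    has positive amplitude ([shortest_weight_gt0]): all degrees are at least 3,
    so only turning back counts negatively, and a shortest walk turns back
    either never or twice. Its length nu determines the length of a further
    edge f: either it is 2 l(f), or it is l(f) plus lengths of edges in K
    ([next_edge_exists], [next_edge_mono]). And nu itself is the length of a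
    closed walk inside K or, by the transfer, the length of a closed walk of G0
    ([next_edge_word]). So H can be rebuilt from the endpoints of its edges in
    the order of discovery and from one word per edge whose letters are edges of
    H found before or edges of G0 ([certificate_iso]).

    As edges have length at least 1 and nu <= 2 l(f), all words together have at
    most 2 L letters; there are at most M edges and 2 M / 3 vertices. Writing
    the words one after another with end marks encodes H in a finite set
    ([code_iso]) with (W + 1)^(2 M) 2^M (2 M)^(2 T + 1) elements, where
    W = floor (2 M / 3) and T = floor L, and this is at most the bound claimed
    because T >= M >= 3 ([code_card_bound]). *)

Set Implicit Arguments.
Unset Strict Implicit.
Unset Printing Implicit Defensive.

Local Open Scope classical_set_scope.
Local Open Scope ring_scope.

(** * Complex numbers and the unit circle *)

Notation nc := Normc.normc.

Section Modulus.
Variable R : realType.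
Local Notation C := R[i].
Implicit Types (z w : C) (x y : R).

Lemma nc_ge0 z : 0 <= nc z.
Proof. by case: z => a b /=; exact: sqrtr_ge0. Qed.

Lemma ncD z w : nc (z + w) <= nc z + nc w.
Proof. exact: le_normcD. Qed.

Lemma ncN z : nc (- z) = nc z.
Proof. exact: normcN. Qed.

Lemma ncB z w : nc (z - w) <= nc z + nc w.
Proof. by rewrite -(ncN w); exact: ncD. Qed.

Lemma ncM z w : nc (z * w) = nc z * nc w.
Proof. exact: Normc.normcM. Qed.

Lemma nc0 : nc (0 : C) = 0.
Proof. exact: Normc.normc0. Qed.

Lemma nc1 : nc (1 : C) = 1.
Proof. exact: Normc.normc1. Qed.

Lemma nc0_eq z : nc z = 0 -> z = 0.
Proof. exact: Normc.eq0_normc. Qed.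

Lemma nc_gt0 z : (0 < nc z) = (z != 0).
Proof.
rewrite lt0r nc_ge0 andbT; congr (~~ _); apply/eqP/eqP => [/nc0_eq//|->].
exact: nc0.
Qed.

Lemma ncX z n : nc (z ^+ n) = nc z ^+ n.
Proof. by elim: n => [|n IH]; rewrite ?expr0 ?nc1// !exprS ncM IH. Qed.

Lemma nc_real x : nc x%:C%C = `|x|.
Proof. by rewrite /= expr0n /= addr0 sqrtr_sqr. Qed.

Lemma nc_sum (I : Type) (r : seq I) (P : pred I) (F : I -> C) :
  nc (\sum_(i <- r | P i) F i) <= \sum_(i <- r | P i) nc (F i).
Proof.
apply: (big_ind2 (fun z (x : R) => nc z <= x)) => //; first by rewrite nc0.
by move=> z x w y hz hw; apply: (le_trans (ncD _ _)); exact: lerD.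
Qed.

Lemma nc_sqr z : nc z ^+ 2 = complex.Re z ^+ 2 + complex.Im z ^+ 2.
Proof. by case: z => a b /=; rewrite sqr_sqrtr// addr_ge0// sqr_ge0. Qed.

Lemma nc_conj z : nc z^*%C = nc z.
Proof. by case: z => a b /=; rewrite sqrrN. Qed.

Lemma Re_le_nc z : `|complex.Re z| <= nc z.
Proof.
rewrite -ler_sqr ?nnegrE ?nc_ge0// nc_sqr real_normK ?num_real//.
by rewrite lerDl sqr_ge0.
Qed.

Lemma Im_le_nc z : `|complex.Im z| <= nc z.
Proof.
rewrite -ler_sqr ?nnegrE ?nc_ge0// nc_sqr real_normK ?num_real//.
by rewrite lerDr sqr_ge0.
Qed.

Lemma Re_sum (I : Type) (r : seq I) (P : pred I) (F : I -> C) :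
  complex.Re (\sum_(i <- r | P i) F i) = \sum_(i <- r | P i) complex.Re (F i).
Proof. by apply: (big_morph _ _ _) => // [[a b] [c d]]. Qed.

Lemma Im_sum (I : Type) (r : seq I) (P : pred I) (F : I -> C) :
  complex.Im (\sum_(i <- r | P i) F i) = \sum_(i <- r | P i) complex.Im (F i).
Proof. by apply: (big_morph _ _ _) => // [[a b] [c d]]. Qed.

Lemma ReM_real x z : complex.Re (x%:C%C * z) = x * complex.Re z.
Proof. by case: z => a b /=; rewrite mul0r subr0. Qed.

Lemma ImM_real x z : complex.Im (x%:C%C * z) = x * complex.Im z.
Proof. by case: z => a b /=; rewrite mul0r addr0. Qed.

Lemma mulC_conj z : z * z^*%C = (nc z ^+ 2)%:C%C.
Proof.
rewrite nc_sqr; case: z => a b /=; apply/eqP; rewrite eq_complex /=.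
by apply/andP; split; apply/eqP; ring.
Qed.

Lemma add_conj z : z + z^*%C = (2 * complex.Re z)%:C%C.
Proof.
case: z => a b /=; apply/eqP; rewrite eq_complex /=.
by apply/andP; split; apply/eqP; ring.
Qed.

Lemma conjcM z w : (z * w)^*%C = z^*%C * w^*%C.
Proof. exact: rmorphM. Qed.

Lemma conjc_sum (I : Type) (r : seq I) (P : pred I) (F : I -> C) :
  (\sum_(i <- r | P i) F i)^*%C = \sum_(i <- r | P i) (F i)^*%C.
Proof. exact: rmorph_sum. Qed.

Lemma conjcB z w : (z - w)^*%C = z^*%C - w^*%C.
Proof. exact: rmorphB. Qed.

Lemma conjcX z n : (z ^+ n)^*%C = z^*%C ^+ n.
Proof. exact: rmorphXn. Qed.

Lemma real_nat n : (n%:R : R)%:C%C = n%:R :> C.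
Proof. by rewrite rmorph_nat. Qed.

Definition cis x : C := (cos x +i* sin x)%C.

Lemma cis0 : cis 0 = 1.
Proof. by rewrite /cis cos0 sin0. Qed.

Lemma cisD x y : cis (x + y) = cis x * cis y.
Proof.
rewrite /cis cosD sinD; apply/eqP; rewrite eq_complex /=.
by apply/andP; split; apply/eqP; ring.
Qed.

Lemma cisN x : cis (- x) = (cis x)^*%C.
Proof. by rewrite /cis cosN sinN. Qed.

Lemma nc_cis x : nc (cis x) = 1.
Proof. by rewrite /= cos2Dsin2 sqrtr1. Qed.

Lemma cis_neq0 x : cis x != 0.
Proof. by rewrite -nc_gt0 nc_cis. Qed.

Lemma cisX x n : cis x ^+ n = cis (x * n%:R).
Proof.
elim: n => [|n IH]; first by rewrite expr0 mulr0 cis0.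
by rewrite exprS IH -cisD -natr1; congr cis; ring.
Qed.

Lemma cis_sum (I : Type) (r : seq I) (P : pred I) (F : I -> R) :
  cis (\sum_(i <- r | P i) F i) = \prod_(i <- r | P i) cis (F i).
Proof. by apply: (big_morph _ cisD cis0). Qed.

Lemma cis2pi : cis (pi *+ 2) = 1.
Proof. by rewrite /cis cos2pi sin2pi. Qed.

Lemma cis2piMn n : cis (pi *+ 2 * n%:R) = 1.
Proof. by rewrite -cisX cis2pi expr1n. Qed.

Lemma cis_neq1 x : 0 < `|x| < pi -> cis x != 1.
Proof.
move=> hx; apply/eqP => -[_ hs].
have : 0 < sin `|x| by rewrite sin_gt0_pi.
by case: (ger0P x) => _; rewrite ?sinN hs ?oppr0 ltxx.
Qed.

(** The step d is so small that no d * x reaches a multiple of 2 pi; averages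
    over its multiples then separate the frequencies as well as a continuous
    mean would. *)
Lemma nonresonant_step (xs : seq R) :
  exists2 d : R, 0 < d & forall x, x \in xs -> x != 0 -> cis (d * x) != 1.
Proof.
pose s := \sum_(x <- xs) `|x|.
have s0 : 0 <= s by apply: sumr_ge0.
have hs : 0 < 1 + s by rewrite ltr_pwDl.
exists (1 + s)^-1; first by rewrite invr_gt0.
move=> x xin x0; apply: cis_neq1; rewrite normrM gtr0_norm ?invr_gt0//.
apply/andP; split; first by rewrite mulr_gt0 ?invr_gt0 ?normr_gt0.
apply: (@le_lt_trans _ _ 1); last by apply: lt_le_trans (pi_ge2 R); rewrite ltr1n.
rewrite mulrC ler_pdivrMr// mul1r.
have : `|x| <= s.
  rewrite /s (big_rem x)//= lerDl; exact: sumr_ge0.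
by move=> h; apply: (le_trans h); rewrite lerDr.
Qed.

Lemma geom_bound z n : nc z = 1 -> z != 1 ->
  nc (\sum_(j < n) z ^+ j.+1) <= 2 / nc (z - 1).
Proof.
move=> z1 zn1.
have h0 : 0 < nc (z - 1) by rewrite nc_gt0 subr_eq0.
rewrite ler_pdivlMr// -ncM.
have -> : (\sum_(j < n) z ^+ j.+1) * (z - 1) = z * (z ^+ n - 1).
  have -> : \sum_(j < n) z ^+ j.+1 = z * \sum_(j < n) z ^+ j.
    by rewrite mulr_sumr; apply: eq_bigr => j _; rewrite exprS.
  by rewrite subrX1 -mulrA [_ * (z - 1)]mulrC.
rewrite ncM z1 mul1r; apply: (le_trans (ncB _ _)).
by rewrite ncX z1 expr1n nc1.
Qed.

End Modulus.

(** * Exponential sums and their Bohr coefficients *)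

Section ExpSum.
Variable R : realType.
Local Notation C := R[i].
Implicit Types (s : seq (C * R)) (k nu : R).

Definition expsum s k : C := \sum_(p <- s) p.1 * cis (k * p.2).
Definition bohr_coef s nu : C := \sum_(p <- s | p.2 == nu) p.1.

Lemma expsum_cat s1 s2 k : expsum (s1 ++ s2) k = expsum s1 k + expsum s2 k.
Proof. by rewrite /expsum big_cat. Qed.

Lemma bohr_coef_cat s1 s2 nu :
  bohr_coef (s1 ++ s2) nu = bohr_coef s1 nu + bohr_coef s2 nu.
Proof. by rewrite /bohr_coef big_cat. Qed.

Definition es_scale (c : C) s := [seq (c * p.1, p.2) | p <- s].
Definition es_conj s : seq (C * R) := [seq (p.1^*%C, - p.2) | p <- s].

Lemma expsum_scale c s k : expsum (es_scale c s) k = c * expsum s k.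
Proof.
by rewrite /expsum big_map mulr_sumr; apply: eq_bigr => p _; rewrite mulrA.
Qed.

Lemma bohr_coef_scale c s nu : bohr_coef (es_scale c s) nu = c * bohr_coef s nu.
Proof. by rewrite /bohr_coef big_map mulr_sumr. Qed.

Lemma expsum_conj s k : expsum (es_conj s) k = (expsum s k)^*%C.
Proof.
rewrite /expsum big_map conjc_sum; apply: eq_bigr => p _.
by rewrite conjcM mulrN cisN.
Qed.

Lemma bohr_coef_conj s nu : bohr_coef (es_conj s) nu = (bohr_coef s (- nu))^*%C.
Proof.
rewrite /bohr_coef big_map conjc_sum.
by apply: eq_bigl => p; rewrite eqr_oppLR.
Qed.

Lemma expsum_flatten (I : Type) (r : seq I) (F : I -> seq (C * R)) k :
  expsum (flatten [seq F i | i <- r]) k = \sum_(i <- r) expsum (F i) k.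
Proof.
elim: r => [|i r IH] /=; first by rewrite /expsum !big_nil.
by rewrite expsum_cat IH big_cons.
Qed.

Lemma bohr_coef_flatten (I : Type) (r : seq I) (F : I -> seq (C * R)) nu :
  bohr_coef (flatten [seq F i | i <- r]) nu = \sum_(i <- r) bohr_coef (F i) nu.
Proof.
elim: r => [|i r IH] /=; first by rewrite /bohr_coef !big_nil.
by rewrite bohr_coef_cat IH big_cons.
Qed.

(** Every frequency other than nu contributes a geometric sum bounded uniformly
    in Q, so that division by Q leaves only the coefficient at nu. *)
Lemma bohr_mean s nu d :
  (forall p, p \in s -> p.2 - nu != 0 -> cis (d * (p.2 - nu)) != 1) ->
  exists K : R, forall Q : nat,
    nc (\sum_(j < Q) expsum s (d * j.+1%:R) * cis (- (d * j.+1%:R * nu))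
        - Q%:R * bohr_coef s nu) <= K.
Proof.
elim: s => [_|[c mu] s IH hd].
  exists 0 => Q; rewrite /bohr_coef big_nil mulr0 subr0.
  by rewrite big1 ?nc0// => j _; rewrite /expsum big_nil mul0r.
have [|K hK] := IH; first by move=> p ps; apply: hd; rewrite inE ps orbT.
have hsplit Q : \sum_(j < Q) expsum ((c, mu) :: s) (d * j.+1%:R) *
      cis (- (d * j.+1%:R * nu)) =
    c * \sum_(j < Q) cis (d * (mu - nu)) ^+ j.+1 +
    \sum_(j < Q) expsum s (d * j.+1%:R) * cis (- (d * j.+1%:R * nu)).
  rewrite mulr_sumr -big_split /=; apply: eq_bigr => j _.
  rewrite /expsum big_cons mulrDl; congr (_ + _).
  by rewrite /= -mulrA -cisD cisX; congr (_ * cis _); ring.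
have [E|N] := eqVneq mu nu.
  exists K => Q; rewrite hsplit /bohr_coef big_cons /= E eqxx.
  rewrite subrr mulr0 cis0 [X in c * X](_ : _ = Q%:R); last first.
    by under eq_bigr do rewrite expr1n; rewrite sumr_const card_ord.
  set A := \sum_(j < Q) _; set B := \sum_(j <- s | _) _.
  have -> : c * Q%:R + A - Q%:R * (c + B) = A - Q%:R * B by ring.
  exact: hK.
exists (nc c * (2 / nc (cis (d * (mu - nu)) - 1)) + K) => Q.
rewrite hsplit /bohr_coef big_cons /= (negbTE N) -addrA.
apply: (le_trans (ncD _ _)); apply: lerD; last exact: hK.
rewrite ncM ler_wpM2l ?nc_ge0// geom_bound ?nc_cis//.
by apply: (hd (c, mu)); rewrite ?mem_head//= subr_eq0.
Qed.

Lemma le_of_natmul_bound (x y K : R) :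
  (forall Q : nat, Q%:R * x <= Q%:R * y + K) -> x <= y.
Proof.
move=> h; rewrite leNgt; apply/negP => hlt.
have hxy : 0 < x - y by rewrite subr_gt0.
pose Q := (Num.truncn (`|K| / (x - y))).+1.
have hQ : `|K| / (x - y) < Q%:R by apply: truncnS_gt.
have := h Q; rewrite -lerBlDl -mulrBr leNgt => /negP; apply.
apply: (le_lt_trans (ler_norm K)).
by rewrite -ltr_pdivrMr.
Qed.

(** The coefficient at a frequency is a mean value, so it is dominated by the
    mean value of any majorant; the mean value of an exponential sum is its
    coefficient at frequency zero. *)
Lemma bohr_coef_le s h nu :
  (forall k, 0 < k -> nc (expsum s k) <= complex.Re (expsum h k)) ->
  nc (bohr_coef s nu) <= complex.Re (bohr_coef h 0).
Proof.
move=> hle.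
have [d d0 hd] := nonresonant_step ([seq p.2 - nu | p <- s] ++ [seq p.2 | p <- h]).
have [|K1 hK1] := @bohr_mean s nu d.
  by move=> p ps; apply: hd; rewrite mem_cat (map_f (fun q => q.2 - nu)).
have [|K2 hK2] := @bohr_mean h 0 d.
  by move=> p ps; rewrite subr0; apply: hd; rewrite mem_cat (map_f snd) ?orbT.
apply: (@le_of_natmul_bound _ _ (K1 + K2)) => Q.
have -> : Q%:R * nc (bohr_coef s nu) = nc (Q%:R * bohr_coef s nu).
  by rewrite ncM -real_nat nc_real normr_nat.
set A := \sum_(j < Q) expsum s (d * j.+1%:R) * cis (- (d * j.+1%:R * nu)).
have -> : Q%:R * bohr_coef s nu = A - (A - Q%:R * bohr_coef s nu) by ring.
apply: (le_trans (ncB _ _)).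
rewrite [K1 + K2]addrC addrA; apply: lerD; last exact: hK1.
have -> : Q%:R * complex.Re (bohr_coef h 0) = complex.Re (Q%:R * bohr_coef h 0).
  by rewrite -real_nat ReM_real.
set B := \sum_(j < Q) expsum h (d * j.+1%:R) * cis (- (d * j.+1%:R * 0)).
have hB : nc (B - Q%:R * bohr_coef h 0) <= K2 by apply: hK2.
have hAB : nc A <= complex.Re B.
  rewrite /A /B Re_sum; apply: (le_trans (nc_sum _ _ _)).
  apply: ler_sum => j _; rewrite ncM nc_cis mulr1 mulr0 oppr0 cis0 mulr1.
  by apply: hle; rewrite mulr_gt0.
apply: (le_trans hAB); rewrite -lerBlDl.
have := le_trans (ler_norm _) (le_trans (Re_le_nc _) hB).
by rewrite raddfB.
Qed.

End ExpSum.

(** * The argument on the unit circle *)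

Section Argument.
Variable R : realType.
Local Notation C := R[i].
Implicit Types (z w : C) (x y t : R).

Lemma sin_mvt x : 0 < x -> exists2 c, 0 < c < x & sin x = x * cos c.
Proof.
move=> x0.
have [|c hc] := @MVT R (@sin R) (@cos R) 0 x x0 (fun y _ => is_derive_sin y).
  by apply: continuous_subspaceT => y; exact: continuous_sin.
rewrite sin0 !subr0 mulrC => E; exists c => //.
Qed.

Lemma sin_le_id x : 0 <= x -> sin x <= x.
Proof.
rewrite le_eqVlt => /orP[/eqP<-|x0]; first by rewrite sin0.
have [c _ ->] := sin_mvt x0.
by rewrite ler_piMr ?cos_le1// ltW.
Qed.

(** By the mean value theorem sin (x / 2) is x / 2 times a cosine larger than
    cos (x / 2), whose square is at least 1 / 2; then double the angle. *)
Lemma sin_ge_half x : 0 <= x <= pi / 2 -> x / 2 <= sin x.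
Proof.
move=> /andP[]; rewrite le_eqVlt => /orP[/eqP<-|x0 xpi].
  by rewrite sin0 mul0r.
have y0 : 0 < x / 2 by rewrite divr_gt0.
have [c /andP[c0 cx] E] := sin_mvt y0.
have hp := pi_gt0 R.
have hc : cos (x / 2) <= cos c.
  by rewrite ltW// ltr_cos// in_itv/=; apply/andP; split; lra.
have hy : 0 <= cos (x / 2) by apply: cos_ge0_pihalf; apply/andP; split; lra.
have h2 : 0 <= cos x by apply: cos_ge0_pihalf; apply/andP; split; lra.
have E2 : x = (x / 2) *+ 2 by rewrite mulr2n; lra.
have h3 : cos x = 2 * cos (x / 2) ^+ 2 - 1.
  by rewrite {1}E2 cos_mulr2n mulr_natl.
have -> : sin x = 2 * (cos (x / 2) * sin (x / 2)).
  by rewrite {1}E2 sin_mulr2n mulr_natl.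
rewrite E.
have h4 : cos (x / 2) * (x / 2 * cos (x / 2)) <= cos (x / 2) * (x / 2 * cos c).
  by rewrite ler_wpM2l// ler_wpM2l// ltW.
move: h2; rewrite h3; set a := cos (x / 2) in h4 *; set b := cos c in h4 *.
move=> h2.
have h5 : 0 <= x / 2 * (2 * a ^+ 2 - 1) by apply: mulr_ge0 => //; exact: ltW.
rewrite -subr_ge0.
have -> : 2 * (a * (x / 2 * b)) - x / 2 =
  2 * (a * (x / 2 * b) - a * (x / 2 * a)) + x / 2 * (2 * a ^+ 2 - 1) by ring.
by rewrite addr_ge0// mulr_ge0// subr_ge0.
Qed.

Lemma chord_sqr t : nc (cis t - 1) ^+ 2 = (2 * sin (t / 2)) ^+ 2.
Proof.
rewrite nc_sqr /=.
have E2 : t = (t / 2) *+ 2 by rewrite mulr2n; lra.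
rewrite {1 2}E2 cos_mulr2n sin_mulr2n; have := cos2Dsin2 (t / 2).
set c := cos _; set s := sin _ => h.
have hc : c ^+ 2 = 1 - s ^+ 2 by rewrite -h; ring.
rewrite subr0.
transitivity (4 * (c ^+ 2 - 1) ^+ 2 + 4 * c ^+ 2 * s ^+ 2); first by ring.
by rewrite hc; ring.
Qed.

Lemma chordE t : nc (cis t - 1) = 2 * `|sin (t / 2)|.
Proof.
have h : 0 <= 2 * `|sin (t / 2)| by rewrite mulr_ge0.
apply/eqP; rewrite -(@eqrXn2 _ 2)// ?nc_ge0// chord_sqr !exprMn.
by rewrite real_normK ?num_real.
Qed.

Lemma chord_le t : nc (cis t - 1) <= `|t|.
Proof.
rewrite chordE.
wlog t0 : t / 0 <= t.
  move=> h; case: (leP 0 t) => [|t0]; first exact: h.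
  by rewrite -(normrN t) -(normrN (sin _)) -sinN -mulNr h// oppr_ge0 ltW.
rewrite (ger0_norm t0).
have h1 : sin (t / 2) <= t / 2 by rewrite sin_le_id// divr_ge0.
have [h2|h2] := leP 0 (sin (t / 2)); first by rewrite (ger0_norm h2); lra.
rewrite (ltr0_norm h2).
have h3 := sin_geN1 (t / 2).
have [h4|h4] := leP 2 t; first by lra.
suff : 0 <= sin (t / 2) by lra.
apply: sin_ge0_pi; have := pi_ge2 R; move=> ?; apply/andP; split; lra.
Qed.

Lemma chord_ge t : `|t| <= pi -> `|t| <= 2 * nc (cis t - 1).
Proof.
rewrite chordE.
wlog t0 : t / 0 <= t.
  move=> h; case: (leP 0 t) => [|t0]; first exact: h.
  by rewrite -(normrN t) -(normrN (sin _)) -sinN -mulNr; apply: h; rewrite oppr_ge0 ltW.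
rewrite (ger0_norm t0) => tpi.
have h : t / 2 / 2 <= sin (t / 2) by apply: sin_ge_half; apply/andP; split; lra.
have := ler_norm (sin (t / 2)); lra.
Qed.

Lemma cisB_chord x y : nc (cis x - cis y) = nc (cis (x - y) - 1).
Proof.
have -> : cis x - cis y = cis y * (cis (x - y) - 1).
  by rewrite mulrBr -cisD mulr1; congr (cis _ - _); ring.
by rewrite ncM nc_cis mul1r.
Qed.

(** The branch with values in [0, 2 pi): its jump at 1 is what records that an
    eigenvalue passes through 1. *)
Definition Arg z : R :=
  if 0 <= complex.Im z then acos (complex.Re z) else pi *+ 2 - acos (complex.Re z).

Lemma circle_Re z : nc z = 1 -> -1 <= complex.Re z <= 1.
Proof. by move=> z1; rewrite -ler_norml -z1; exact: Re_le_nc. Qed.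

Lemma Arg_ge0 z : nc z = 1 -> 0 <= Arg z.
Proof.
move=> /circle_Re h; rewrite /Arg; case: ifP => _; first exact: acos_ge0.
by rewrite subr_ge0 (le_trans (acos_lepi h))// mulr2n lerDl pi_ge0.
Qed.

Lemma cis_Arg z : nc z = 1 -> cis (Arg z) = z.
Proof.
move=> z1; have h := circle_Re z1.
have hs : sin (acos (complex.Re z)) = `|complex.Im z|.
  rewrite sin_acos//; have := nc_sqr z; rewrite z1 expr1n => ->.
  by rewrite addrAC subrr add0r sqrtr_sqr.
rewrite /Arg; case: ifP => [i0|/negbT]; rewrite /cis.
  by rewrite hs acosK ?in_itv//= ger0_norm//; case: z {z1 h hs i0}.
rewrite -ltNge => i0; rewrite addrC cosD2pi sinD2pi cosN sinN hs acosK ?in_itv//=.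
by rewrite ltr0_norm// opprK; case: z {z1 h hs i0}.
Qed.

Lemma Arg_lt2pi z : nc z = 1 -> Arg z < pi *+ 2.
Proof.
move=> z1; have h := circle_Re z1; have hp := pi_gt0 R.
rewrite /Arg; case: ifP => [i0|/negbT].
  by rewrite (le_lt_trans (acos_lepi h))// mulr2n ltrDl.
rewrite -ltNge => i0; rewrite ltrBlDr ltrDl acos_gt0//.
have /andP[-> h2] /= := h; rewrite lt_neqAle h2 andbT; apply/eqP => E.
have := nc_sqr z; rewrite z1 E expr1n -[LHS]addr0 => /addrI/esym/eqP.
by rewrite sqrf_eq0 => /eqP E2; rewrite E2 ltxx in i0.
Qed.

Lemma Arg_le2pi z : nc z = 1 -> Arg z <= pi *+ 2.
Proof. by move=> /Arg_lt2pi/ltW. Qed.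

Lemma Arg_norm z : nc z = 1 -> `|Arg z| <= pi *+ 2.
Proof. by move=> z1; rewrite ger0_norm ?Arg_ge0// Arg_le2pi. Qed.

Lemma cis_inj_02pi x y :
  0 <= x < pi *+ 2 -> 0 <= y < pi *+ 2 -> cis x = cis y -> x = y.
Proof.
wlog xy : x y / x <= y.
  move=> h hx hy E; case: (leP x y) => [|/ltW] xy; first exact: h.
  by apply/esym/h.
move=> /andP[x0 x2] /andP[y0 y2] E; apply/eqP; apply/negPn/negP => nxy.
have hlt : x < y by rewrite lt_neqAle nxy.
have : nc (cis y - cis x) = 0 by rewrite E subrr nc0.
rewrite cisB_chord chordE => /eqP; rewrite mulf_eq0 pnatr_eq0 /= normr_eq0.
suff : 0 < sin ((y - x) / 2) by move=> /gt_eqF ->.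
rewrite mulr2n in x2 y2.
by apply: sin_gt0_pi; apply/andP; split; lra.
Qed.

Lemma Arg_cis t : 0 <= t < pi *+ 2 -> Arg (cis t) = t.
Proof.
move=> ht; apply: cis_inj_02pi => //; last by rewrite cis_Arg// nc_cis.
by rewrite Arg_ge0 ?nc_cis// Arg_lt2pi ?nc_cis.
Qed.

Lemma Arg1 : Arg 1 = 0.
Proof. by rewrite -cis0 Arg_cis// lexx mulrn_wgt0// pi_gt0. Qed.

Lemma Arg_conj z : nc z = 1 -> z != 1 -> Arg z^*%C = pi *+ 2 - Arg z.
Proof.
move=> z1 zn1.
have h0 : 0 < Arg z.
  rewrite lt_neqAle Arg_ge0// andbT; apply: contraNneq zn1 => h.
  by rewrite -(cis_Arg z1) -h cis0.
have h2 := Arg_lt2pi z1.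
rewrite -{1}(cis_Arg z1) -cisN.
have -> : cis (- Arg z) = cis (pi *+ 2 - Arg z) by rewrite cisD cis2pi mul1r.
by rewrite Arg_cis//; apply/andP; split; lra.
Qed.

(** [Arg] jumps at 1; multiplying by a ramp vanishing at 1 makes it Lipschitz
    without changing it at distance at least [e] from 1. *)
Definition ramp (e : R) z : R := Num.min 1 (nc (z - 1) / e).
Definition softArg (e : R) z : R := Arg z * ramp e z.

Lemma ramp_ge0 e z : 0 < e -> 0 <= ramp e z.
Proof. by move=> e0; rewrite le_min ler01 divr_ge0 ?nc_ge0// ltW. Qed.

Lemma ramp_le1 e z : ramp e z <= 1.
Proof. by rewrite ge_min lexx. Qed.

Lemma ramp_eq1 e z : 0 < e -> e <= nc (z - 1) -> ramp e z = 1.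
Proof. by move=> e0 h; rewrite /ramp min_l// ler_pdivlMr// mul1r. Qed.

Lemma ramp_le e z : ramp e z <= nc (z - 1) / e.
Proof. by rewrite ge_min lexx orbT. Qed.

Lemma min1_lip x y : `|Num.min 1 x - Num.min 1 y| <= `|x - y|.
Proof.
wlog xy : x y / x <= y.
  move=> h; case: (leP x y) => [|/ltW] xy; first exact: h.
  by rewrite distrC [leRHS]distrC h.
have h : Num.min 1 x <= Num.min 1 y by rewrite le_min !ge_min lexx xy orbT.
rewrite distrC ger0_norm ?subr_ge0// distrC ger0_norm ?subr_ge0//.
by rewrite /Num.min; case: ltP => ?; case: ltP => ?; lra.
Qed.

Lemma ramp_lip e z w : 0 < e -> `|ramp e z - ramp e w| <= nc (z - w) / e.
Proof.
move=> e0; apply: (le_trans (min1_lip _ _)).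
rewrite -mulrBl normrM [`|e^-1|]gtr0_norm ?invr_gt0// ler_wpM2r ?invr_ge0 ?(ltW e0)//.
rewrite ler_norml; apply/andP; split.
  have := ncD (w - z) (z - 1); have -> : w - z + (z - 1) = w - 1 by ring.
  by rewrite -(ncN (z - w)) opprB; lra.
have := ncD (z - w) (w - 1); have -> : z - w + (w - 1) = z - 1 by ring.
by lra.
Qed.

(** If the arguments differ by at most pi, both factors are Lipschitz. Otherwise
    the shorter arc joining z and w passes through 1, so both points are within
    about |z - w| of 1, where the ramp is small. *)
Lemma softArg_lip e : 0 < e -> exists2 K, 0 < K &
  forall z w, nc z = 1 -> nc w = 1 ->
    `|softArg e z - softArg e w| <= K * nc (z - w).
Proof.
move=> e0; have hp := pi_gt0 R.
have hpe : 0 < pi / e by rewrite divr_gt0.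
exists (2 + 4 * (pi / e)); first by lra.
move=> z w; wlog hzw : z w / Arg z <= Arg w.
  move=> h hz hw; case: (leP (Arg z) (Arg w)) => [|/ltW] hzw; first exact: h.
  by rewrite distrC -(ncN (z - w)) opprB h.
move=> hz hw.
have hd0 : 0 <= nc (z - w) := nc_ge0 _.
have hAw0 := Arg_ge0 hw; have hAw := Arg_le2pi hw; have hAz0 := Arg_ge0 hz.
rewrite mulr2n in hAw.
have hpd : 0 <= pi / e * nc (z - w) by rewrite mulr_ge0// ltW.
have [hle|hgt] := leP (Arg w - Arg z) pi.
  have -> : softArg e z - softArg e w =
     (Arg z - Arg w) * ramp e z + Arg w * (ramp e z - ramp e w).
    by rewrite /softArg; ring.
  apply: (le_trans (ler_normD _ _)).
  have h1 : `|Arg z - Arg w| <= 2 * nc (z - w).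
    rewrite -{2}(cis_Arg hz) -{2}(cis_Arg hw) cisB_chord; apply: chord_ge.
    by rewrite distrC ger0_norm ?subr_ge0.
  have h2 : `|(Arg z - Arg w) * ramp e z| <= 2 * nc (z - w).
    rewrite normrM [`|ramp e z|]ger0_norm ?ramp_ge0//.
    by apply: le_trans h1; rewrite ler_piMr ?ramp_le1.
  have h3 : `|Arg w * (ramp e z - ramp e w)| <= (pi + pi) * (nc (z - w) / e).
    rewrite normrM ger0_norm// ler_pM// ?ramp_lip//.
  have -> : (2 + 4 * (pi / e)) * nc (z - w) =
     2 * nc (z - w) + 4 * (pi / e * nc (z - w)) by ring.
  have E : (pi + pi) * (nc (z - w) / e) = 2 * (pi / e * nc (z - w)) by ring.
  by rewrite E in h3; lra.
have hz1 : nc (z - 1) <= Arg z.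
  rewrite -{1}(cis_Arg hz); apply: (le_trans (chord_le _)).
  by rewrite ger0_norm.
have hw1 : nc (w - 1) <= pi + pi - Arg w.
  rewrite -{1}(cis_Arg hw); have -> : cis (Arg w) = cis (Arg w - pi *+ 2).
    by rewrite cisD cisN cis2pi conjc1 mulr1.
  apply: (le_trans (chord_le _)).
  by rewrite mulr2n distrC ger0_norm; lra.
have hzw2 : Arg z + (pi + pi - Arg w) <= 2 * nc (z - w).
  have := @chord_ge (Arg z - (Arg w - pi *+ 2)).
  rewrite -cisB_chord [cis (Arg w - _)]cisD cisN cis2pi conjc1 mulr1 !cis_Arg//.
  by rewrite mulr2n ger0_norm; lra.
have gz : `|softArg e z| <= (pi + pi) * (nc (z - 1) / e).
  rewrite /softArg normrM (ger0_norm hAz0) [`|ramp e z|]ger0_norm ?ramp_ge0//.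
  by rewrite ler_pM// ?ramp_ge0// ?ramp_le//; lra.
have gw : `|softArg e w| <= (pi + pi) * (nc (w - 1) / e).
  rewrite /softArg normrM (ger0_norm hAw0) [`|ramp e w|]ger0_norm ?ramp_ge0//.
  by rewrite ler_pM// ?ramp_ge0// ?ramp_le//; lra.
apply: (le_trans (ler_normB _ _)).
have h : pi / e * (nc (z - 1) + nc (w - 1)) <= pi / e * (2 * nc (z - w)).
  by rewrite ler_wpM2l//; lra.
have E1 : (pi + pi) * (nc (z - 1) / e) = 2 * (pi / e * nc (z - 1)) by ring.
have E2 : (pi + pi) * (nc (w - 1) / e) = 2 * (pi / e * nc (w - 1)) by ring.
rewrite E1 in gz; rewrite E2 in gw.
rewrite mulrDl; rewrite mulrDr in h.
have -> : 4 * (pi / e) * nc (z - w) = 2 * (pi / e * (2 * nc (z - w))) by ring.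
have : 0 <= 2 * nc (z - w) by lra.
by lra.
Qed.

End Argument.

(** * Trigonometric approximation by Fejer sampling *)

Section Fejer.
Variable R : realType.
Local Notation C := R[i].
Implicit Types (z w : C) (x y t : R).

(** The real trigonometric polynomial whose coefficients at opposite frequencies
    are conjugate. *)
Definition trigp (c0 : R) (c : nat -> C) (N : nat) z : R :=
  c0 + 2 * complex.Re (\sum_(n < N) c n * z ^+ n.+1).

(** The square of a geometric sum is N times the Fejer kernel. *)
Lemma fejer_square z N : nc z = 1 ->
  nc (\sum_(j < N) z ^+ j) ^+ 2 =
  trigp N%:R (fun n => (N - n.+1)%:R) N z.
Proof.
move=> z1; rewrite /trigp; elim: N => [|N IH].
  by rewrite !big_ord0 nc0 expr0n mulr0 addr0.
have zz : z * z^*%C = 1 by rewrite mulC_conj z1 expr1n.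
have zzX n : z ^+ n * (z^*%C) ^+ n = 1 by rewrite -exprMn zz expr1n.
rewrite big_ord_recr /=; set A := \sum_(j < N) z ^+ j.
have E : nc (A + z ^+ N) ^+ 2 =
    nc A ^+ 2 + 1 + 2 * complex.Re (z ^+ N * A^*%C).
  apply: complexI; rewrite !rmorphD /= -!mulC_conj -add_conj rmorph1.
  rewrite !conjcM conjcK rmorphD /= conjcX mulrDl !mulrDr zzX; ring.
rewrite E IH.
have -> : z ^+ N * A^*%C = \sum_(n < N) z ^+ n.+1.
  rewrite /A conjc_sum mulr_sumr (reindex_inj rev_ord_inj) /=.
  apply: eq_bigr => j _; rewrite conjcX.
  by rewrite -[X in z ^+ X * _](subnKC (ltn_ord j)) exprD -mulrA zzX mulr1.
rewrite [X in _ = _ + 2 * complex.Re X]big_ord_recr /= subnn mul0r addr0.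
have -> : \sum_(n < N) (N.+1 - n.+1)%:R * z ^+ n.+1 =
   \sum_(n < N) (N - n.+1)%:R * z ^+ n.+1 + \sum_(n < N) z ^+ n.+1.
  rewrite -big_split /=; apply: eq_bigr => n _.
  by rewrite subSn// -addn1 natrD mulrDl mul1r.
rewrite [complex.Re (_ + _)]raddfD -natr1 /=; ring.
Qed.

Definition node N (q : nat) : C := cis (pi *+ 2 / N%:R * q%:R).

Lemma nc_node N q : nc (node N q) = 1.
Proof. exact: nc_cis. Qed.

Lemma nodeX N q : (0 < N)%N -> node N q ^+ N = 1.
Proof.
move=> N0; have h : N%:R != 0 :> R by rewrite pnatr_eq0 -lt0n.
rewrite /node cisX -(cis2piMn R q); congr cis; field.
exact: h.
Qed.

Lemma node_root N n : (0 < n < N)%N -> node N n != 1.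
Proof.
move=> /andP[n0 nN]; have hp := pi_gt0 R.
have hp2 : 0 < pi *+ 2 :> R by rewrite mulr2n addr_gt0.
have N0 : 0 < N%:R :> R by rewrite ltr0n (ltn_trans n0).
apply/eqP => h.
have : pi *+ 2 / N%:R * n%:R = 0 :> R.
  apply: cis_inj_02pi; rewrite ?cis0//; last by rewrite lexx hp2.
  have h1 : 0 <= pi *+ 2 / N%:R * n%:R :> R.
    by rewrite mulr_ge0// divr_ge0// ltW.
  rewrite h1 /= mulrAC ltr_pdivrMr// ltr_pM2l//.
  by rewrite ltr_nat.
move/eqP; rewrite !mulf_eq0 invr_eq0 !pnatr_eq0.
by rewrite mulrn_eq0 /= (gt_eqF hp) !gtn_eqF// (ltn_trans n0).
Qed.

Lemma node_swap N q n : node N q ^+ n = node N n ^+ q.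
Proof. by rewrite /node !cisX; congr cis; ring. Qed.

Lemma node_conjX N q n : (node N q)^*%C ^+ n = (node N n)^*%C ^+ q.
Proof. by rewrite -!conjcX node_swap. Qed.

Lemma sum_node N n : (0 < n < N)%N -> \sum_(q < N) (node N q)^*%C ^+ n = 0.
Proof.
move=> hn; have N0 : (0 < N)%N by case/andP: hn => _; apply: leq_ltn_trans.
under eq_bigr do rewrite node_conjX.
have h1 : (node N n)^*%C != 1.
  by rewrite -[1]conjc1 (inj_eq (can_inj (@conjcK R))) node_root.
have := subrX1 ((node N n)^*%C) N.
rewrite -conjcX nodeX// conjc1 subrr => /esym/eqP.
by rewrite mulf_eq0 subr_eq0 (negbTE h1) => /eqP.
Qed.

(** The Fejer kernels centred at the N-th roots of unity form a partition of
    unity, each part being concentrated near its node; weighting samples with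
    them turns a Lipschitz function into a trigonometric polynomial by finite
    sums only. *)
Definition fweight N q z : R :=
  nc (\sum_(j < N) (z * (node N q)^*%C) ^+ j) ^+ 2 / N%:R ^+ 2.

Lemma fweight_ge0 N q z : 0 <= fweight N q z.
Proof. by rewrite divr_ge0// sqr_ge0. Qed.

Definition fcoef N (g : C -> R) (n : nat) : C :=
  (N - n.+1)%:R / N%:R ^+ 2 * \sum_(q < N) (g (node N q))%:C%C * (node N q)^*%C ^+ n.+1.
Definition fcoef0 N (g : C -> R) : R := (\sum_(q < N) g (node N q)) / N%:R.

Lemma nat_realC n : n%:R = (n%:R : R)%:C%C :> C.
Proof. by rewrite real_nat. Qed.

Lemma natV2_realC n : n%:R ^- 2 = ((n%:R : R) ^- 2)%:C%C :> C.
Proof. by rewrite nat_realC -rmorphXn -fmorphV. Qed.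

Lemma fejer_sample N g z : (0 < N)%N -> nc z = 1 ->
  \sum_(q < N) g (node N q) * fweight N q z = trigp (fcoef0 N g) (fcoef N g) N z.
Proof.
move=> N0 z1; have hN : N%:R != 0 :> R by rewrite pnatr_eq0 -lt0n.
rewrite /fweight.
under eq_bigr => q _.
  rewrite fejer_square; last by rewrite ncM nc_conj nc_node z1 mulr1.
  rewrite /trigp; over.
rewrite /trigp /fcoef0.
have -> : \sum_(n < N) fcoef N g n * z ^+ n.+1 = \sum_(q < N)
   (g (node N q) / N%:R ^+ 2)%:C%C *
     (\sum_(n < N) (N - n.+1)%:R * (z * (node N q)^*%C) ^+ n.+1).
  transitivity (\sum_(n < N) \sum_(q < N) (g (node N q) / N%:R ^+ 2)%:C%C *
    ((N - n.+1)%:R * (z * (node N q)^*%C) ^+ n.+1)).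
    apply: eq_bigr => n _; rewrite /fcoef mulr_sumr mulr_suml.
    apply: eq_bigr => q _.
    by rewrite natV2_realC rmorphM /= exprMn; ring.
  by rewrite exchange_big /=; apply: eq_bigr => q _; rewrite mulr_sumr.
rewrite Re_sum mulr_sumr mulr_suml -big_split /=; apply: eq_bigr => q _.
by rewrite ReM_real; field.
Qed.

Lemma fweight_sum N z : (0 < N)%N -> nc z = 1 -> \sum_(q < N) fweight N q z = 1.
Proof.
move=> N0 z1; have hN : N%:R != 0 :> R by rewrite pnatr_eq0 -lt0n.
have := @fejer_sample N (fun=> 1) z N0 z1.
under eq_bigr do rewrite mul1r.
move=> ->; rewrite /trigp /fcoef0 sumr_const card_ord divff//.
rewrite big1 ?mulr0 ?addr0// => n _; rewrite /fcoef.
have [->|nN] := eqVneq n.+1 N; first by rewrite subnn !mul0r.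
under eq_bigr do rewrite mul1r.
rewrite (@sum_node N n.+1) ?mulr0 ?mul0r//=.
by rewrite ltn_neqAle nN; exact: (ltn_ord n).
Qed.

Lemma fweight_dist N q z : (0 < N)%N -> nc z = 1 ->
  fweight N q z * nc (z - node N q) ^+ 2 <= 4 / N%:R ^+ 2.
Proof.
move=> N0 z1; have hN : 0 < N%:R :> R by rewrite ltr0n.
set u := z * (node N q)^*%C.
have u1 : nc u = 1 by rewrite ncM nc_conj nc_node z1 mulr1.
have -> : nc (z - node N q) = nc (u - 1).
  have <- : (u - 1) * node N q = z - node N q.
    rewrite mulrBl mul1r /u -mulrA [_^*%C * _]mulrC mulC_conj nc_node expr1n.
    by rewrite mulr1.
  by rewrite ncM nc_node mulr1.
rewrite /fweight -/u mulrAC -exprMn -ncM ler_pM2r ?invr_gt0 ?exprn_gt0//.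
rewrite [_ * (u - 1)]mulrC -subrX1.
have : nc (u ^+ N - 1) <= 2.
  by apply: (le_trans (ncB _ _)); rewrite ncX u1 expr1n nc1.
by move=> h; have := nc_ge0 (u ^+ N - 1); nra.
Qed.

(** For d the distance to a node, d <= t + d^2 / t, and the weights have second
    moments of order 1 / N. *)
Lemma fejer_error N g K t z : (0 < N)%N -> 0 < t -> 0 <= K -> nc z = 1 ->
  (forall w, nc w = 1 -> `|g z - g w| <= K * nc (z - w)) ->
  `|g z - trigp (fcoef0 N g) (fcoef N g) N z| <= K * (t + 4 / (t * N%:R)).
Proof.
move=> N0 t0 K0 z1 hK; have hN : 0 < N%:R :> R by rewrite ltr0n.
rewrite -fejer_sample//.
rewrite -[g z]mulr1 -{1}(fweight_sum N0 z1) mulr_sumr -sumrB.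
apply: (le_trans (ler_norm_sum _ _ _)).
have h q : `|g z * fweight N q z - g (node N q) * fweight N q z| <=
    K * (t * fweight N q z + 4 / (t * N%:R ^+ 2)).
  rewrite -mulrBl normrM [`|fweight _ _ _|]ger0_norm ?fweight_ge0//.
  have h1 : `|g z - g (node N q)| * fweight N q z <=
      K * (nc (z - node N q) * fweight N q z).
    by rewrite mulrA ler_wpM2r ?fweight_ge0// hK// nc_node.
  apply: (le_trans h1); rewrite ler_wpM2l//.
  set d := nc _; set f := fweight _ _ _.
  have h2 : d <= t + d ^+ 2 / t.
    have d0 : 0 <= d := nc_ge0 _.
    have [dt|dt] := leP d t.
      by apply: (le_trans dt); rewrite lerDl divr_ge0 ?sqr_ge0// ltW.
    apply: (@le_trans _ _ (d ^+ 2 / t)); last by rewrite lerDr ltW.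
    by rewrite ler_pdivlMr// expr2 ler_wpM2l// ltW.
  have h3 : d * f <= (t + d ^+ 2 / t) * f by rewrite ler_wpM2r// fweight_ge0.
  apply: (le_trans h3); rewrite mulrDl lerD2l.
  have h4 := fweight_dist q N0 z1; rewrite -/f -/d in h4.
  have -> : d ^+ 2 / t * f = (f * d ^+ 2) / t by ring.
  have -> : 4 / (t * N%:R ^+ 2) = 4 / N%:R ^+ 2 / t.
    by field; rewrite !gt_eqF.
  by rewrite ler_wpM2r// invr_ge0 ltW.
have hs : \sum_(q < N) `|g z * fweight N q z - g (node N q) * fweight N q z| <=
    \sum_(q < N) K * (t * fweight N q z + 4 / (t * N%:R ^+ 2)).
  by apply: ler_sum => q _; exact: h.
apply: (le_trans hs).
rewrite -mulr_sumr big_split /= -mulr_sumr fweight_sum// mulr1.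
rewrite sumr_const card_ord -[X in _ + X]mulr_natr.
rewrite ler_wpM2l// lerD2l expr2.
by rewrite le_eqVlt; apply/orP; left; apply/eqP; field; rewrite !gt_eqF.
Qed.

Lemma natP_gt x : exists N0 : nat, forall N, (N0 <= N)%N -> x < N%:R.
Proof.
exists (Num.truncn x).+1 => N hN; apply: (lt_le_trans (truncnS_gt x)).
by rewrite ler_nat.
Qed.

Lemma fejer_approx g K eps : 0 <= K -> 0 < eps ->
  (forall z w, nc z = 1 -> nc w = 1 -> `|g z - g w| <= K * nc (z - w)) ->
  exists N0 : nat, forall N, (N0 <= N)%N -> (0 < N)%N -> forall z, nc z = 1 ->
    `|g z - trigp (fcoef0 N g) (fcoef N g) N z| <= eps.
Proof.
move=> K0 e0 hK.
pose t := eps / (2 * (K + 1)).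
have hK1 : 0 < K + 1 by rewrite ltr_wpDl.
have t0 : 0 < t by rewrite divr_gt0// mulr_gt0.
have [N0 hN0] := natP_gt (4 / t / t).
exists N0 => N hNN N1 z z1.
have hN : 0 < N%:R :> R by rewrite ltr0n.
apply: (le_trans (fejer_error N1 t0 K0 z1 (fun w => hK z w z1))).
have h : 4 / (t * N%:R) <= t.
  rewrite invfM mulrA ler_pdivrMr// -ler_pdivrMl// mulrC.
  exact/ltW/hN0.
have h2 : K * (t + 4 / (t * N%:R)) <= (K + 1) * (t + t).
  have h0 : 0 <= 4 / (t * N%:R) by rewrite divr_ge0// mulr_ge0 ?ltW.
  by apply: ler_pM; rewrite ?addr_ge0 ?lerD2l ?lerDl// ltW.
apply: (le_trans h2); rewrite /t.
by rewrite le_eqVlt; apply/orP; left; apply/eqP; field; rewrite gt_eqF.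
Qed.

End Fejer.

Section ArgApprox.
Variable R : realType.
Local Notation C := R[i].
Implicit Types (z w : C) (x y t : R).

Lemma node_Arg N q : (q < N)%N -> Arg (node R N q) = pi *+ 2 / N%:R * q%:R.
Proof.
move=> qN; have hp := pi_gt0 R.
have hp2 : 0 < pi *+ 2 :> R by rewrite mulr2n addr_gt0.
have N0 : 0 < N%:R :> R by rewrite ltr0n (leq_ltn_trans _ qN).
rewrite Arg_cis//; apply/andP; split.
  by rewrite mulr_ge0// divr_ge0// ltW.
by rewrite mulrAC ltr_pdivrMr// ltr_pM2l// ltr_nat.
Qed.

(** This evaluates the sampled Fourier coefficients of the sawtooth [Arg]. *)
Lemma sum_arith_geom (x : C) N : x ^+ N = 1 -> x != 1 ->
  \sum_(q < N) q%:R * x ^+ q = N%:R / (x - 1).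
Proof.
move=> xN x1; have h : x - 1 != 0 by rewrite subr_eq0.
apply: (canRL (mulfK h)).
have E M : (\sum_(q < M) q%:R * x ^+ q) * (x - 1) =
    M%:R * x ^+ M - \sum_(q < M) x ^+ q.+1.
  elim: M => [|M IH]; first by rewrite !big_ord0 !mul0r subrr.
  by rewrite !big_ord_recr /= mulrDl IH exprS -natr1; ring.
rewrite E xN mulr1.
have -> : \sum_(q < N) x ^+ q.+1 = 0; last by rewrite subr0.
under eq_bigr do rewrite exprS.
rewrite -mulr_sumr; have := subrX1 x N; rewrite xN subrr => /esym/eqP.
by rewrite mulf_eq0 (negbTE h) /= => /eqP ->; rewrite mulr0.
Qed.

Lemma sum_nat_ord N : \sum_(q < N) (q%:R : R) = N%:R * (N%:R - 1) / 2.
Proof.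
elim: N => [|N IH]; first by rewrite big_ord0 !mul0r.
by rewrite big_ord_recr /= IH -natr1; field.
Qed.

(** The square of a geometric sum dominates the indicator of a short arc
    around 1 while its mean value tends to 0. *)
Definition bump (m : nat) z : R := 4 / m%:R ^+ 2 * nc (\sum_(j < m) z ^+ j) ^+ 2.

Lemma bump_ge0 m z : 0 <= bump m z.
Proof. by rewrite mulr_ge0 ?sqr_ge0// divr_ge0 ?sqr_ge0. Qed.

Lemma nc_Xsub1 z n : nc z = 1 -> nc (z ^+ n - 1) <= n%:R * nc (z - 1).
Proof.
move=> z1; rewrite subrX1 ncM mulrC ler_wpM2r ?nc_ge0//.
apply: (le_trans (nc_sum _ _ _)).
by under eq_bigr do rewrite ncX z1 expr1n; rewrite sumr_const card_ord.
Qed.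

Lemma bump_ge1 m z : (0 < m)%N -> nc z = 1 -> nc (z - 1) <= m%:R^-1 ->
  1 <= bump m z.
Proof.
move=> m0 z1 h; have hm : 0 < m%:R :> R by rewrite ltr0n.
have h1 : nc (\sum_(j < m) z ^+ j - m%:R) <= m%:R / 2.
  have -> : \sum_(j < m) z ^+ j - m%:R = \sum_(j < m) (z ^+ j - 1).
    by rewrite sumrB sumr_const card_ord.
  apply: (le_trans (nc_sum _ _ _)).
  apply: (@le_trans _ _ (\sum_(j < m) j%:R * m%:R^-1)).
    apply: ler_sum => j _; apply: (le_trans (nc_Xsub1 _ z1)).
    by rewrite ler_wpM2l.
  rewrite -mulr_suml sum_nat_ord.
  have -> : m%:R * (m%:R - 1) / 2 / m%:R = (m%:R - 1) / 2 :> R.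
    by field; rewrite gt_eqF.
  by rewrite ler_wpM2r// lerBlDr lerDl.
have h2 : m%:R / 2 <= nc (\sum_(j < m) z ^+ j).
  set A := \sum_(j < m) _ in h1 *.
  have := ncB A (A - m%:R); have -> : A - (A - m%:R) = m%:R by ring.
  have -> : nc (m%:R : C) = m%:R by rewrite nat_realC nc_real ger0_norm// ltW.
  by lra.
rewrite /bump mulrAC ler_pdivlMr ?exprn_gt0// mul1r.
have -> : m%:R ^+ 2 = 4 * (m%:R / 2) ^+ 2 :> R by field.
by rewrite ler_wpM2l// ler_sqr ?nnegrE ?nc_ge0// divr_ge0// ltW.
Qed.

Definition bump_coef (m n : nat) : C := (4 / m%:R ^+ 2 * (m - n.+1)%:R : R)%:C%C.

Lemma bump_trigp m z : (0 < m)%N -> nc z = 1 ->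
  bump m z = trigp (4 / m%:R) (bump_coef m) m z.
Proof.
move=> m0 z1; have hm : m%:R != 0 :> R by rewrite pnatr_eq0 -lt0n.
rewrite /bump fejer_square// /trigp mulrDr; congr (_ + _); first by field.
rewrite mulrCA -ReM_real mulr_sumr; congr (_ * complex.Re _).
apply: eq_bigr => n _; rewrite mulrA; congr (_ * _).
by rewrite /bump_coef -[in LHS]real_nat -rmorphM.
Qed.

Lemma Arg_softArg m z : (0 < m)%N -> nc z = 1 ->
  `|Arg z - softArg m%:R^-1 z| <= pi *+ 2 * bump m z.
Proof.
move=> m0 z1; have hm : 0 < m%:R^-1 :> R by rewrite invr_gt0 ltr0n.
have hp2 : 0 <= pi *+ 2 :> R by rewrite mulr2n addr_ge0// pi_ge0.
have [h|/ltW h] := leP m%:R^-1 (nc (z - 1)).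
  by rewrite /softArg ramp_eq1// mulr1 subrr normr0 mulr_ge0// bump_ge0.
rewrite /softArg -[X in X - _]mulr1 -mulrBr normrM.
apply: ler_pM => //; first exact: Arg_norm.
apply: le_trans (bump_ge1 m0 z1 h).
rewrite ger0_norm ?subr_ge0 ?ramp_le1//.
by rewrite lerBlDr lerDl ramp_ge0.
Qed.

(** Sampling at N >= m nodes integrates polynomials of degree below m exactly. *)
Lemma bump_mean m N : (0 < m)%N -> (m <= N)%N ->
  (\sum_(q < N) bump m (node R N q)) / N%:R = 4 / m%:R.
Proof.
move=> m0 mN; have N0 : (0 < N)%N by apply: leq_trans mN.
have hN : N%:R != 0 :> R by rewrite pnatr_eq0 -lt0n.
under eq_bigr => q _.
  rewrite bump_trigp ?nc_node// /trigp; over.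
rewrite big_split /= sumr_const card_ord -mulr_sumr -Re_sum.
rewrite (_ : \sum_(q < N) _ = 0) ?mulr0 ?addr0.
  by rewrite -[X in X / N%:R]mulr_natr mulfK.
rewrite exchange_big /= big1// => n _; rewrite -mulr_sumr.
have [E|nm] := eqVneq n.+1 m.
  by rewrite /bump_coef E subnn mulr0 mul0r.
suff -> : \sum_(q < N) node R N q ^+ n.+1 = 0 by rewrite mulr0.
apply: (can_inj (@conjcK R)); rewrite conjc0 conjc_sum.
under eq_bigr do rewrite conjcX.
apply: sum_node => //=; apply: leq_trans mN.
by rewrite ltn_neqAle nm; exact: (ltn_ord n).
Qed.

Lemma fcoef_scaleE N n :
  (N - n)%:R / N%:R ^+ 2 = ((N - n)%:R / N%:R ^+ 2 : R)%:C%C :> C.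
Proof. by rewrite natV2_realC rmorphM /= real_nat. Qed.

(** With x the conjugate of the node of index n + 1 the sampled coefficient is
    2 pi / (x - 1) up to a positive factor, and the imaginary part of 1 / (x - 1)
    is at least 1 over twice the angle of the node. *)
Lemma Arg_fcoef_im N n : (4 * n.+1 <= N)%N ->
  3 / (8 * n.+1%:R) <= complex.Im (fcoef N (@Arg R) n).
Proof.
move=> hN; have hp := pi_gt0 R.
have nN : (n.+1 < N)%N by apply: leq_trans hN; rewrite mulnC; lia.
have N0 : 0 < N%:R :> R by rewrite ltr0n (leq_ltn_trans _ nN).
have n0 : 0 < n.+1%:R :> R by rewrite ltr0n.
have hNR : 4 * n.+1%:R <= N%:R :> R by rewrite -natrM ler_nat.
pose x := (node R N n.+1)^*%C.
have x1 : nc x = 1 by rewrite nc_conj nc_node.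
have xn1 : x != 1.
  by rewrite -[1]conjc1 (inj_eq (can_inj (@conjcK R))) node_root.
have xN : x ^+ N = 1 by rewrite -conjcX nodeX ?conjc1// (leq_ltn_trans _ nN).
have E1 : \sum_(q < N) (Arg (node R N q))%:C%C * (node R N q)^*%C ^+ n.+1 =
    (pi *+ 2)%:C%C / (x - 1).
  transitivity ((pi *+ 2 / N%:R)%:C%C * \sum_(q < N) q%:R * x ^+ q).
    rewrite mulr_sumr; apply: eq_bigr => q _; rewrite node_Arg// node_conjX.
    by rewrite -[q%:R in RHS]real_nat mulrA -rmorphM.
  rewrite sum_arith_geom// mulrA; congr (_ / _).
  by rewrite -real_nat -rmorphM /= divfK ?gt_eqF.
rewrite /fcoef E1.
rewrite fcoef_scaleE.
rewrite ImM_real ImM_real.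
set phi := pi *+ 2 / N%:R * n.+1%:R : R.
have phi0 : 0 < phi by rewrite mulr_gt0// divr_gt0// mulr2n addr_gt0.
have hphi : phi <= pi / 2.
  rewrite /phi mulrAC ler_pdivrMr// mulr2n.
  have : (pi / 2) * (4 * n.+1%:R) <= pi / 2 * N%:R :> R.
    by rewrite ler_wpM2l// divr_ge0// ltW.
  by lra.
have xE : x = cis (- phi) by rewrite cisN.
have xs : nc (x - 1) <= phi.
  by rewrite xE (le_trans (chord_le _))// normrN gtr0_norm.
have d0 : 0 < nc (x - 1) by rewrite nc_gt0 subr_eq0.
have Ei : complex.Im (x - 1)^-1 = sin phi / nc (x - 1) ^+ 2.
  rewrite nc_sqr xE /cis cosN sinN /=; set a := cos phi; set b := sin phi.
  by rewrite !subr0 mulNr opprK.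
have hi : 1 / (2 * phi) <= complex.Im (x - 1)^-1.
  rewrite Ei ler_pdivlMr ?exprn_gt0//.
  have h1 : nc (x - 1) ^+ 2 <= phi ^+ 2 by rewrite ler_sqr ?nnegrE ?nc_ge0// ltW.
  have h2 : phi / 2 <= sin phi by apply: sin_ge_half; rewrite hphi ltW.
  apply: le_trans h2.
  apply: (@le_trans _ _ (1 / (2 * phi) * phi ^+ 2)).
    by rewrite ler_wpM2l// divr_ge0// mulr_ge0// ltW.
  by rewrite le_eqVlt; apply/orP; left; apply/eqP; field; rewrite gt_eqF.
have hc : 0 <= (N - n.+1)%:R / N%:R ^+ 2 :> R by rewrite divr_ge0// sqr_ge0.
apply: le_trans (_ : (N - n.+1)%:R / N%:R ^+ 2 * (pi *+ 2 * (1 / (2 * phi))) <= _).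
  rewrite /phi natrB ?(ltnW nN)//.
  have -> : (N%:R - n.+1%:R) / N%:R ^+ 2 * (pi *+ 2 * (1 / (2 * (pi *+ 2 / N%:R * n.+1%:R)))) =
     (N%:R - n.+1%:R) / (2 * N%:R * n.+1%:R) :> R.
    have aux (A B P : R) : 0 < A -> 0 < B -> 0 < P ->
      (A - B) / A ^+ 2 * (P * (1 / (2 * (P / A * B)))) = (A - B) / (2 * A * B).
      by move=> A0 B0 P0; field; rewrite !gt_eqF.
    by apply: aux => //; rewrite mulr2n addr_gt0.
  rewrite ler_pdivrMr; last by rewrite mulr_gt0.
  rewrite mulrAC ler_pdivlMr; last by rewrite !mulr_gt0.
  have : 0 <= n.+1%:R * (N%:R - 4 * n.+1%:R) :> R by rewrite mulr_ge0 ?subr_ge0.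
  by lra.
by rewrite ler_wpM2l// ler_wpM2l// mulr2n addr_ge0// ltW.
Qed.

(** Trigonometric polynomials approximate [Arg] up to a nonnegative
    trigonometric polynomial of small mean; their low coefficients stay close to
    the Fourier coefficients i/n of the sawtooth. *)
Lemma Arg_trig_approx (n0 : nat) (eps : R) : 0 < eps ->
  exists N c0 (c : nat -> C) M a0 (a : nat -> C),
  [/\ forall z, nc z = 1 -> `|Arg z - trigp c0 c N z| <= trigp a0 a M z,
      a0 <= eps, `|c0 - pi| <= eps, (n0 <= N)%N
    & forall n, (n < n0)%N -> 1 / (4 * n.+1%:R) <= complex.Im (c n)].
Proof.
move=> e0; have hp := pi_gt0 R.
have hp2 : 0 < pi *+ 2 :> R by rewrite mulr2n addr_gt0.
pose e1 := Num.min (eps / 2) (1 / (8 * n0.+1%:R)).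
have e10 : 0 < e1 by rewrite lt_min !divr_gt0// mulr_gt0.
have [m0 hm0] := natP_gt (pi *+ 2 * 4 / e1).
pose m := m0.+1; have m_gt0 : 0 < m%:R :> R by rewrite ltr0n.
have hm : pi *+ 2 * (4 / m%:R) <= e1.
  rewrite mulrA ler_pdivrMr// [leRHS]mulrC -ler_pdivrMr//; apply/ltW/hm0.
  by rewrite /m.
have e1a : e1 <= eps / 2 by rewrite ge_min lexx.
have e1b : e1 <= 1 / (8 * n0.+1%:R) by rewrite ge_min lexx orbT.
have mi : 0 < m%:R^-1 :> R by rewrite invr_gt0.
have [K K0 hK] := softArg_lip mi.
have [N1 hN1] := fejer_approx (ltW K0) (divr_gt0 e0 (ltr0n _ 2)) hK.
have [N2 hN2] := natP_gt (pi / (eps / 2)).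
pose N := (N1 + N2 + m + 4 * n0.+1)%N.
have NN1 : (N1 <= N)%N by rewrite /N -!addnA leq_addr.
have NN2 : (N2 <= N)%N by rewrite /N -addnA addnAC leq_addl.
have Nm : (m <= N)%N by rewrite /N addnAC leq_addl.
have Nn0 : (4 * n0.+1 <= N)%N by rewrite /N leq_addl.
have N0 : (0 < N)%N by apply: leq_trans Nm.
have N0R : 0 < N%:R :> R by rewrite ltr0n.
pose g := softArg (m%:R^-1 : R).
exists N, (fcoef0 N g), (fcoef N g), m, (pi *+ 2 * (4 / m%:R) + eps / 2),
  (fun n => (pi *+ 2)%:C%C * bump_coef m n).
have hsum : (\sum_(q < N) `|g (node R N q) - Arg (node R N q)|) / N%:R <= e1.
  apply: le_trans hm; rewrite -(bump_mean (ltn0Sn m0) Nm) mulrA.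
  rewrite ler_wpM2r ?invr_ge0 ?ler0n// mulr_sumr; apply: ler_sum => q _.
  by rewrite distrC; apply: Arg_softArg => //; exact: nc_node.
split.
- move=> z z1.
  have -> : trigp (pi *+ 2 * (4 / m%:R) + eps / 2)
      (fun n => (pi *+ 2)%:C%C * bump_coef m n) m z =
      pi *+ 2 * bump m z + eps / 2.
    rewrite bump_trigp// /trigp.
    have -> : \sum_(n < m) (pi *+ 2)%:C%C * bump_coef m n * z ^+ n.+1 =
        (pi *+ 2)%:C%C * \sum_(n < m) bump_coef m n * z ^+ n.+1.
      by rewrite mulr_sumr; apply: eq_bigr => n _; rewrite mulrA.
    by rewrite ReM_real; ring.
  have -> : Arg z - trigp (fcoef0 N g) (fcoef N g) N z =
     (Arg z - g z) + (g z - trigp (fcoef0 N g) (fcoef N g) N z) by ring.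
  apply: (le_trans (ler_normD _ _)); apply: lerD.
    exact: Arg_softArg.
  exact: hN1.
- by lra.
- have -> : fcoef0 N g - pi = (fcoef0 N g - fcoef0 N (@Arg R)) + (fcoef0 N (@Arg R) - pi).
    by ring.
  apply: (le_trans (ler_normD _ _)).
  have h1 : `|fcoef0 N g - fcoef0 N (@Arg R)| <= e1.
    apply: le_trans hsum; rewrite /fcoef0 -mulrBl normrM [`|N%:R^-1|]ger0_norm ?invr_ge0//.
    by rewrite ler_wpM2r ?invr_ge0// -sumrB ler_norm_sum.
  have h2 : `|fcoef0 N (@Arg R) - pi| <= eps / 2.
    have -> : fcoef0 N (@Arg R) - pi = - (pi / N%:R).
      rewrite /fcoef0; under eq_bigr => q _ do rewrite node_Arg//.
      rewrite -mulr_sumr sum_nat_ord mulr2n; field.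
      by rewrite gt_eqF.
    rewrite normrN ger0_norm ?divr_ge0 ?ltW//.
    by rewrite ltr_pdivrMr// mulrC -ltr_pdivrMr ?hN2// divr_gt0.
  by lra.
- by apply: leq_trans Nn0; rewrite mulnS addnC mulSn -!addnA leq_addr.
move=> n nn0.
have hn0 : 0 < n.+1%:R :> R by rewrite ltr0n.
have h1 : 3 / (8 * n.+1%:R) <= complex.Im (fcoef N (@Arg R) n).
  by apply: Arg_fcoef_im; apply: leq_trans Nn0; rewrite leq_mul2l ltnS ltnW.
have h2 : `|complex.Im (fcoef N g n) - complex.Im (fcoef N (@Arg R) n)| <= e1.
  have -> : complex.Im (fcoef N g n) - complex.Im (fcoef N (@Arg R) n) =
     complex.Im (fcoef N g n - fcoef N (@Arg R) n).
    by rewrite raddfB.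
  apply: (le_trans (Im_le_nc _)); apply: le_trans hsum.
  rewrite /fcoef -mulrBr -sumrB ncM mulrC.
  apply: ler_pM; rewrite ?nc_ge0//.
    apply: (le_trans (nc_sum _ _ _)); apply: ler_sum => q _.
    rewrite -mulrBl ncM ncX nc_conj nc_node expr1n mulr1.
    by rewrite -raddfB nc_real.
  rewrite fcoef_scaleE nc_real ger0_norm; last first.
    by rewrite divr_ge0// sqr_ge0.
  rewrite expr2 invfM mulrA ler_piMl ?invr_ge0 ?ler0n//.
  by rewrite ler_pdivrMr// mul1r ler_nat leq_subr.
have h3 : 1 / (8 * n0.+1%:R) <= 1 / (8 * n.+1%:R) :> R.
  rewrite ler_pM2l// lef_pV2 ?posrE ?mulr_gt0// ler_pM2l// ler_nat.
  by rewrite ltnS ltnW.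
have E3 : 3 / (8 * n.+1%:R) = 1 / (4 * n.+1%:R) + 1 / (8 * n.+1%:R) :> R.
  by field; rewrite gt_eqF.
move: h2; rewrite ler_norml => /andP[h2 _]; rewrite E3 in h1.
move: h1 h2 h3 e1b.
move: (1 / (4 * n.+1%:R)) (1 / (8 * n.+1%:R)) (1 / (8 * n0.+1%:R)) => u v w.
by clear; lra.
Qed.

End ArgApprox.

(** * Closed walks and traces of powers *)

Section Walks.
Variables (K : comNzRingType) (n : nat).
Implicit Types (A : 'M[K]_n) (s : seq 'I_n).

Fixpoint path_weight A (i : 'I_n) s : K :=
  if s is j :: s' then A i j * path_weight A j s' else 1.

Definition cycle_weight A s : K :=
  if s is x :: s' then path_weight A (last x s') s else 1.

Lemma sum_tuple_cons m (F : m.+1.-tuple 'I_n -> K) :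
  \sum_t F t = \sum_x \sum_(t : m.-tuple 'I_n) F [tuple of x :: t].
Proof.
rewrite pair_big /= (reindex (fun p : 'I_n * m.-tuple 'I_n => [tuple of p.1 :: p.2])) //=.
exists (fun t => (thead t, [tuple of behead t])) => [[x t] _|t _] /=.
  by rewrite theadE; congr pair; apply: val_inj.
by rewrite -tuple_eta.
Qed.

Lemma mxpow_paths A m i j :
  (A ^+ m) i j = \sum_(t : m.-tuple 'I_n | last i t == j) path_weight A i t.
Proof.
elim: m i => [|m IH] i.
  rewrite expr0 mxE.
  have -> : \sum_(t : 0.-tuple 'I_n | last i t == j) path_weight A i t =
     \sum_(t : 0.-tuple 'I_n) (i == j)%:R.
    rewrite big_mkcond; apply: eq_bigr => t _; rewrite tuple0 /=.
    by case: eqP.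
  by rewrite sumr_const card_tuple expn0 mulr1n.
rewrite exprS mxE [RHS]big_mkcond sum_tuple_cons /=; apply: eq_bigr => k _.
rewrite IH mulr_sumr [LHS]big_mkcond; apply: eq_bigr => t _ /=.
by case: ifP => //; rewrite mulr0.
Qed.

(** The source of all closed walks: a power sum of eigenvalues is a sum over
    closed index sequences. *)
Lemma trace_pow_walks A m :
  \tr (A ^+ m.+1) = \sum_(t : m.+1.-tuple 'I_n) cycle_weight A t.
Proof.
rewrite /mxtrace; under eq_bigr => i _ do rewrite mxpow_paths big_mkcond.
rewrite exchange_big /=; apply: eq_bigr => t _.
case: (tupleP t) => x t' /=.
rewrite (bigD1 (last x t')) //= eqxx big1 ?addr0// => i.
by rewrite eq_sym => /negbTE ->.
Qed.

End Walks.

(** * The spectrum of a unitary scattering system *)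

Section Adjoint.
Variable R : realType.
Local Notation C := R[i].

Definition adj m n (A : 'M[C]_(m, n)) : 'M[C]_(n, m) := \matrix_(i, j) (A j i)^*%C.

Lemma adjE m n (A : 'M[C]_(m, n)) : adj A = map_mx Num.conj (A^T).
Proof. by apply/matrixP => i j; rewrite !mxE. Qed.

Lemma adj_mul m n p (A : 'M[C]_(m, n)) (B : 'M[C]_(n, p)) :
  adj (A *m B) = adj B *m adj A.
Proof.
apply/matrixP => i j; rewrite !mxE conjc_sum; apply: eq_bigr => k _.
by rewrite !mxE conjcM mulrC.
Qed.

Lemma unitary_adj n (A : 'M[C]_n) : (A \is unitarymx) = (A *m adj A == 1%:M).
Proof. by rewrite adjE. Qed.

Lemma unitary_adjl n (A : 'M[C]_n) : A \is unitarymx -> adj A *m A = 1%:M.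
Proof. by rewrite unitary_adj => /eqP/mulmx1C. Qed.

Lemma unitary_adjr n (A : 'M[C]_n) : A \is unitarymx -> A *m adj A = 1%:M.
Proof. by rewrite unitary_adj => /eqP. Qed.

Lemma unitary_mul n (A B : 'M[C]_n) :
  A \is unitarymx -> B \is unitarymx -> A *m B \is unitarymx.
Proof. exact: mul_unitarymx. Qed.

Lemma unitary_normal n (A : 'M[C]_n) : A \is unitarymx -> A \is normalmx.
Proof.
by move=> hA; apply/normalmxP; rewrite -adjE unitary_adjl// unitary_adjr.
Qed.

Definition sqn n (v : 'rV[C]_n) : R := \sum_j nc (v 0 j) ^+ 2.

Lemma sqnE n (v : 'rV[C]_n) : (v *m adj v) 0 0 = (sqn v)%:C%C.
Proof.
rewrite mxE rmorph_sum; apply: eq_bigr => j _.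
by rewrite !mxE mulC_conj.
Qed.

Lemma sqn_unitary n (v : 'rV[C]_n) (A : 'M[C]_n) : A \is unitarymx ->
  sqn (v *m A) = sqn v.
Proof.
move=> hA; apply: complexI; rewrite -!sqnE adj_mul mulmxA -(mulmxA v).
by rewrite unitary_adjr// mulmx1.
Qed.

Lemma sqnZ n (c : C) (v : 'rV[C]_n) : sqn (c *: v) = nc c ^+ 2 * sqn v.
Proof. by rewrite /sqn mulr_sumr; apply: eq_bigr => i _; rewrite mxE ncM exprMn. Qed.

Lemma sqnD n (v w : 'rV[C]_n) : sqn (v + w) <= 2 * (sqn v + sqn w).
Proof.
rewrite /sqn -big_split mulr_sumr /=; apply: ler_sum => j _; rewrite mxE.
have h := ncD (v 0 j) (w 0 j).
apply: (@le_trans _ _ ((nc (v 0 j) + nc (w 0 j)) ^+ 2)).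
  by rewrite ler_sqr ?nnegrE ?addr_ge0 ?nc_ge0.
rewrite -subr_ge0; set x := nc _; set y := nc _.
have -> : 2 * (x ^+ 2 + y ^+ 2) - (x + y) ^+ 2 = (x - y) ^+ 2 by ring.
exact: sqr_ge0.
Qed.

Lemma sqn_mul_diag n (v d : 'rV[C]_n) : sqn (v *m diag_mx d) =
  \sum_j nc (v 0 j) ^+ 2 * nc (d 0 j) ^+ 2.
Proof.
by rewrite /sqn mul_mx_diag; apply: eq_bigr => j _; rewrite mxE ncM exprMn.
Qed.

End Adjoint.

Lemma rank_diag (F : fieldType) n (d : 'rV[F]_n) :
  \rank (diag_mx d) = #|[pred i | d 0 i != 0]|.
Proof.
have E : (diag_mx d :=: \sum_(i | d 0 i != 0) <<delta_mx 0 i : 'rV[F]_n>>)%MS.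
  apply/eqmxP/andP; split; last first.
    apply/sumsmx_subP => i di; rewrite genmxE.
    have -> : (delta_mx 0 i : 'rV[F]_n) = (d 0 i)^-1 *: (delta_mx 0 i *m diag_mx d).
      rewrite mul_mx_diag; apply/rowP => j; rewrite !mxE /=.
      by case: eqP => [->|]; rewrite ?mul0r ?mulr0// mul1r mulVf.
    by rewrite scalemx_sub// submxMl.
  apply/row_subP => i; rewrite row_diag_mx.
  have [->|di] := eqVneq (d 0 i) 0; first by rewrite scale0r sub0mx.
  by rewrite scalemx_sub// (sumsmx_sup i)// genmxE.
have injI : {in [pred i | d 0 i != 0] &, injective (id : 'I_n -> 'I_n)} by [].
rewrite E; have /mxdirectP := mxdirect_delta F injI.
move=> ->; rewrite /= -sum1_card; apply: eq_bigr => i _.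
by rewrite mxrank_gen mxrank_delta.
Qed.

Section System.
Variables (R : realType) (n : nat) (S : 'M[R[i]]_n) (l : 'I_n -> R) (a b : R).
Local Notation C := R[i].
Hypothesis S_unitary : S \is unitarymx.
Hypothesis a_gt0 : 0 < a.
Hypothesis l_ge : forall j, a <= l j.
Hypothesis l_le : forall j, l j <= b.
Hypothesis a_le_b : a <= b.
Implicit Types (k h : R).

Definition phase h : 'M[C]_n := diag_mx (\row_j cis (h * l j)).
(** One time step acting on row vectors of amplitudes from the right: the phases
    acquired along the bonds, then the scattering. *)
Definition evol k : 'M[C]_n := phase k *m S.
Definition eig k : 'rV[C]_n := spectral_diag (evol k).

Lemma l_gt0 j : 0 < l j. Proof. exact: lt_le_trans (l_ge j). Qed.

Lemma phaseD h k : phase (h + k) = phase h *m phase k.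
Proof.
rewrite /phase mulmx_diag; congr diag_mx; apply/rowP => j.
by rewrite !mxE mulrDl cisD.
Qed.

Lemma phase0 : phase 0 = 1%:M.
Proof.
apply/matrixP => i j; rewrite !mxE mul0r cis0.
by case: eqP.
Qed.

Lemma phase_unitary h : phase h \is unitarymx.
Proof.
rewrite unitary_adj; apply/eqP.
have -> : adj (phase h) = phase (- h).
  apply/matrixP => i j; rewrite !mxE eq_sym; case: eqP => [->|_].
    by rewrite !mulr1n -cisN mulNr.
  by rewrite !mulr0n conjc0.
by rewrite -phaseD subrr phase0.
Qed.

Lemma evol_unitary k : evol k \is unitarymx.
Proof. by apply: unitary_mul; first exact: phase_unitary. Qed.

Lemma evolD h k : evol (k + h) = phase h *m evol k.
Proof. by rewrite /evol addrC phaseD mulmxA. Qed.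

Lemma evol_spectral k : evol k =
  adj (spectralmx (evol k)) *m diag_mx (eig k) *m spectralmx (evol k).
Proof.
have /orthomx_spectralP h := unitary_normal (evol_unitary k).
rewrite [LHS]h; congr (_ *m _ *m _).
rewrite (invmx_unitary (spectral_unitarymx _)).
exact: esym (adjE _).
Qed.

(** Row vectors are acted on from the right, so the eigenvectors are the rows of
    the diagonalizing matrix. *)
Lemma eig_vector k j : exists2 v : 'rV[C]_n,
  sqn v = 1 & v *m evol k = eig k 0 j *: v.
Proof.
set P := spectralmx (evol k).
have hP : P \is unitarymx := spectral_unitarymx _.
have h0 : delta_mx 0 j *m diag_mx (eig k) = eig k 0 j *: (delta_mx 0 j : 'rV[C]_n).
  rewrite mul_mx_diag; apply/rowP => i; rewrite !mxE /=.
  by case: eqP => [->|]; rewrite ?mul1r ?mulr1 ?mul0r ?mulr0.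
exists ((delta_mx 0 j : 'rV[C]_n) *m P).
  rewrite sqn_unitary// /sqn (bigD1 j)//= mxE !eqxx nc1 expr1n big1 ?addr0//.
  by move=> i /negbTE ij; rewrite mxE ij andbF nc0 expr0n.
rewrite {1}evol_spectral -/P !mulmxA -(mulmxA _ P) unitary_adjr// mulmx1.
by rewrite h0 scalemxAl.
Qed.

Lemma nc_eig k j : nc (eig k 0 j) = 1.
Proof.
have [v v1 E] := eig_vector k j.
have : sqn (eig k 0 j *: v) = 1 by rewrite -E (sqn_unitary _ (evol_unitary k)).
rewrite sqnZ v1 mulr1 => /eqP; rewrite -[X in _ == X](expr1n _ 2) eqrXn2//.
  by move/eqP.
exact: nc_ge0.
Qed.

Lemma mxpow_similar (P A D : 'M[C]_n) m : P \is unitarymx ->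
  A = adj P *m D *m P -> A ^+ m = adj P *m D ^+ m *m P.
Proof.
move=> hP E; elim: m => [|m IH]; first by rewrite !expr0 mulmx1 unitary_adjl.
rewrite exprS IH {1}E exprS -!mulmxE !mulmxA -(mulmxA _ P) (unitary_adjr hP).
by rewrite mulmx1.
Qed.

Lemma diag_pow (d : 'rV[C]_n) m : diag_mx d ^+ m = diag_mx (\row_j d 0 j ^+ m).
Proof.
elim: m => [|m IH].
  by apply/matrixP => i j; rewrite expr0 !mxE expr0.
rewrite exprS IH -mulmxE mulmx_diag; congr diag_mx; apply/rowP => j.
by rewrite !mxE exprS.
Qed.

Lemma trace_evol k m : \tr (evol k ^+ m) = \sum_j eig k 0 j ^+ m.
Proof.
rewrite (mxpow_similar m (spectral_unitarymx _) (evol_spectral k)).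
rewrite -mulmxA mxtrace_mulC -mulmxA unitary_adjr ?spectral_unitarymx// mulmx1.
by rewrite diag_pow mxtrace_diag; apply: eq_bigr => j _; rewrite mxE.
Qed.

Lemma det_evol k : \det (evol k) = \prod_j eig k 0 j.
Proof.
rewrite evol_spectral !det_mulmx mulrAC -det_mulmx unitary_adjl ?spectral_unitarymx//.
by rewrite det1 mul1r det_diag.
Qed.

Lemma det_evol_phase k : \det (evol k) = cis (k * \sum_j l j) * \det S.
Proof.
rewrite /evol det_mulmx det_diag; congr (_ * _).
by rewrite mulr_sumr cis_sum; apply: eq_bigr => j _; rewrite mxE.
Qed.

Definition total_phase k : R := \sum_j Arg (eig k 0 j).

Lemma cis_total_phase k : cis (total_phase k) = \det (evol k).
Proof.
rewrite cis_sum det_evol; apply: eq_bigr => j _.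
by rewrite cis_Arg// nc_eig.
Qed.

Definition mult1 k : nat := #|[pred j | eig k 0 j == 1]|.

(** The algebraic count used in the phase argument is the geometric
    multiplicity, since a unitary matrix is diagonalizable. *)
Lemma mult1_rank k : mult1 k = \rank (kermx (evol k - 1%:M)).
Proof.
have hP := spectral_unitarymx (evol k); set P := spectralmx _ in hP.
have uP := spectral_unit (evol k); rewrite -/P in uP.
have E : evol k - 1%:M = adj P *m diag_mx (\row_j (eig k 0 j - 1)) *m P.
  have -> : diag_mx (\row_j (eig k 0 j - 1)) = diag_mx (eig k) - 1%:M.
    by apply/matrixP => i j; rewrite !mxE mulrnBl.
  rewrite mulmxBr mulmx1 mulmxBl unitary_adjl//; congr (_ - _).
  exact: evol_spectral.
have uA : adj P \in unitmx.
  by have [] := mulmx1_unit (unitary_adjl hP).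
rewrite mxrank_ker E mxrankMfree ?row_free_unit//.
rewrite (eqmxMfull _ _) ?row_full_unit// rank_diag.
have -> : #|[pred i | (\row_j (eig k 0 j - 1)) 0 i != 0]| = #|[predC [pred j | eig k 0 j == 1]]|.
  by apply: eq_card => i; rewrite !inE mxE subr_eq0.
by rewrite -[X in (X - _)%N](card_ord n) -(cardC [pred j | eig k 0 j == 1]) addnK.
Qed.

Lemma expsum_lip (s : seq (C * R)) : exists2 K, 0 <= K &
  forall k h, nc (expsum s (k + h) - expsum s k) <= K * `|h|.
Proof.
exists (\sum_(p <- s) nc p.1 * `|p.2|).
  by apply: sumr_ge0 => p _; rewrite mulr_ge0// nc_ge0.
move=> k h; rewrite /expsum -sumrB mulr_suml.
apply: (le_trans (nc_sum _ _ _)); apply: ler_sum => p _.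
rewrite -mulrBr ncM -mulrA ler_wpM2l ?nc_ge0// cisB_chord.
apply: (le_trans (chord_le _)); rewrite -normrM.
by rewrite le_eqVlt; apply/orP; left; apply/eqP; congr `|_|; ring.
Qed.

Definition walk_len (t : seq 'I_n) : R := \sum_(j <- t) l j.

Lemma walk_len_ge t : (size t)%:R * a <= walk_len t.
Proof.
rewrite /walk_len; elim: t => [|x t IH] /=; first by rewrite big_nil mul0r.
by rewrite big_cons -natr1 mulrDl mul1r addrC lerD.
Qed.

Lemma walk_len_gt0 t : t != [::] -> 0 < walk_len t.
Proof.
move=> t0; apply: lt_le_trans (walk_len_ge t).
by rewrite mulr_gt0// ltr0n lt0n size_eq0.
Qed.

Lemma evol_entry k i j : evol k i j = cis (k * l i) * S i j.
Proof. by rewrite /evol mul_diag_mx !mxE. Qed.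

Lemma path_weight_evol k i t : path_weight (evol k) i t =
  cis (k * \sum_(j <- belast i t) l j) * path_weight S i t.
Proof.
elim: t i => [|x t IH] i /=; first by rewrite big_nil mulr0 cis0 mulr1.
by rewrite IH evol_entry big_cons mulrDr cisD; ring.
Qed.

(** Along a closed walk the phases collect into the exponential of its length,
    so the wave number appears only there. *)
Lemma cycle_weight_evol k t : t != [::] ->
  cycle_weight (evol k) t = cis (k * walk_len t) * cycle_weight S t.
Proof.
case: t => // x t _; rewrite /cycle_weight path_weight_evol.
congr (cis (k * _) * _); rewrite /walk_len [in RHS]lastI /=.
by rewrite big_cons big_rcons /= addrC.
Qed.

Definition walk_es m : seq (C * R) :=
  [seq (cycle_weight S t, walk_len t) | t : m.-tuple 'I_n].

Lemma trace_expsum k m : expsum (walk_es m.+1) k = \tr (evol k ^+ m.+1).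
Proof.
rewrite trace_pow_walks /expsum big_image; apply: eq_bigr => t _ /=.
by rewrite cycle_weight_evol 1?mulrC// -size_eq0 size_tuple.
Qed.

Lemma bohr_walk_es m nu : bohr_coef (walk_es m) nu =
  \sum_(t : m.-tuple 'I_n | walk_len t == nu) cycle_weight S t.
Proof. by rewrite /bohr_coef big_image_cond. Qed.

Lemma bohr_walk_es_le0 m nu : nu <= 0 -> bohr_coef (walk_es m.+1) nu = 0.
Proof.
move=> nu0; rewrite bohr_walk_es big1// => t /eqP E.
have := @walk_len_gt0 t; rewrite E ltNge nu0 -size_eq0 size_tuple.
by move/(_ isT).
Qed.

Definition half_es (c : nat -> C) N : seq (C * R) :=
  flatten [seq es_scale (c m) (walk_es m.+1) | m <- index_iota 0 N].

(** The exponential sum in k that equals the sum of a trigonometric polynomial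
    over the eigenvalues of [evol k]; its positive frequencies are lengths of
    closed walks. *)
Definition spec_es c0 (c : nat -> C) N : seq (C * R) :=
  ((n%:R * c0)%:C%C, 0) :: (half_es c N ++ es_conj (half_es c N)).

Lemma expsum_half c N k : expsum (half_es c N) k =
  \sum_j \sum_(m < N) c m * eig k 0 j ^+ m.+1.
Proof.
rewrite expsum_flatten exchange_big big_mkord /=.
apply: eq_bigr => m _.
by rewrite expsum_scale trace_expsum trace_evol mulr_sumr.
Qed.

Lemma expsum_spec c0 c N k :
  expsum (spec_es c0 c N) k = (\sum_j trigp c0 c N (eig k 0 j))%:C%C.
Proof.
rewrite /expsum big_cons -/(expsum _ _) expsum_cat expsum_conj add_conj /=.
rewrite mulr0 cis0 mulr1 -rmorphD /=; congr (_%:C%C).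
rewrite /trigp big_split /= sumr_const card_ord expsum_half Re_sum mulr_sumr.
by rewrite mulr_natl.
Qed.

Lemma bohr_spec_gt0 c0 c N nu : 0 < nu -> bohr_coef (spec_es c0 c N) nu =
  \sum_(m < N) c m * bohr_coef (walk_es m.+1) nu.
Proof.
move=> nu0; rewrite /bohr_coef big_cons /= lt_eqF// -!/(bohr_coef _ _).
rewrite bohr_coef_cat bohr_coef_conj [X in _ + X^*%C](_ : _ = 0).
  rewrite conjc0 addr0 bohr_coef_flatten big_mkord.
  by apply: eq_bigr => m _; rewrite bohr_coef_scale.
rewrite bohr_coef_flatten big1_seq// => m _.
by rewrite bohr_coef_scale bohr_walk_es_le0 ?mulr0// oppr_le0 ltW.
Qed.

Lemma bohr_spec_0 c0 c N : bohr_coef (spec_es c0 c N) 0 = (n%:R * c0)%:C%C.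
Proof.
rewrite /bohr_coef big_cons /= eqxx -!/(bohr_coef _ _).
rewrite bohr_coef_cat bohr_coef_conj oppr0 [bohr_coef _ _](_ : _ = 0).
  by rewrite conjc0 !addr0.
rewrite bohr_coef_flatten big1_seq// => m _.
by rewrite bohr_coef_scale bohr_walk_es_le0 ?mulr0.
Qed.

Lemma dist_le3 (x y z w e1 e2 e3 : R) :
  `|x - y| <= e1 -> `|y - z| <= e2 -> `|w - z| <= e3 -> `|x - w| <= e1 + e2 + e3.
Proof.
rewrite !ler_norml => /andP[? ?] /andP[? ?] /andP[? ?].
by apply/andP; split; lra.
Qed.

(** The eigenvalues carry no numbering that is continuous in k, but symmetric
    functions of them do vary continuously: those of trigonometric polynomials
    are exponential sums, and Lipschitz functions are uniform limits of these. *)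
Lemma spec_lip_continuous (g : C -> R) (K k eps : R) : 0 <= K -> 0 < eps ->
  (forall z w, nc z = 1 -> nc w = 1 -> `|g z - g w| <= K * nc (z - w)) ->
  exists2 d, 0 < d & forall h, `|h| < d ->
    `|\sum_j g (eig (k + h) 0 j) - \sum_j g (eig k 0 j)| <= eps.
Proof.
move=> K0 e0 gK; have n1 : 0 < n.+1%:R :> R by rewrite ltr0n.
pose e1 := eps / (3 * n.+1%:R).
have e10 : 0 < e1 by rewrite divr_gt0// mulr_gt0.
have [N0 hN0] := fejer_approx K0 e10 gK.
pose N := N0.+1; have hN := hN0 N (leqnSn _) isT.
pose T k := \sum_j trigp (fcoef0 N g) (fcoef N g) N (eig k 0 j).
have hT k' : `|\sum_j g (eig k' 0 j) - T k'| <= eps / 3.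
  rewrite /T -sumrB; apply: (le_trans (ler_norm_sum _ _ _)).
  apply: (@le_trans _ _ (\sum_(j < n) e1)).
    by apply: ler_sum => j _; apply: hN; exact: nc_eig.
  have E : e1 * n.+1%:R = eps / 3.
    rewrite /e1; move: n1; move: (n.+1%:R : R) => u u0.
    by field; rewrite gt_eqF.
  by rewrite sumr_const card_ord -[e1 *+ n]mulr_natr -E ler_wpM2l ?(ltW e10)// ler_nat.
have [M M0 hM] := expsum_lip (spec_es (fcoef0 N g) (fcoef N g) N).
exists (eps / 3 / (M + 1)); first by rewrite !divr_gt0// ltr_wpDl.
move=> h hd.
have hTT : `|T (k + h) - T k| <= eps / 3.
  have := hM k h; rewrite !expsum_spec -raddfB nc_real => /le_trans; apply.
  have : (M + 1) * `|h| <= eps / 3.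
    by rewrite mulrC -ler_pdivlMr ?ltr_wpDl// ltW.
  by apply: le_trans; rewrite ler_wpM2r// lerDl.
have -> : eps = eps / 3 + eps / 3 + eps / 3 by field.
exact: dist_le3 (hT _) hTT (hT _).
Qed.

Lemma finite_gap (f : 'I_n -> R) : exists2 g : R, 0 < g & forall j, 0 < f j -> g <= f j.
Proof.
pose s := \sum_(j | 0 < f j) (f j)^-1.
have s0 : 0 <= s by apply: sumr_ge0 => j h; rewrite invr_ge0 ltW.
have s1 : 0 < 1 + s by rewrite ltr_pwDl.
exists (1 + s)^-1; first by rewrite invr_gt0.
move=> j fj; rewrite -[f j]invrK lef_pV2 ?posrE ?invr_gt0//.
rewrite /s (bigD1 j)//= addrCA lerDl addr_ge0//.
by apply: sumr_ge0 => i /andP[h _]; rewrite invr_ge0 ltW.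
Qed.

(** First-order perturbation at an eigenvalue 1 of [evol k]: p is the component
    of the eigenvector v in the eigenspace and q the rest. *)
Lemma phase_im (v p q : 'rV[C]_n) (k h : R) (lam : C) :
  v = p + q -> p *m evol k = p -> (q *m adj p) 0 0 = 0 ->
  v *m evol (k + h) = lam *: v ->
  complex.Im lam * sqn p = \sum_j sin (h * l j) * nc (p 0 j) ^+ 2 +
     complex.Im (\sum_j q 0 j * (cis (h * l j) - 1) * (p 0 j)^*%C).
Proof.
move=> vE pU qp vU.
have UK : evol k *m adj p = adj p.
  by rewrite -{1}pU adj_mul mulmxA (unitary_adjr (evol_unitary k)) mul1mx.
have pv : (v *m adj p) 0 0 = (sqn p)%:C%C.
  by rewrite vE mulmxDl mxE qp addr0 sqnE.
have E : (v *m phase h *m adj p) 0 0 = lam * (sqn p)%:C%C.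
  by rewrite -UK mulmxA -(mulmxA v) -evolD vU -scalemxAl mxE pv.
have Ep : (p *m phase h *m adj p) 0 0 = \sum_j (nc (p 0 j) ^+ 2)%:C%C * cis (h * l j).
  rewrite /phase mul_mx_diag mxE; apply: eq_bigr => j _.
  by rewrite !mxE mulrAC mulC_conj.
have Eq : (q *m phase h *m adj p) 0 0 =
    \sum_j q 0 j * (cis (h * l j) - 1) * (p 0 j)^*%C.
  have -> : (q *m phase h *m adj p) 0 0 = (q *m (phase h - 1%:M) *m adj p) 0 0.
    by rewrite mulmxBr mulmx1 mulmxBl [RHS]mxE [X in _ = _ + X]mxE qp oppr0 addr0.
  have -> : phase h - 1%:M = diag_mx (\row_j (cis (h * l j) - 1)).
    by apply/matrixP => i j; rewrite !mxE mulrnBl.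
  by rewrite mul_mx_diag mxE; apply: eq_bigr => j _; rewrite !mxE.
have -> : complex.Im lam * sqn p = complex.Im (lam * (sqn p)%:C%C).
  by rewrite [lam * _]mulrC ImM_real mulrC.
rewrite -E vE !mulmxDl mxE Ep Eq raddfD /=; congr (_ + _).
by rewrite Im_sum; apply: eq_bigr => j _; rewrite ImM_real mulrC.
Qed.

Lemma sin_lower (x : R) : `|x| <= pi / 2 -> x ^+ 2 / 2 <= x * sin x.
Proof.
wlog x0 : x / 0 <= x.
  move=> H; case: (leP 0 x) => [|x0]; first exact: H.
  have -> : x * sin x = - x * sin (- x) by rewrite sinN mulrNN.
  move=> hx; have := H (- x); rewrite sqrrN normrN oppr_ge0 (ltW x0).
  by move/(_ isT hx).
rewrite ger0_norm// => hx.
by rewrite expr2 -mulrA ler_wpM2l// sin_ge_half// x0.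
Qed.

(** The cross term of [phase_im], by the weighted arithmetic-geometric
    inequality. *)
Lemma cross_bound (p q : 'rV[C]_n) (h X : R) : 0 <= b -> 0 < X ->
  `|complex.Im (\sum_j q 0 j * (cis (h * l j) - 1) * (p 0 j)^*%C)| <=
  `|h| * b * (X * sqn q + sqn p / (4 * X)).
Proof.
move=> b0 X0; apply: (le_trans (Im_le_nc _)); apply: (le_trans (nc_sum _ _ _)).
rewrite /sqn !mulr_sumr mulr_suml -big_split mulr_sumr /=.
apply: ler_sum => j _; rewrite !ncM nc_conj.
have h1 : nc (cis (h * l j) - 1) <= `|h| * b.
  apply: (le_trans (chord_le _)); rewrite normrM ler_wpM2l//.
  by rewrite gtr0_norm ?l_gt0// l_le.
set u := nc (q 0 j); set w := nc (p 0 j).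
have u0 : 0 <= u := nc_ge0 _. have w0 : 0 <= w := nc_ge0 _.
have h2 : u * w <= X * u ^+ 2 + w ^+ 2 / (4 * X).
  rewrite -subr_ge0.
  have -> : X * u ^+ 2 + w ^+ 2 / (4 * X) - u * w = (2 * X * u - w) ^+ 2 / (4 * X).
    by field; rewrite gt_eqF.
  by rewrite divr_ge0 ?sqr_ge0// mulr_ge0// ltW.
rewrite mulrAC mulrC; apply: ler_pM; rewrite ?nc_ge0// ?mulr_ge0//.
Qed.

(** Splitting a vector into its part in the eigenspace of 1 and the rest, which
    is small when the vector is almost fixed, by the spectral gap g. *)
Lemma spectral_split k (v : 'rV[C]_n) :
  exists p q : 'rV[C]_n, [/\ v = p + q, p *m evol k = p, (q *m adj p) 0 0 = 0,
    sqn v = sqn p + sqn q &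
    forall g : R, 0 <= g -> (forall j, eig k 0 j != 1 -> g <= nc (eig k 0 j - 1)) ->
      g ^+ 2 * sqn q <= sqn (v *m evol k - v)].
Proof.
set P := spectralmx (evol k); set mu := eig k.
have hP : P \is unitarymx := spectral_unitarymx _.
have hU : evol k = adj P *m diag_mx mu *m P := evol_spectral k.
pose y := v *m adj P.
have vy : v = y *m P by rewrite /y -mulmxA (unitary_adjl hP) mulmx1.
pose yp : 'rV[C]_n := \row_j (if mu 0 j == 1 then y 0 j else 0).
pose yq : 'rV[C]_n := \row_j (if mu 0 j == 1 then 0 else y 0 j).
have act (w : 'rV[C]_n) : w *m P *m evol k = (w *m diag_mx mu) *m P.
  by rewrite hU !mulmxA -(mulmxA w) (unitary_adjr hP) mulmx1.
exists (yp *m P), (yq *m P); split.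
- rewrite -mulmxDl vy; congr (_ *m _); apply/rowP => j; rewrite !mxE.
  by case: eqP; rewrite ?addr0 ?add0r.
- rewrite act; congr (_ *m _); rewrite mul_mx_diag; apply/rowP => j; rewrite !mxE.
  by case: eqP => [->|]; rewrite ?mulr1 ?mul0r.
- rewrite adj_mul mulmxA -(mulmxA yq) (unitary_adjr hP) mulmx1 mxE big1// => j _.
  by rewrite !mxE; case: eqP; rewrite ?mul0r ?conjc0 ?mulr0.
- rewrite vy !(sqn_unitary _ hP) /sqn -big_split /=; apply: eq_bigr => j _.
  by rewrite !mxE; case: eqP; rewrite ?nc0 ?expr0n ?addr0 ?add0r.
move=> g g0 hg.
have -> : v *m evol k - v = (y *m diag_mx (\row_j (mu 0 j - 1))) *m P.
  have -> : diag_mx (\row_j (mu 0 j - 1)) = diag_mx mu - 1%:M.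
    by apply/matrixP => i j; rewrite !mxE mulrnBl.
  by rewrite {1}vy act mulmxBr mulmx1 mulmxBl -vy.
rewrite !(sqn_unitary _ hP) sqn_mul_diag /sqn mulr_sumr; apply: ler_sum => j _.
rewrite !mxE; case: eqP => [->|/eqP hj].
  by rewrite nc0 subrr nc0 !expr0n !mulr0.
rewrite mulrC ler_wpM2l ?sqr_ge0// ler_sqr ?nnegrE ?nc_ge0//.
exact: hg.
Qed.

(** Near an eigenvalue 1 of [evol k], the eigenvalues of [evol (k + h)] have
    left 1 in the direction given by the sign of [h]: all the phases rotate
    counterclockwise, at a speed at least [a]. *)
Lemma phase_drift k : exists2 d : R, 0 < d & forall h j, h != 0 -> `|h| < d ->
  nc (eig (k + h) 0 j - 1) < d -> 0 < h * complex.Im (eig (k + h) 0 j).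
Proof.
have [g g0 hg] := finite_gap (fun j => nc (eig k 0 j - 1)).
have hg' j : eig k 0 j != 1 -> g <= nc (eig k 0 j - 1).
  by move=> hj; apply: hg; rewrite nc_gt0 subr_eq0.
have b0 : 0 < b := lt_le_trans a_gt0 a_le_b.
(* the constant makes the part q of an eigenvector outside the eigenspace so
   small that the cross term takes at most half of the drift *)
pose th := a / (8 * b * (b + 1)).
have th0 : 0 < th by rewrite divr_gt0// !mulr_gt0// addr_gt0.
pose d := Num.min (pi / (2 * b)) (g * th).
have d0 : 0 < d.
  rewrite lt_min; apply/andP; split; last by rewrite mulr_gt0.
  by rewrite divr_gt0 ?pi_gt0// mulr_gt0.
have d1 : d <= pi / (2 * b) by rewrite ge_min lexx.
have d2 : d <= g * th by rewrite ge_min lexx orbT.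
exists d => // h j h0 hd lamd.
set lam := eig (k + h) 0 j in lamd *.
have [v v1 vU] := eig_vector (k + h) j.
have [p [q [vE pU qp nv hq]]] := spectral_split k v.
have hh : 0 <= `|h| by [].
have hsq : h ^+ 2 <= d ^+ 2.
  by rewrite -real_normK ?num_real// ler_sqr ?nnegrE// ltW.
have lam2 : nc (lam - 1) ^+ 2 <= d ^+ 2.
  by rewrite ler_sqr ?nnegrE ?nc_ge0 ?(ltW d0)// ltW.
have move_v : sqn (v *m evol k - v) <= 2 * (d ^+ 2 * (b ^+ 2 + 1)).
  have -> : v *m evol k - v =
     v *m diag_mx (\row_i (1 - cis (h * l i))) *m evol k + (lam - 1) *: v.
    have -> : diag_mx (\row_i (1 - cis (h * l i))) = 1%:M - phase h.
      by apply/matrixP => i i'; rewrite !mxE mulrnBl.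
    rewrite mulmxBr mulmx1 mulmxBl -[v *m phase h *m _]mulmxA -evolD vU.
    by rewrite scalerBl scale1r addrA addrNK.
  apply: (le_trans (sqnD _ _)); rewrite ler_wpM2l// mulrDr mulr1.
  apply: lerD; last by rewrite sqnZ v1 mulr1.
  rewrite (sqn_unitary _ (evol_unitary k)) sqn_mul_diag.
  rewrite -[leRHS]mulr1 -v1 /sqn mulr_sumr; apply: ler_sum => i _.
  rewrite mulrC ler_wpM2r ?sqr_ge0// !mxE.
  apply: (@le_trans _ _ (h ^+ 2 * b ^+ 2)); last by rewrite ler_wpM2r ?sqr_ge0.
  rewrite -exprMn -[leRHS]real_normK ?num_real// ler_sqr ?nnegrE ?nc_ge0//.
  rewrite -ncN opprB (le_trans (chord_le _))// !normrM ler_wpM2l//.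
  by rewrite gtr0_norm ?l_gt0// gtr0_norm// l_le.
have nq : sqn q <= a ^+ 2 / (16 * b ^+ 2).
  have h1 := le_trans (hq g (ltW g0) hg') move_v.
  have h2 : d ^+ 2 <= (g * th) ^+ 2.
    by rewrite ler_sqr ?nnegrE ?(ltW d0)// ltW// mulr_gt0.
  have h3 : g ^+ 2 * sqn q <= g ^+ 2 * (2 * (th ^+ 2 * (b ^+ 2 + 1))).
    apply: (le_trans h1).
    have -> : g ^+ 2 * (2 * (th ^+ 2 * (b ^+ 2 + 1))) =
      2 * ((g * th) ^+ 2 * (b ^+ 2 + 1)) by ring.
    by rewrite ler_wpM2l// ler_wpM2r// addr_ge0// sqr_ge0.
  rewrite ler_pM2l ?exprn_gt0// in h3; apply: (le_trans h3).
  have h4 : b ^+ 2 + 1 <= (b + 1) ^+ 2.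
    rewrite -subr_ge0; have -> : (b + 1) ^+ 2 - (b ^+ 2 + 1) = 2 * b by ring.
    by rewrite mulr_ge0// ltW.
  apply: (@le_trans _ _ (2 * (th ^+ 2 * (b + 1) ^+ 2))).
    by rewrite ler_wpM2l// ler_wpM2l// sqr_ge0.
  have -> : 2 * (th ^+ 2 * (b + 1) ^+ 2) = (a ^+ 2 / (16 * b ^+ 2)) / 2.
    by rewrite /th; field; rewrite !gt_eqF ?addr_gt0.
  by rewrite ler_pdivrMr// ler_peMr ?ler1n// divr_ge0 ?sqr_ge0// mulr_ge0// sqr_ge0.
have np : 1 / 2 <= sqn p.
  have : a ^+ 2 / (16 * b ^+ 2) <= 1 / 2.
    rewrite ler_pdivrMr ?mulr_gt0 ?exprn_gt0//.
    have : a ^+ 2 <= b ^+ 2 by rewrite ler_sqr ?nnegrE ?(ltW b0) ?(ltW a_gt0).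
    have := sqr_ge0 b; lra.
  by move: nv; rewrite v1; lra.
have Eim := phase_im vE pU qp vU.
have np0 : 0 < sqn p by apply: lt_le_trans np.
rewrite -(pmulr_lgt0 _ np0) -mulrA Eim mulrDr.
have h2 : h ^+ 2 * (a / 2) * sqn p <= h * \sum_j0 sin (h * l j0) * nc (p 0 j0) ^+ 2.
  rewrite /sqn !mulr_sumr; apply: ler_sum => i _.
  rewrite [leRHS]mulrA ler_wpM2r ?sqr_ge0//.
  have hl : `|h * l i| <= pi / 2.
    rewrite normrM [`|l i|]gtr0_norm ?l_gt0//.
    apply: (@le_trans _ _ (pi / (2 * b) * b)).
      by apply: ler_pM => //; [exact: ltW (l_gt0 i)|exact: ltW (lt_le_trans hd d1)].
    by rewrite le_eqVlt; apply/orP; left; apply/eqP; field; rewrite gt_eqF.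
  rewrite -(ler_pM2l (l_gt0 i)).
  apply: (@le_trans _ _ ((h * l i) ^+ 2 / 2)).
    have -> : l i * (h ^+ 2 * (a / 2)) = (h ^+ 2 * l i) * a / 2 by ring.
    have -> : (h * l i) ^+ 2 / 2 = (h ^+ 2 * l i) * l i / 2 by ring.
    by rewrite ler_pM2r// ler_wpM2l// mulr_ge0 ?sqr_ge0// ltW// l_gt0.
  apply: (le_trans (sin_lower hl)).
  by rewrite le_eqVlt; apply/orP; left; apply/eqP; ring.
have X0 : 0 < b / a by rewrite divr_gt0.
have := cross_bound p q h (ltW b0) X0.
set cr := complex.Im _ => hcr.
have h3 : - (h ^+ 2 * (b * (b / a * sqn q + sqn p / (4 * (b / a))))) <= h * cr.
  rewrite lerNl -mulNr (le_trans (ler_norm _))// normrM normrN.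
  rewrite -[X in _ <= X * _]real_normK ?num_real// [X in _ <= X * _]expr2.
  by rewrite -[leRHS]mulrA ler_wpM2l// [leRHS]mulrA.
have E1 : b * (b / a * sqn q + sqn p / (4 * (b / a))) = b ^+ 2 / a * sqn q + a / 4 * sqn p.
  by field; rewrite !gt_eqF.
rewrite E1 in h3.
have h4 : b ^+ 2 / a * sqn q <= a / 16.
  apply: (@le_trans _ _ (b ^+ 2 / a * (a ^+ 2 / (16 * b ^+ 2)))).
    by rewrite ler_wpM2l// divr_ge0 ?sqr_ge0// ltW.
  by rewrite le_eqVlt; apply/orP; left; apply/eqP; field; rewrite !gt_eqF.
have h20 : 0 < h ^+ 2 by rewrite exprn_even_gt0.
have h5 : a / 4 * (1 / 2) <= a / 4 * sqn p by rewrite ler_wpM2l// divr_ge0// ltW.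
have h6 : h ^+ 2 * (a / 16) <= h ^+ 2 * (a / 2 * sqn p - (b ^+ 2 / a * sqn q + a / 4 * sqn p)).
  by rewrite ler_wpM2l ?(ltW h20)//; lra.
have h7 : 0 < h ^+ 2 * (a / 16) by rewrite mulr_gt0// divr_gt0.
apply: (lt_le_trans h7); apply: (le_trans h6); rewrite mulrBr.
by apply: lerD => //; rewrite mulrA.
Qed.

Lemma Arg_near1 (z : C) : nc z = 1 -> 0 <= complex.Im z -> Arg z <= 2 * nc (z - 1).
Proof.
move=> z1 iz.
have h : Arg z <= pi by rewrite /Arg iz acos_lepi// circle_Re.
have := @chord_ge R (Arg z); rewrite cis_Arg// ger0_norm ?Arg_ge0//.
exact.
Qed.

Lemma softArg_near (e : R) (z : C) : 0 < e -> nc z = 1 ->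
  (nc (z - 1) < e -> 0 <= complex.Im z) -> `|Arg z - softArg e z| <= 2 * e.
Proof.
move=> e0 z1 hz; have [h|h] := leP e (nc (z - 1)).
  by rewrite /softArg ramp_eq1// mulr1 subrr normr0 mulr_ge0// ltW.
have hA := Arg_near1 z1 (hz h); have A0 := Arg_ge0 z1.
have -> : Arg z - softArg e z = Arg z * (1 - ramp e z) by rewrite /softArg; ring.
rewrite ger0_norm ?mulr_ge0 ?subr_ge0 ?ramp_le1//.
apply: (@le_trans _ _ (Arg z)); first by rewrite ler_piMr// lerBlDr lerDl ramp_ge0.
by apply: (le_trans hA); rewrite ler_wpM2l// ltW.
Qed.

Lemma softArg_eq (e : R) (z : C) : 0 < e -> nc z = 1 ->
  (z != 1 -> e <= nc (z - 1)) -> softArg e z = Arg z.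
Proof.
move=> e0 z1; have [->|zn1] := eqVneq z 1; first by rewrite /softArg Arg1 mul0r.
by move=> /(_ isT) h; rewrite /softArg ramp_eq1// mulr1.
Qed.

Lemma conjc_eq1 (z : C) : (z^*%C == 1) = (z == 1).
Proof. by rewrite -[1]conjc1 (inj_eq (can_inj (@conjcK R))) conjc1. Qed.

Lemma nc_conj_sub1 (z : C) : nc (z^*%C - 1) = nc (z - 1).
Proof. by rewrite -[in RHS]nc_conj conjcB conjc1. Qed.

Lemma mult1_sum k : (mult1 k)%:R = \sum_j (eig k 0 j == 1)%:R :> R.
Proof.
rewrite /mult1 -sum1_card natr_sum big_mkcond; apply: eq_bigr => j _.
by rewrite inE; case: eqP.
Qed.

Lemma Arg_conj_sum k : \sum_j Arg (eig k 0 j)^*%C =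
  n%:R * (pi *+ 2) - (mult1 k)%:R * (pi *+ 2) - total_phase k.
Proof.
have -> : n%:R * (pi *+ 2) = \sum_(j < n) (pi *+ 2) :> R.
  by rewrite sumr_const card_ord [LHS]mulr_natl.
rewrite mult1_sum mulr_suml /total_phase -!sumrB; apply: eq_bigr => j _.
case: eqP => [->|/eqP h]; first by rewrite conjc1 !Arg1 mul1r subrr subr0.
by rewrite Arg_conj ?nc_eig// mul0r subr0.
Qed.

(** Away from 1 the sum of the arguments is continuous. By [phase_drift] the
    eigenvalues near 1 lie just after 1 for h > 0 and just before 1 for h < 0, so
    that from the left each eigenvalue 1 at k counts as a full turn. *)
Lemma total_phase_limits k (eps : R) : 0 < eps ->
  exists2 d : R, 0 < d & forall h, 0 < h -> h < d ->
    `|total_phase (k + h) - total_phase k| <= eps /\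
    `|total_phase (k - h) - (total_phase k + (mult1 k)%:R * (pi *+ 2))| <= eps.
Proof.
move=> eps0; have [d1 d10 hd1] := phase_drift k.
have [g g0 hg] := finite_gap (fun j => nc (eig k 0 j - 1)).
have n10 : 0 < n.+1%:R :> R by rewrite ltr0n.
pose e := Num.min (Num.min d1 g) (eps / (4 * n.+1%:R)).
have e0 : 0 < e.
  by rewrite !lt_min d10 g0 divr_gt0// mulr_gt0.
have ed1 : e <= d1 by rewrite !ge_min lexx.
have eg : e <= g by rewrite !ge_min lexx orbT.
have en : \sum_(j < n) 2 * e <= eps / 2.
  rewrite sumr_const card_ord -[X in X <= _]mulr_natr.
  apply: (@le_trans _ _ (2 * e * n.+1%:R)).
    by rewrite ler_wpM2l ?ler_nat// mulr_ge0// ltW.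
  apply: (@le_trans _ _ (2 * (eps / (4 * n.+1%:R)) * n.+1%:R)).
    by rewrite ler_wpM2r ?(ltW n10)// ler_wpM2l// ge_min lexx orbT.
  move: n10; move: (n.+1%:R : R) => u u0.
  by rewrite le_eqVlt; apply/orP; left; apply/eqP; field; rewrite gt_eqF.
have [K K0 hK] := @softArg_lip R e e0.
have e20 : 0 < eps / 2 by rewrite divr_gt0.
have [d2 d20 hd2] := spec_lip_continuous k (ltW K0) e20 hK.
have [d3 d30 hd3] : exists2 d : R, 0 < d & forall h, `|h| < d ->
    `|\sum_j softArg e (eig (k + h) 0 j)^*%C - \sum_j softArg e (eig k 0 j)^*%C| <= eps / 2.
  apply: (@spec_lip_continuous (fun z => softArg e z^*%C) K) => //; first exact: ltW.
  move=> z w z1 w1; rewrite -[nc (z - w)]nc_conj conjcB.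
  by apply: hK; rewrite nc_conj.
pose d := Num.min d1 (Num.min d2 d3).
exists d; first by rewrite !lt_min d10 d20 d30.
move=> h h0; rewrite !lt_min => /and3P[hd1' hd2' hd3'].
have habs : `|h| = h by rewrite gtr0_norm.
split.
  have -> : total_phase k = \sum_j softArg e (eig k 0 j).
    apply: eq_bigr => j _; rewrite softArg_eq ?nc_eig// => hj.
    by apply: (le_trans eg); apply: hg; rewrite nc_gt0 subr_eq0.
  have -> : eps = eps / 2 + eps / 2 by field.
  apply: (le_trans (ler_distD (\sum_j softArg e (eig (k + h) 0 j)) _ _)).
  apply: lerD; last by apply: hd2; rewrite habs.
  apply: le_trans en; rewrite /total_phase -sumrB.
  apply: (le_trans (ler_norm_sum _ _ _)); apply: ler_sum => j _.
  apply: softArg_near => //; first exact: nc_eig.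
  move=> hj; apply: ltW; rewrite -(pmulr_rgt0 _ h0); apply: hd1.
  - by rewrite gt_eqF.
  - by rewrite habs.
  - exact: lt_le_trans ed1.
have near j : nc ((eig (k - h) 0 j) - 1) < e -> complex.Im (eig (k - h) 0 j) < 0.
  move=> hj; have h1 : 0 < - h * complex.Im (eig (k - h) 0 j).
    apply: hd1; rewrite ?oppr_eq0 ?gt_eqF// ?normrN ?habs//.
    exact: lt_le_trans ed1.
  by rewrite mulNr oppr_gt0 pmulr_rlt0 in h1.
have m0 : mult1 (k - h) = 0%N.
  apply: eq_card0 => j; rewrite inE; apply/negP => /eqP E.
  by have := near j; rewrite E subrr nc0 /= ltxx => /(_ e0).
have E0 := Arg_conj_sum k; have E1 := Arg_conj_sum (k - h).
rewrite m0 mul0r subr0 in E1.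
have -> : total_phase (k - h) - (total_phase k + (mult1 k)%:R * (pi *+ 2)) =
   \sum_j Arg (eig k 0 j)^*%C - \sum_j Arg (eig (k - h) 0 j)^*%C.
  by rewrite E0 E1; ring.
rewrite distrC.
have -> : \sum_j Arg (eig k 0 j)^*%C = \sum_j softArg e (eig k 0 j)^*%C.
  apply: eq_bigr => j _; rewrite softArg_eq ?nc_conj ?nc_eig// conjc_eq1 => hj.
  by rewrite nc_conj_sub1; apply: (le_trans eg); apply: hg; rewrite nc_gt0 subr_eq0.
have -> : eps = eps / 2 + eps / 2 by field.
apply: (le_trans (ler_distD (\sum_j softArg e (eig (k - h) 0 j)^*%C) _ _)).
apply: lerD; last by apply: hd3; rewrite normrN habs.
apply: le_trans en; rewrite -sumrB.
apply: (le_trans (ler_norm_sum _ _ _)); apply: ler_sum => j _.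
apply: softArg_near => //; first by rewrite nc_conj nc_eig.
rewrite nc_conj_sub1 => /near; case: (eig _ _ _) => x y /= /ltW.
by rewrite oppr_ge0.
Qed.

(** For a real scattering matrix the eigenvalues of [evol 0] come in conjugate
    pairs, so that the total phase counts the eigenvalues different from 1. *)
Lemma total_phase0 : (forall i j, (S i j)^*%C = S i j) ->
  total_phase 0 = (n%:R - (mult1 0)%:R) * pi.
Proof.
move=> Sreal.
have E0 : evol 0 = S by rewrite /evol phase0 mul1mx.
pose s := [seq eig 0 0 j | j : 'I_n].
have charE : char_poly S = \prod_(z <- s) ('X - z%:P).
  have E := evol_spectral 0; rewrite E0 in E.
  set P := spectralmx S in E.
  have hP : P \is unitarymx := spectral_unitarymx _.
  pose pm := map_mx (@polyC C).
  have PP : pm _ _ (adj P) *m pm _ _ P = 1%:M.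
    by rewrite /pm -map_mxM (unitary_adjl hP) map_mx1.
  have Ech : char_poly_mx S = pm _ _ (adj P) *m char_poly_mx (diag_mx (eig 0)) *m pm _ _ P.
    rewrite /char_poly_mx mulmxBr mulmxBl; congr (_ - _).
      by rewrite scalar_mxC -mulmxA PP mulmx1.
    by rewrite -!map_mxM -E.
  have -> : char_poly S = char_poly (diag_mx (eig 0)).
    rewrite /char_poly Ech !det_mulmx mulrAC -det_mulmx PP det1 mul1r.
    by [].
  rewrite char_poly_trig ?diag_mx_is_trig// /s big_image /=.
  by apply: eq_bigr => j _; rewrite mxE eqxx mulr1n.
have hperm : perm_eq s [seq z^*%C | z <- s].
  apply: prod_XsubC_eq; rewrite -charE big_map.
  have <- : map_poly (@conjc R) (char_poly S) = \prod_(z <- s) ('X - (z^*%C)%:P).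
    rewrite charE rmorph_prod /=; apply: eq_bigr => z _.
    exact: map_polyXsubC.
  rewrite map_char_poly; congr char_poly.
  by apply/matrixP => i j; rewrite [RHS]mxE; exact: esym (Sreal i j).
have := Arg_conj_sum 0.
have -> : \sum_j Arg (eig 0 0 j)^*%C = total_phase 0.
  transitivity (\sum_(z <- [seq z^*%C | z <- s]) Arg z).
    by rewrite big_map /s big_image.
  by rewrite -(perm_big _ hperm) /s big_image.
rewrite mulr2n; lra.
Qed.

End System.

(** * Two systems with the same positive spectrum *)

Section TwoSystems.
Variables (R : realType) (n1 n2 : nat).
Local Notation C := R[i].
Variables (S1 : 'M[C]_n1) (S2 : 'M[C]_n2) (l1 : 'I_n1 -> R) (l2 : 'I_n2 -> R).
Variables a b : R.
Hypotheses (S1_unitary : S1 \is unitarymx) (S2_unitary : S2 \is unitarymx).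
Hypotheses (a_gt0 : 0 < a) (a_le_b : a <= b).
Hypotheses (l1_ge : forall j, a <= l1 j) (l1_le : forall j, l1 j <= b).
Hypotheses (l2_ge : forall j, a <= l2 j) (l2_le : forall j, l2 j <= b).
Hypothesis same_length : \sum_j l1 j = \sum_j l2 j.
Hypothesis same_mult : forall k, 0 < k -> mult1 S1 l1 k = mult1 S2 l2 k.
Implicit Types (k h nu : R).

Definition phase_diff k : R := total_phase S1 l1 k - total_phase S2 l2 k.

(** From the left both total phases jump, by the same amount because the
    multiplicities at k agree. *)
Lemma phase_diff_limits k eps : 0 < eps -> exists2 d : R, 0 < d &
  forall h, 0 < h -> h < d -> `|phase_diff (k + h) - phase_diff k| <= eps /\
    (0 < k -> `|phase_diff (k - h) - phase_diff k| <= eps).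
Proof.
move=> e0; have e20 : 0 < eps / 2 by rewrite divr_gt0.
have [d1 d10 h1] := total_phase_limits S1_unitary a_gt0 l1_ge l1_le a_le_b k e20.
have [d2 d20 h2] := total_phase_limits S2_unitary a_gt0 l2_ge l2_le a_le_b k e20.
exists (Num.min d1 d2); first by rewrite lt_min d10.
move=> h h0; rewrite lt_min => /andP[hd1 hd2].
have [r1 r1'] := h1 h h0 hd1; have [r2 r2'] := h2 h h0 hd2.
rewrite /phase_diff; split=> [|k0].
  move: (total_phase S1 _ _) (total_phase S1 _ _) (total_phase S2 _ _)
    (total_phase S2 _ _) r1 r2 => x y z w.
  rewrite !ler_norml => /andP[? ?] /andP[? ?].
  by apply/andP; split; lra.
rewrite (same_mult k0) in r1'.
move: (total_phase S1 _ _) (total_phase S1 _ _) (total_phase S2 _ _)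
  (total_phase S2 _ _) (_ * (pi *+ 2)) r1' r2' => x y z w u.
rewrite !ler_norml => /andP[? ?] /andP[? ?].
by apply/andP; split; lra.
Qed.

(** The exponentials of the total phases are the determinants, whose dependence
    on k is the same as the total lengths agree. *)
Lemma cis_phase_diff k k' : cis (phase_diff k - phase_diff k') = 1.
Proof.
have E q : cis (phase_diff q) = \det S1 / \det S2.
  rewrite /phase_diff cisD cisN.
  have -> : (cis (total_phase S2 l2 q))^*%C = (cis (total_phase S2 l2 q))^-1.
    apply: (mulfI (cis_neq0 (total_phase S2 l2 q))).
    by rewrite mulC_conj nc_cis expr1n divff// cis_neq0.
  rewrite !cis_total_phase// !det_evol_phase same_length invfM mulrACA.
  by rewrite divff ?mul1r// cis_neq0.
rewrite cisD cisN E -(E k') mulC_conj nc_cis expr1n.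
by [].
Qed.

(** The difference of phases takes values in a translate of 2 pi Z. *)
Lemma phase_diff_discrete k k' : `|phase_diff k - phase_diff k'| <= 1 ->
  phase_diff k = phase_diff k'.
Proof.
move=> h; apply/eqP; rewrite -subr_eq0; apply/negPn/negP => hn.
have := @cis_neq1 _ (phase_diff k - phase_diff k').
rewrite cis_phase_diff eqxx normr_gt0 hn /=.
have hp : 1 < pi :> R by apply: lt_le_trans (pi_ge2 R); rewrite ltr1n.
by move/(_ (le_lt_trans h hp)).
Qed.

Lemma phase_diff_locally_constant k : 0 < k -> exists2 d : R, 0 < d &
  forall h, `|h| < d -> phase_diff (k + h) = phase_diff k.
Proof.
move=> k0; have [d d0 hd] := phase_diff_limits k ltr01.
exists d; first exact: d0.
move=> h hhd; apply: phase_diff_discrete.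
have [h0|h0|->] := ltrgtP h 0; last by rewrite addr0 subrr normr0.
- have nh : 0 < - h by rewrite oppr_gt0.
  have nd : - h < d by rewrite -(ltr0_norm h0).
  by have [_ /(_ k0)] := hd _ nh nd; rewrite opprK.
- have hd' : h < d by rewrite -(gtr0_norm h0).
  by have [H _] := hd h h0 hd'; exact: H.
Qed.

Lemma phase_diff_constant k : 0 < k -> phase_diff k = phase_diff 0.
Proof.
move=> k0; have [d d0 hd] := phase_diff_limits 0 ltr01.
pose h := Num.min 1 (d / 2).
have h0 : 0 < h by rewrite lt_min ltr01 divr_gt0.
have -> : phase_diff 0 = phase_diff h.
  apply/esym/phase_diff_discrete; rewrite -[h]add0r; apply: (hd h h0 _).1.
  rewrite gt_min; apply/orP; right; rewrite ltr_pdivrMr// ltr_pMr//.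
  by rewrite ltr1n.
(* the exponential turns the half line into the line, where a function with
   zero derivative is constant *)
pose f (x : R) := phase_diff (expR x).
have fd (x : R) : is_derive x (1 : R) f 0.
  have [e e0 he] := phase_diff_locally_constant (expR_gt0 x).
  refine (@near_eq_is_derive _ _ _ (cst (f x)) f x 1 0 _ (is_derive_cst _ _ _)).
  have : \forall y \near x, `|expR x - expR y| < e.
    by have /cvgrPdist_lt := @continuous_expR R x; apply.
  apply: filterS => y hy; rewrite /= /f.
  have -> : expR y = expR x + (expR y - expR x) by ring.
  by rewrite he// distrC.
have := @is_derive_0_is_cst R f (ln k) (ln h) fd.
by rewrite /f !lnK ?posrE.
Qed.

(** Comparison of the two systems through an approximation of [Arg] by
    trigonometric polynomials: the total phases differ by a constant, so the
    Bohr coefficients of the approximations agree up to the mean error. *)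
Lemma bohr_compare N c0 (c : nat -> C) M a0 (a' : nat -> C) :
  (forall z : C, nc z = 1 -> `|Arg z - trigp c0 c N z| <= trigp a0 a' M z) ->
  forall nu, nc (bohr_coef (spec_es S1 l1 c0 c N) nu - bohr_coef (spec_es S2 l2 c0 c N) nu
    - (if nu == 0 then (phase_diff 0)%:C%C else 0)) <= (n1%:R + n2%:R) * a0.
Proof.
move=> happ nu.
pose E := spec_es S1 l1 c0 c N ++ es_scale (-1) (spec_es S2 l2 c0 c N) ++
   [:: (- (phase_diff 0)%:C%C, 0 : R)].
pose H := spec_es S1 l1 a0 a' M ++ spec_es S2 l2 a0 a' M.
have -> : bohr_coef (spec_es S1 l1 c0 c N) nu - bohr_coef (spec_es S2 l2 c0 c N) nu
    - (if nu == 0 then (phase_diff 0)%:C%C else 0) = bohr_coef E nu.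
  rewrite /E !bohr_coef_cat bohr_coef_scale mulN1r addrA; congr (_ + _).
  rewrite /bohr_coef big_cons big_nil /= [0 == nu]eq_sym.
  by case: eqP; rewrite ?addr0 ?oppr0.
have -> : (n1%:R + n2%:R) * a0 = complex.Re (bohr_coef H 0).
  by rewrite /H bohr_coef_cat (bohr_spec_0 _ a_gt0 l1_ge) (bohr_spec_0 _ a_gt0 l2_ge) /= mulrDl.
apply: bohr_coef_le => k k0.
rewrite /E /H !expsum_cat expsum_scale !expsum_spec// mulN1r.
have -> : expsum [:: (- (phase_diff 0)%:C%C, 0 : R)] k = - (phase_diff 0)%:C%C.
  by rewrite /expsum big_cons big_nil /= mulr0 cis0 mulr1 addr0.
rewrite -rmorphD -!rmorphN -!rmorphD nc_real -(phase_diff_constant k0) /=.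
set t1 := \sum_j trigp c0 c N _; set t2 := \sum_j trigp c0 c N _.
have -> : t1 + (- t2 - phase_diff k) =
   (total_phase S2 l2 k - t2) - (total_phase S1 l1 k - t1).
  by rewrite /phase_diff; ring.
apply: (le_trans (ler_normB _ _)); rewrite addrC.
by apply: lerD; rewrite /t1 /t2 /total_phase -sumrB;
  apply: (le_trans (ler_norm_sum _ _ _)); apply: ler_sum => j _;
  apply: happ; exact: nc_eig.
Qed.

(** The mean value of the total phases determines the multiplicities at 0. *)
Theorem mult1_at_0 : (forall i j, (S1 i j)^*%C = S1 i j) ->
  (forall i j, (S2 i j)^*%C = S2 i j) -> mult1 S1 l1 0 = mult1 S2 l2 0.
Proof.
move=> r1 r2; have hp := pi_gt0 R.
have d0 : phase_diff 0 =
    ((n1%:R - (mult1 S1 l1 0)%:R) - (n2%:R - (mult1 S2 l2 0)%:R)) * pi.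
  by rewrite /phase_diff !total_phase0// -mulrBl.
have key : forall eps, 0 < eps -> `|((mult1 S1 l1 0)%:R - (mult1 S2 l2 0)%:R) * pi|
    <= eps * (2 * (n1%:R + n2%:R)) :> R.
  move=> eps e0.
  have [N [c0 [c [M [a0 [a' [happ ha0 hc0 _ _]]]]]]] := Arg_trig_approx 0 e0.
  have := bohr_compare happ 0; rewrite eqxx.
  rewrite (bohr_spec_0 _ a_gt0 l1_ge) (bohr_spec_0 _ a_gt0 l2_ge).
  rewrite -!rmorphB nc_real d0 => h.
  have n12 : 0 <= n1%:R + n2%:R :> R by rewrite addr_ge0.
  have h2 : `|(n1%:R - n2%:R) * (c0 - pi)| <= (n1%:R + n2%:R) * eps.
    rewrite normrM ler_pM//.
    by rewrite (le_trans (ler_normB _ _))// !normr_nat.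
  have h3 : (n1%:R + n2%:R) * a0 <= (n1%:R + n2%:R) * eps by rewrite ler_wpM2l.
  move: (n1%:R : R) (n2%:R : R) ((mult1 S1 l1 0)%:R : R) ((mult1 S2 l2 0)%:R : R) h h2 h3 => x y u v h h2 h3.
  have -> : (u - v) * pi = (x * c0 - y * c0 - (x - u - (y - v)) * pi) - (x - y) * (c0 - pi).
    by ring.
  apply: (le_trans (ler_normB _ _)).
  have -> : eps * (2 * (x + y)) = (x + y) * eps + (x + y) * eps by ring.
  by apply: lerD => //; apply: le_trans h3.
apply/eqP; rewrite -(eqr_nat R) -subr_eq0; apply/negPn/negP => hn.
have h0 : 0 < `|((mult1 S1 l1 0)%:R - (mult1 S2 l2 0)%:R) * pi| :> R.
  by rewrite normr_gt0 mulf_neq0// gt_eqF.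
set D := `|_| in key h0.
pose m : R := 2 * (n1%:R + n2%:R) + 1.
have m0 : 0 < m by rewrite ltr_wpDl// mulr_ge0// addr_ge0.
have hDm : 0 < D / m / 2 by rewrite !divr_gt0.
have := key _ hDm.
apply/negP; rewrite -ltNge.
apply: (@le_lt_trans _ _ (D / m / 2 * m)).
  by rewrite ler_wpM2l ?(ltW hDm)// /m lerDl.
rewrite mulrAC divfK ?gt_eqF// ltr_pdivrMr// ltr_pMr//.
by rewrite ltr1n.
Qed.

(** If all closed walks of length [nu] of the second system contribute with the
    same sign, their contributions cannot cancel, so the first system has
    a closed walk of length [nu]. *)
Theorem closed_walk_transfer nu t0 : t0 != [::] -> walk_len l2 t0 = nu ->
  0 < cycle_weight S2 t0 ->
  (forall t, t != [::] -> walk_len l2 t = nu -> 0 <= cycle_weight S2 t) ->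
  exists2 t, t != [::] & walk_len l1 t = nu /\ cycle_weight S1 t != 0.
Proof.
move=> t0n t0nu t0w tw.
have nu0 : 0 < nu by rewrite -t0nu (walk_len_gt0 a_gt0 l2_ge).
apply: contrapT => hno.
have hW1 m : bohr_coef (walk_es S1 l1 m.+1) nu = 0.
  rewrite bohr_walk_es big1// => t /eqP tnu.
  apply/eqP/negPn/negP => tn; apply: hno; exists (tval t) => //.
  by rewrite -size_eq0 size_tuple.
pose W m := bohr_coef (walk_es S2 l2 m.+1) nu.
have W0 m : 0 <= W m.
  rewrite /W bohr_walk_es; apply: sumr_ge0 => t /eqP tnu.
  by apply: tw => //; rewrite -size_eq0 size_tuple.
have Wre m : W m = (complex.Re (W m))%:C%C by rewrite RRe_real// ger0_real.
have Wre0 m : 0 <= complex.Re (W m) by rewrite -ler0c -Wre.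
(* a walk of length nu has at most nu / a steps *)
pose n0 := (Num.truncn (nu / a)).+1.
have hn0 : nu / a < n0%:R by exact: truncnS_gt.
have Wbig m : (n0 <= m)%N -> W m = 0.
  move=> hm; rewrite /W bohr_walk_es big1// => t /eqP tnu.
  have := walk_len_ge l2_ge t; rewrite tnu size_tuple -ler_pdivlMr// => h.
  have : m.+1%:R < n0%:R :> R by exact: le_lt_trans h hn0.
  by rewrite ltr_nat ltnNge (leqW hm).
pose m0 := (size t0).-1.
have m0E : m0.+1 = size t0 by rewrite /m0 prednK// lt0n size_eq0.
have Wm0 : cycle_weight S2 t0 <= W m0.
  rewrite /W bohr_walk_es (bigD1 (tcast (esym m0E) (in_tuple t0))) /=; last first.
    by rewrite val_tcast /= t0nu.
  rewrite val_tcast /= lerDl; apply: sumr_ge0 => t /andP[/eqP tnu _].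
  by apply: tw => //; rewrite -size_eq0 size_tuple.
pose w := complex.Re (W m0).
have w0 : 0 < w by rewrite -ltcR -Wre; exact: lt_le_trans Wm0.
have m0n0 : (m0 < n0)%N.
  rewrite ltnNge; apply/negP => /Wbig E; move: w0; rewrite /w E /= ltxx.
  by [].
(* all terms below n0 have nonnegative imaginary parts, and that of the step
   number of t0 is at least D, more than the error of the comparison *)
pose D : R := w / (4 * m0.+1%:R).
have D0 : 0 < D by rewrite divr_gt0// mulr_gt0.
pose m : R := n1%:R + n2%:R + 1.
have hm0 : 0 < m by rewrite ltr_wpDl// addr_ge0.
have e0 : 0 < D / m / 2 by rewrite !divr_gt0.
have [N [c0 [c [M [a0 [a' [happ ha0 _ hN hc]]]]]]] := Arg_trig_approx n0 e0.
have := bohr_compare happ nu; rewrite (gt_eqF nu0) subr0.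
rewrite (bohr_spec_gt0 _ a_gt0 l1_ge _ _ _ nu0) (bohr_spec_gt0 _ a_gt0 l2_ge _ _ _ nu0).
rewrite big1 ?sub0r ?ncN; last by move=> i _; rewrite hW1 mulr0.
apply/negP; rewrite -ltNge.
apply: (@lt_le_trans _ _ D).
  apply: (@le_lt_trans _ _ (m * (D / m / 2))).
    apply: (@le_trans _ _ ((n1%:R + n2%:R) * (D / m / 2))).
      by rewrite ler_wpM2l// addr_ge0.
    by rewrite ler_wpM2r ?(ltW e0)// lerDl.
  have -> : m * (D / m / 2) = D / 2 by field; rewrite gt_eqF.
  by rewrite ltr_pdivrMr// ltr_pMr// ltr1n.
apply: le_trans (Im_le_nc _); apply: le_trans (ler_norm _).
rewrite Im_sum.
have hterm i : complex.Im (c i * bohr_coef (walk_es S2 l2 i.+1) nu) =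
   complex.Re (W i) * complex.Im (c i).
  by rewrite -/(W i) Wre mulrC ImM_real.
have hi0 : (m0 < N)%N by apply: leq_trans hN.
rewrite (bigD1 (Ordinal hi0)) //= hterm -[leLHS]addr0; apply: lerD.
  rewrite -/w /D ler_pM2l//.
  by apply: le_trans (hc _ m0n0); rewrite mul1r.
apply: sumr_ge0 => i _; rewrite hterm.
have [hi|hi] := ltnP i n0; last by rewrite Wbig ?mul0r.
by rewrite mulr_ge0// (le_trans _ (hc _ hi))// divr_ge0.
Qed.

End TwoSystems.

(** * Solutions of the eigenvalue equation on one edge *)

Section EdgeEquation.
Variable R : realType.
Local Notation mu := (@lebesgue_measure R).
Implicit Types (l k x : R) (u v w : R -> R).

(** On a bounded interval, from |u| <= 1 + u^2. *)
Lemma square_integrable_integrable l u : square_integrable l u ->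
  mu.-integrable `[0, l] (EFin \o u).
Proof.
move=> [mu_u iu].
have m0l : measurable (`[0, l]%classic : set (measurableTypeR R)).
  exact: measurable_itv.
have i1 : mu.-integrable `[0, l] (EFin \o cst 1 : measurableTypeR R -> \bar R).
  apply: continuous_compact_integrable; first exact: segment_compact.
  by apply: continuous_subspaceT => x; exact: cst_continuous.
have isum := integrableD m0l i1 iu.
apply: (le_integrable m0l _ _ isum); first exact/measurable_EFinP.
move=> x _ /=; rewrite !lee_fin.
have h : 0 <= 1 + u x ^+ 2 by rewrite addr_ge0// sqr_ge0.
rewrite (ger0_norm h) ler_norml.
have h1 := sqr_ge0 (u x - 1); have h2 := sqr_ge0 (u x + 1).
rewrite !expr2 in h1 h2 *; apply/andP; split; nra.
Qed.

Lemma primitive_continuous l u v : 0 <= l ->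
  mu.-integrable `[0, l] (EFin \o v) ->
  (forall x, x \in `[0, l] -> u x = u 0 + \int[mu]_(t in `[0, x]) v t) ->
  {within `[0, l], continuous u}.
Proof.
move=> l0 iv hu.
have hc := parameterized_integral_continuous l0 iv.
apply: (@subspace_eq_continuous _ _ _ (fun x => u 0 + parameterized_integral mu 0 x v)).
  by move=> x; rewrite inE => xl; apply/esym/hu.
by move=> x; apply: cvgD; [exact: cvg_cst|exact: hc].
Qed.

Lemma primitive_is_derive l u v x : 0 < x -> x < l ->
  mu.-integrable `[0, l] (EFin \o v) -> {within `[0, l], continuous v} ->
  (forall x, x \in `[0, l] -> u x = u 0 + \int[mu]_(t in `[0, x]) v t) ->
  is_derive x 1 u (v x).
Proof.
move=> x0 xl iv cv hu.
have cvx : {for x, continuous v}.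
  have : x \in `]0, l[ by rewrite in_itv/= x0.
  by have /continuous_within_itvP[|h _ _] := cv; [exact: lt_trans xl|exact: h].
have [dF EF] := continuous_FTC1_closed xl iv x0 cvx.
have hd : is_derive x 1 (fun y => u 0 + \int[mu]_(t in `[0, y]) v t) (v x).
  rewrite -EF derive1E -[X in is_derive _ _ _ X]add0r.
  by apply: is_deriveD; exact: DeriveDef.
refine (@near_eq_is_derive _ _ _ _ u x 1 (v x) _ hd).
have : x \in `]0, l[ by rewrite in_itv/= x0.
  move=> /near_in_itvoo; apply: filterS => y.
  rewrite in_itv/= => /andP[y0 yl]; apply/esym/hu.
  by rewrite in_itv/= !ltW.
Qed.

Lemma zero_derive_constant l u : {within `[0, l], continuous u} ->
  (forall x, 0 < x -> x < l -> is_derive x 1 u 0) ->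
  forall x, x \in `[0, l] -> u x = u 0.
Proof.
move=> cu du x; rewrite in_itv/= => /andP[]; rewrite le_eqVlt.
move=> /orP[/eqP<-//|x0 xl].
have cux : {within `[0, x], continuous u}.
  apply: continuous_subspaceW cu => y /=; rewrite !in_itv/= => /andP[-> h] /=.
  exact: le_trans xl.
have dux y : y \in `]0, x[ -> is_derive y 1 u (cst (0 : R) y).
  by rewrite in_itv/= => /andP[y0 yx]; apply: du => //; exact: lt_le_trans xl.
have [c _] := MVT x0 dux cux.
by rewrite mul0r => /eqP; rewrite subr_eq0 => /eqP.
Qed.

Lemma is_derive_scale k x : is_derive x (1 : R) (k \*: id) k.
Proof. by rewrite -[X in is_derive _ _ _ X]mulr1; exact: is_deriveZ. Qed.

Lemma is_derive_cosM k x :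
  is_derive x (1 : R) (fun y : R => cos (k * y)) (- (k * sin (k * x))).
Proof.
have := is_derive1_comp (is_derive_cos (k * x)) (is_derive_scale k x).
by rewrite mulNr mulrC.
Qed.

Lemma is_derive_sinM k x :
  is_derive x (1 : R) (fun y : R => sin (k * y)) (k * cos (k * x)).
Proof.
have := is_derive1_comp (is_derive_sin (k * x)) (is_derive_scale k x).
by rewrite mulrC.
Qed.

Lemma is_derive_linM (a b : R) (f g : R -> R) x df dg :
  is_derive x (1 : R) f df -> is_derive x (1 : R) g dg ->
  is_derive x (1 : R) (fun y => a * f y + b * g y) (a * df + b * dg).
Proof.
move=> hf hg; have h1 : is_derive x 1 (a \*: f) (a *: df) by exact: is_deriveZ.
have h2 : is_derive x 1 (b \*: g) (b *: dg) by exact: is_deriveZ.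
exact: is_deriveD.
Qed.

Lemma is_derive_prodM (f g : R -> R) x df dg :
  is_derive x (1 : R) f df -> is_derive x (1 : R) g dg ->
  is_derive x (1 : R) (fun y => f y * g y) (f x * dg + g x * df).
Proof. by move=> hf hg; exact: is_deriveM. Qed.

Lemma continuous_cosM k : continuous (fun y : R => cos (k * y)).
Proof.
move=> x; apply: continuous_comp; last exact: continuous_cos.
exact: mulrl_continuous.
Qed.

Lemma continuous_sinM k : continuous (fun y : R => sin (k * y)).
Proof.
move=> x; apply: continuous_comp; last exact: continuous_sin.
exact: mulrl_continuous.
Qed.

Lemma within_continuousM (D : set R) (f g : R -> R) :
  {within D, continuous f} -> {within D, continuous g} ->
  {within D, continuous (fun x => f x * g x)}.
Proof. by move=> hf hg x; apply: cvgM; [exact: hf|exact: hg]. Qed.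

Lemma within_continuousD (D : set R) (f g : R -> R) :
  {within D, continuous f} -> {within D, continuous g} ->
  {within D, continuous (fun x => f x + g x)}.
Proof. by move=> hf hg x; apply: cvgD; [exact: hf|exact: hg]. Qed.

Lemma ae_Rintegral l (f g : R -> R) : measurable_fun `[0, l] f ->
  measurable_fun `[0, l] g ->
  {ae mu, forall x, x \in `[0, l] -> f x = g x} ->
  forall x, x \in `[0, l] -> \int[mu]_(t in `[0, x]) f t = \int[mu]_(t in `[0, x]) g t.
Proof.
move=> mf mg fg x; rewrite in_itv/= => /andP[x0 xl].
have m0x : measurable (`[0, x]%classic : set (measurableTypeR R)).
  exact: measurable_itv.
have m0l : measurable (`[0, l]%classic : set (measurableTypeR R)).
  exact: measurable_itv.
have sub : `[0, x]%classic `<=` `[0, l]%classic.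
  by move=> y /=; rewrite !in_itv/= => /andP[-> h]; exact: le_trans xl.
rewrite /Rintegral; congr fine; apply: ae_eq_integral => //.
- by apply/measurable_EFinP; exact: measurable_funS mf.
- by apply/measurable_EFinP; exact: measurable_funS mg.
apply: (@filterS _ _ (ae_filter_ringOfSetsType mu) _ _ _ fg) => t h xt; rewrite h//; exact: (sub t xt).
Qed.

(** A weak solution of -u'' = k^2 u is a combination of cos and sin: the two
    quantities A and B of the proof are first integrals. *)
Lemma edge_solution l k u u1 u2 : 0 < l -> 0 < k -> sobolev2_real l u u1 u2 ->
  {ae mu, forall x, x \in `[0, l] -> k ^+ 2 * u x = - u2 x} ->
  forall x, x \in `[0, l] ->
    u x = u 0 * cos (k * x) + u1 0 / k * sin (k * x) /\
    u1 x = - (k * u 0) * sin (k * x) + u1 0 * cos (k * x).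
Proof.
move=> l0 k0 [sq2 hu1 hu] hae.
have l0' := ltW l0; have kn0 : k != 0 by rewrite gt_eqF.
have m0l : measurable (`[0, l]%classic : set (measurableTypeR R)).
  exact: measurable_itv.
have i2 := square_integrable_integrable sq2.
have c1 := primitive_continuous l0' i2 hu1.
have i1 : mu.-integrable `[0, l] (EFin \o u1).
  by apply: continuous_compact_integrable => //; exact: segment_compact.
have c0 := primitive_continuous l0' i1 hu.
have ck : {within `[0, l], continuous (fun x => - k ^+ 2 * u x)}.
  by apply: within_continuousM => // x; exact: cst_continuous.
have ik : mu.-integrable `[0, l] (EFin \o (fun x => - k ^+ 2 * u x)).
  by apply: continuous_compact_integrable => //; exact: segment_compact.
have hu1' x : x \in `[0, l] -> u1 x = u1 0 + \int[mu]_(t in `[0, x]) (- k ^+ 2 * u t).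
  move=> xl; rewrite hu1//; congr (_ + _); apply: ae_Rintegral xl.
  - by case: sq2.
  - by have /integrableP[/measurable_EFinP] := ik.
  - apply: (@filterS _ _ (ae_filter_ringOfSetsType mu) _ _ _ hae) => t h tl.
    by rewrite mulNr h// opprK.
have du x : 0 < x -> x < l -> is_derive x 1 u (u1 x).
  by move=> x0 xl; exact: primitive_is_derive xl i1 c1 hu.
have du1 x : 0 < x -> x < l -> is_derive x 1 u1 (- k ^+ 2 * u x).
  by move=> x0 xl; exact: primitive_is_derive xl ik ck hu1'.
pose A := fun x => 1 * (u x * cos (k * x)) + (- k^-1) * (u1 x * sin (k * x)).
pose B := fun x => 1 * (u x * sin (k * x)) + k^-1 * (u1 x * cos (k * x)).
have wc f : continuous f -> {within `[0, l], continuous (f : R -> R)}.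
  exact: continuous_subspaceT.
have cst_c (q : R) : {within `[0, l], continuous (cst q : R -> R)}.
  by apply: wc => x; exact: cst_continuous.
have wcc := wc _ (@continuous_cosM k); have wcs := wc _ (@continuous_sinM k).
have hA x : x \in `[0, l] -> A x = A 0.
  apply: zero_derive_constant.
    by apply: within_continuousD; apply: within_continuousM; first [exact: cst_c|exact: within_continuousM].
  move=> y y0 yl.
  have h1 := is_derive_prodM (du y y0 yl) (is_derive_cosM k y).
  have h2 := is_derive_prodM (du1 y y0 yl) (is_derive_sinM k y).
  have := is_derive_linM 1 (- k^-1) h1 h2.
  by move=> h; apply: (is_derive_eq h); field.
have hB x : x \in `[0, l] -> B x = B 0.
  apply: zero_derive_constant.
    by apply: within_continuousD; apply: within_continuousM; first [exact: cst_c|exact: within_continuousM].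
  move=> y y0 yl.
  have h1 := is_derive_prodM (du y y0 yl) (is_derive_sinM k y).
  have h2 := is_derive_prodM (du1 y y0 yl) (is_derive_cosM k y).
  have := is_derive_linM 1 (k^-1) h1 h2.
  by move=> h; apply: (is_derive_eq h); field.
move=> x xl; have := hA x xl; have := hB x xl.
rewrite /A /B !mul1r mulr0 cos0 sin0 !mulr0 !mulr1 addr0 add0r => EB EA.
have hs := cos2Dsin2 (k * x).
set c := cos (k * x) in EA EB hs *; set s := sin (k * x) in EA EB hs *.
split.
  have -> : u x = (u x * c + - k^-1 * (u1 x * s)) * c + (u x * s + k^-1 * (u1 x * c)) * s.
    transitivity (u x * (c ^+ 2 + s ^+ 2)); first by rewrite hs mulr1.
    by ring.
  by rewrite EA EB; ring.
have -> : u1 x = - k * (u x * c + - k^-1 * (u1 x * s)) * s + k * (u x * s + k^-1 * (u1 x * c)) * c.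
  transitivity (u1 x * (c ^+ 2 + s ^+ 2)); first by rewrite hs mulr1.
  by field.
by rewrite EA EB; field.
Qed.

Lemma FTC2_primitive l u v : 0 < l -> continuous v ->
  (forall x, is_derive x (1 : R) u (v x)) ->
  forall x, x \in `[0, l] -> u x = u 0 + \int[mu]_(t in `[0, x]) v t.
Proof.
move=> l0 cv du x; rewrite in_itv/= => /andP[]; rewrite le_eqVlt => /orP[/eqP<-|x0] _.
  by rewrite set_itv1 Rintegral_set1 addr0.
have cu : continuous u.
  by move=> y; apply: differentiable_continuous; apply/derivable1_diffP; case: (du y).
rewrite /Rintegral (@continuous_FTC2 _ v u 0 x)//=; first by ring.
- exact: continuous_subspaceT.
- split.
  + by move=> y _; case: (du y).
  + by apply: cvg_at_right_filter; exact: cu.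
  + by apply: cvg_at_left_filter; exact: cu.
- by move=> y _; rewrite derive1E; case: (du y).
Qed.

Lemma sobolev2_trig l k (A B : R) u : 0 < l ->
  (forall x, x \in `[0, l] -> u x = A * cos (k * x) + B * sin (k * x)) ->
  sobolev2_real l u (fun x => A * (- (k * sin (k * x))) + B * (k * cos (k * x)))
    (fun x => - k ^+ 2 * (A * cos (k * x) + B * sin (k * x))).
Proof.
move=> l0 hu.
pose u0 x := A * cos (k * x) + B * sin (k * x).
pose u1 x := A * (- (k * sin (k * x))) + B * (k * cos (k * x)).
pose u2 x := - k ^+ 2 * u0 x.
have cs := @continuous_sinM k; have cc := @continuous_cosM k.
have cst_c (q : R) : continuous (cst q : R -> R) by move=> x; exact: cst_continuous.
have c0 : continuous u0.
  by move=> x; apply: cvgD; apply: cvgM; first [exact: cst_c|exact: cc|exact: cs].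
have c1 : continuous u1.
  move=> x; apply: cvgD; apply: cvgM; first [exact: cst_c|idtac].
  - by apply: cvgN; apply: cvgM; first [exact: cst_c|exact: cs].
  - by apply: cvgM; first [exact: cst_c|exact: cc].
have c2 : continuous u2.
  by move=> x; apply: cvgM; first [exact: cst_c|exact: c0].
have c22 : continuous (fun x => u2 x ^+ 2).
  by move=> x; apply: (@cvgM _ _ _ _ u2 u2); exact: c2.
have d0 x : is_derive x (1 : R) u0 (u1 x).
  exact: is_derive_linM (is_derive_cosM k x) (is_derive_sinM k x).
have d1 x : is_derive x (1 : R) u1 (u2 x).
  have := is_derive_linM (- (k * A)) (k * B) (is_derive_sinM k x) (is_derive_cosM k x).
  have -> : (fun y => - (k * A) * sin (k * y) + k * B * cos (k * y)) = u1.
    by apply/funext => y; rewrite /u1; ring.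
  by move=> h; apply: (is_derive_eq h); rewrite /u2 /u0; ring.
split.
- split.
    by apply: measurable_funTS; exact: continuous_measurable_fun.
  apply: (@continuous_compact_integrable _ (fun x => u2 x ^+ 2)).
    exact: segment_compact.
  exact: continuous_subspaceT.
- exact: FTC2_primitive c2 d1.
- move=> x xl; have z0l : 0 \in `[0, l] by rewrite in_itv/= lexx ltW.
  by rewrite (hu _ xl) (hu _ z0l); exact: (FTC2_primitive l0 c1 d0).
Qed.

End EdgeEquation.

(** * The scattering system of a quantum graph *)

Section Bonds.
Variable G : graph.

Definition bond : finType := (edge G * bool)%type.
Implicit Types c d : bond.

Definition btail c : vertex G := if c.2 then src c.1 else tgt c.1.
Definition bhead c : vertex G := if c.2 then tgt c.1 else src c.1.
Definition brev c : bond := (c.1, ~~ c.2).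

Lemma brevK : involutive brev.
Proof. by case=> e s; rewrite /brev /= negbK. Qed.

Lemma btail_rev c : btail (brev c) = bhead c.
Proof. by case: c => e []. Qed.

Lemma bhead_rev c : bhead (brev c) = btail c.
Proof. by case: c => e []. Qed.

Lemma brev_neq c : brev c != c.
Proof. by case: c => e []; rewrite /brev xpair_eqE eqxx. Qed.

Lemma sum_bonds (V : nmodType) (F : bond -> V) (P : pred bond) :
  \sum_(c | P c) F c =
  \sum_(e | P (e, true)) F (e, true) + \sum_(e | P (e, false)) F (e, false).
Proof.
rewrite [LHS]big_mkcond [X in _ = X + _]big_mkcond [X in _ = _ + X]big_mkcond.
rewrite -big_split /= (eq_bigr (fun c : edge G * bool => (fun e s => if P (e, s) then F (e, s) else 0) c.1 c.2)); last by case.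
rewrite -(pair_bigA _ (fun e s => if P (e, s) then F (e, s) else 0)) /=.
by apply: eq_bigr => e _; rewrite big_bool.
Qed.

Lemma card_out v : #|[pred c | btail c == v]| = degree v.
Proof.
rewrite -sum1_card sum_bonds /degree !cardsE -!sum1_card.
by congr (_ + _)%N; apply: eq_bigl => e; rewrite !inE.
Qed.

Lemma reindex_rev (V : nmodType) (F : bond -> V) (P : pred bond) :
  \sum_(c | P c) F c = \sum_(c | P (brev c)) F (brev c).
Proof. exact: reindex_inj (inv_inj brevK). Qed.

End Bonds.

Section Scattering.
Variables (R : realType) (G : qgraph R).
Local Notation C := R[i].
Local Notation bond := (bond G).
Implicit Types (c d : bond) (alpha : bond -> C).
Hypothesis deg_neq0 : forall v : vertex G, degree v != 0%N.

Definition degC (v : vertex G) : C := (degree v)%:R.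

Lemma degC_neq0 v : degC v != 0.
Proof. by rewrite pnatr_eq0 deg_neq0. Qed.

(** An incoming wave of amplitude 1 leaves in each direction with amplitude
    2 / deg, and the reflected one is diminished by 1: these are the values for
    which the wave is continuous and the derivatives add up to 0. *)
Definition scat c d : C :=
  (if bhead c == btail d then 2 / degC (bhead c) else 0) - (d == brev c)%:R.

Lemma scat_real c d : (scat c d)^*%C = scat c d.
Proof.
rewrite /scat conjcB conjc_nat; congr (_ - _).
case: ifP => _; last exact: conjc0.
by rewrite conjcM conjc_inv !conjc_nat.
Qed.

Lemma sum_scat (F : bond -> C) d : \sum_c F c * scat c d =
  2 / degC (btail d) * (\sum_(c | bhead c == btail d) F c) - F (brev d).
Proof.
rewrite /scat; under eq_bigr => c _ do rewrite mulrBr.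
rewrite sumrB; congr (_ - _).
  rewrite mulr_sumr [RHS]big_mkcond; apply: eq_bigr => c _.
  by case: eqP => [->|_]; rewrite ?mulr0// mulrC.
rewrite (bigD1 (brev d)) //= brevK eqxx mulr1 big1 ?addr0// => c hc.
case: eqP => [E|]; rewrite ?mulr0//.
by rewrite E brevK eqxx in hc.
Qed.

(** Composed with the reversal of bonds, [scat] is at each vertex the reflection
    with entries 2 / deg - delta: it is symmetric and its square is 1. *)
Lemma sum_scat_sq c d : \sum_x scat c x * scat d x = (c == d)%:R.
Proof.
transitivity (\sum_x scat c (brev x) * scat d (brev x)).
  exact: (reindex_rev _ xpredT).
have E x : scat c (brev x) * scat d (brev x) = scat x (brev c) * scat x (brev d).
  have sym y z : scat y (brev z) = scat z (brev y).
    rewrite /scat !btail_rev (eq_sym (bhead y)).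
    congr (_ - _); first by case: eqP => [->|].
    by rewrite (inj_eq (inv_inj (@brevK G))) (inj_eq (inv_inj (@brevK G))) eq_sym.
  by rewrite sym (sym d).
rewrite (eq_bigr _ (fun x _ => E x)).
rewrite (sum_scat (fun x => scat x (brev c))) brevK btail_rev.
have -> : \sum_(x | bhead x == bhead d) scat x (brev c) =
   if bhead c == bhead d then 1 else 0.
  have := sum_scat (fun x => (bhead x == bhead d)%:R) (brev c).
  under eq_bigr => x _ do rewrite mulr_natl mulrb.
  rewrite -big_mkcond /= => ->; rewrite btail_rev brevK.
  case: (eqVneq (bhead c) (bhead d)) => [E1|N1].
    rewrite E1 (eq_bigr (fun=> 1)) => [|x /eqP ->]; last by rewrite eqxx.
    rewrite sumr_const.
    have -> : #|[pred x | bhead x == bhead d]| = degree (bhead d).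
      rewrite -card_out -!sum1_card.
      rewrite [LHS](reindex_rev (fun=> 1%N)).
      by apply: eq_bigl => x; rewrite !inE bhead_rev.
    rewrite divfK ?pnatr_eq0 ?deg_neq0// (_ : true%:R = 1 :> C)//; ring.
  rewrite big1 ?mulr0 ?subr0// => x /eqP ->.
  by rewrite (negbTE N1).
rewrite /scat btail_rev (inj_eq (inv_inj (@brevK G))) eq_sym.
case: (eqVneq (bhead c) (bhead d)) => [E1|N1].
  by ring.
by rewrite mulr0 !sub0r opprK.
Qed.

(** Sources and sinks at a vertex: the scattering condition says that the wave
    is continuous at each vertex and that the currents cancel there. *)
Lemma scattering_iff (out inn : bond -> C) :
  (forall d, out d = \sum_c inn c * scat c d) <->
  (exists phi : vertex G -> C, forall d, out d + inn (brev d) = phi (btail d)) /\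
  (forall v, \sum_(d | btail d == v) (out d - inn (brev d)) = 0).
Proof.
have inE v : \sum_(c | bhead c == v) inn c = \sum_(d | btail d == v) inn (brev d).
  by rewrite reindex_rev; apply: eq_bigl => x; rewrite bhead_rev.
have cardE v (z : C) : \sum_(d : bond | btail d == v) z = degC v * z.
  by rewrite sumr_const -[LHS]mulr_natl /degC -card_out; congr (_%:R * _).
split=> [h|[[phi hphi] hcur] d].
  pose phi v := 2 / degC v * (\sum_(c | bhead c == v) inn c).
  have hphi d : out d + inn (brev d) = phi (btail d) by rewrite h sum_scat subrK.
  split; first by exists phi.
  move=> v; rewrite sumrB.
  have -> : \sum_(d | btail d == v) out d =
     \sum_(d | btail d == v) phi v - \sum_(d | btail d == v) inn (brev d).
    rewrite -sumrB; apply: eq_bigr => d /eqP <-.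
    by rewrite -hphi addrK.
  rewrite cardE /phi inE -addrA -opprD -mulr2n mulrA [degC v * _]mulrC divfK ?degC_neq0//.
  by rewrite mulr_natl subrr.
rewrite sum_scat inE.
have E : degC (btail d) * phi (btail d) =
   2 * \sum_(x | btail x == btail d) inn (brev x).
  have h1 : \sum_(x | btail x == btail d) (out x + inn (brev x)) =
     degC (btail d) * phi (btail d).
    by rewrite -cardE; apply: eq_bigr => x /eqP <-; exact: hphi.
  have h2 := hcur (btail d); rewrite sumrB in h2.
  rewrite -h1 big_split /= (subr0_eq h2); ring.
by rewrite mulrAC -E mulrAC divff ?degC_neq0// mul1r -hphi addrK.
Qed.

Definition nb : nat := #|bond|.
Definition scat_mx : 'M[C]_nb := \matrix_(i, j) scat (enum_val i) (enum_val j).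
Definition bond_len (i : 'I_nb) : R := elen (enum_val i).1.

Lemma scat_mx_unitary : scat_mx \is unitarymx.
Proof.
rewrite unitary_adj; apply/eqP/matrixP => i j; rewrite !mxE.
under eq_bigr => k _ do rewrite !mxE scat_real.
transitivity (\sum_x scat (enum_val i) x * scat (enum_val j) x).
  by rewrite [RHS](reindex (@enum_val _ bond))//=; exists enum_rank => x _; rewrite ?enum_valK ?enum_rankK.
by rewrite sum_scat_sq (inj_eq enum_val_inj).
Qed.

Lemma sum_enum_val (F : bond -> C) : \sum_(i < nb) F (enum_val i) = \sum_c F c.
Proof.
rewrite [RHS](reindex (@enum_val _ bond))//=.
by exists enum_rank => x _; rewrite ?enum_valK ?enum_rankK.
Qed.

(** * Eigenfunctions as standing waves *)

Local Notation mu := (@lebesgue_measure R).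
Variable k : R.
Hypothesis k_gt0 : 0 < k.

Definition inn (alpha : bond -> C) c : C := alpha c * cis (k * elen c.1).

Definition wave_eq (alpha : bond -> C) : Prop :=
  forall d, alpha d = \sum_c inn alpha c * scat c d.

Definition cos_amp (alpha : bond -> C) e : C := alpha (e, true) + inn alpha (e, false).
Definition sin_amp (alpha : bond -> C) e : C :=
  'i%C * (alpha (e, true) - inn alpha (e, false)).

Definition trigf (A B : C) (x : R) : C := A * (cos (k * x))%:C%C + B * (sin (k * x))%:C%C.
Definition dtrigf (A B : C) (x : R) : C :=
  A * (- (k * sin (k * x)))%:C%C + B * (k * cos (k * x))%:C%C.

(** alpha c is the amplitude of the wave leaving along c and [inn alpha c] its
    value on arrival; on an edge the waves of the two orientations superpose. *)
Definition wave (alpha : bond -> C) (e : edge G) (x : R) : C :=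
  if x \in `[0, elen e] then trigf (cos_amp alpha e) (sin_amp alpha e) x else 0.

Lemma ReM_realr (z : C) (x : R) : complex.Re (z * x%:C%C) = complex.Re z * x.
Proof. by rewrite mulrC ReM_real mulrC. Qed.
Lemma ImM_realr (z : C) (x : R) : complex.Im (z * x%:C%C) = complex.Im z * x.
Proof. by rewrite mulrC ImM_real mulrC. Qed.
Lemma ReD (z w : C) : complex.Re (z + w) = complex.Re z + complex.Re w.
Proof. exact: raddfD. Qed.
Lemma ImD (z w : C) : complex.Im (z + w) = complex.Im z + complex.Im w.
Proof. exact: raddfD. Qed.

Lemma cisE (x : R) : cis x = (cos x)%:C%C + 'i%C * (sin x)%:C%C :> C.
Proof. by rewrite [LHS]complexE. Qed.

Lemma sqr_ii : 'i%C * 'i%C = -1 :> C.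
Proof. by rewrite -expr2 sqr_i. Qed.

Lemma wave_ends alpha e :
  [/\ wave alpha e 0 = alpha (e, true) + inn alpha (e, false),
      wave alpha e (elen e) = alpha (e, false) + inn alpha (e, true),
      dtrigf (cos_amp alpha e) (sin_amp alpha e) 0 =
        k%:C%C * 'i%C * (alpha (e, true) - inn alpha (e, false))
    & dtrigf (cos_amp alpha e) (sin_amp alpha e) (elen e) =
        - (k%:C%C * 'i%C * (alpha (e, false) - inn alpha (e, true)))].
Proof.
have l0 := elen_gt0 e.
have hc : (cos (k * elen e))%:C%C ^+ 2 + (sin (k * elen e))%:C%C ^+ 2 = 1 :> C.
  by rewrite -!rmorphXn -rmorphD /= cos2Dsin2.
rewrite /wave !in_itv/= !lexx (ltW l0) /=.
rewrite /trigf /dtrigf /cos_amp /sin_amp /inn /= !cisE !mulr0 cos0 sin0.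
rewrite !rmorphN !rmorphM /= ?mulr0 ?rmorph0 ?rmorph1.
move: (cos _)%:C%C (sin _)%:C%C (alpha _) (alpha _) hc => c s x y hc.
have ii := sqr_ii; set j := 'i%C in ii *; set K := k%:C%C.
have [E1 E2] : c ^+ 2 = 1 - s ^+ 2 /\ j ^+ 2 = -1 by split; [rewrite -hc; ring|rewrite expr2].
split.
- by ring.
- transitivity (y * (c + j * s) + x * (c ^+ 2 - j ^+ 2 * s ^+ 2)); first by ring.
  by rewrite E1 E2; ring.
- by ring.
- transitivity (K * (y * (j * c - s) - x * (c * s * (1 + j ^+ 2) + j * (c ^+ 2 + s ^+ 2)))).
    by ring.
  rewrite hc E2.
  transitivity (K * (y * (j * c + j ^+ 2 * s) - x * j)); first by rewrite E2; ring.
  by ring.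
Qed.

Lemma trigf_sobolev (A B : C) (l : R) (f : R -> C) : 0 < l ->
  (forall x, x \in `[0, l] -> f x = trigf A B x) ->
  sobolev2 l f (dtrigf A B) (fun x => - (k ^+ 2)%:C%C * trigf A B x).
Proof.
move=> l0 hf; split.
  have := @sobolev2_trig R l k (complex.Re A) (complex.Re B) (@complex.Re R \o f) l0.
  have -> : (@complex.Re R \o dtrigf A B) =
    (fun x => complex.Re A * - (k * sin (k * x)) + complex.Re B * (k * cos (k * x))).
    by apply/funext => x; rewrite /= /dtrigf ReD !ReM_realr.
  have -> : (@complex.Re R \o (fun x => - (k ^+ 2)%:C%C * trigf A B x)) =
    (fun x => - k ^+ 2 * (complex.Re A * cos (k * x) + complex.Re B * sin (k * x))).
    by apply/funext => x; rewrite /= -rmorphN ReM_real /trigf ReD !ReM_realr.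
  by apply=> x xl /=; rewrite hf// /trigf ReD !ReM_realr.
have := @sobolev2_trig R l k (complex.Im A) (complex.Im B) (@complex.Im R \o f) l0.
have -> : (@complex.Im R \o dtrigf A B) =
  (fun x => complex.Im A * - (k * sin (k * x)) + complex.Im B * (k * cos (k * x))).
  by apply/funext => x; rewrite /= /dtrigf ImD !ImM_realr.
have -> : (@complex.Im R \o (fun x => - (k ^+ 2)%:C%C * trigf A B x)) =
  (fun x => - k ^+ 2 * (complex.Im A * cos (k * x) + complex.Im B * sin (k * x))).
  by apply/funext => x; rewrite /= -rmorphN ImM_real /trigf ImD !ImM_realr.
by apply=> x xl /=; rewrite hf// /trigf ImD !ImM_realr.
Qed.

Lemma wave_eigenfunction alpha : wave_eq alpha ->
  eigenspace0 (G := G) (k ^+ 2)%:C%C (wave alpha).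
Proof.
move=> /scattering_iff[[phi hphi] hcur].
exists (fun e => dtrigf (cos_amp alpha e) (sin_amp alpha e)),
  (fun e x => - (k ^+ 2)%:C%C * trigf (cos_amp alpha e) (sin_amp alpha e) x).
split.
- by move=> e x /negbTE h; rewrite /wave h.
- exists phi => e; have [-> -> _ _] := wave_ends alpha e.
  by have := hphi (e, true); have := hphi (e, false); rewrite /btail /brev /= => -> ->.
- move=> e; apply: trigf_sobolev; first exact: elen_gt0.
  by move=> x xl; rewrite /wave xl.
- move=> v; have := hcur v; rewrite sum_bonds /btail /brev /= => h.
  under eq_bigr => e _ do [have [_ _ _ ->] := wave_ends alpha e].
  under [X in _ - X]eq_bigr => e _ do [have [_ _ -> _] := wave_ends alpha e].
  rewrite sumrN -opprD -!mulr_sumr -mulrDr addrC.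
  by rewrite h mulr0 oppr0.
- move=> e; apply: (@aeW _ _ _ mu) => x xl.
  by rewrite /wave xl mulNr opprK.
Qed.

(** The values and derivatives at the start of an edge determine the solution
    there, hence the two amplitudes. *)
Lemma eigenfunction_wave f : eigenspace0 (G := G) (k ^+ 2)%:C%C f ->
  exists2 alpha, wave_eq alpha & f = wave alpha.
Proof.
move=> [f1 [f2 [fon [phi fv] fs fk fae]]].
have kC : k%:C%C != 0 :> C by rewrite eq_complex /= eqxx andbT gt_eqF.
have ii := sqr_ii.
have sol e x : x \in `[0, elen e] ->
    f e x = trigf (f e 0) (f1 e 0 / k%:C%C) x /\ f1 e x = dtrigf (f e 0) (f1 e 0 / k%:C%C) x.
  have [sR sI] := fs e; have l0 := elen_gt0 e.
  have aeR : {ae mu, forall x, x \in `[0, elen e] ->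
      k ^+ 2 * (@complex.Re R \o f e) x = - (@complex.Re R \o f2 e) x}.
    apply: (@filterS _ _ (ae_filter_ringOfSetsType mu) _ _ _ (fae e)) => t h tl /=.
    by rewrite -ReM_real h// raddfN.
  have aeI : {ae mu, forall x, x \in `[0, elen e] ->
      k ^+ 2 * (@complex.Im R \o f e) x = - (@complex.Im R \o f2 e) x}.
    apply: (@filterS _ _ (ae_filter_ringOfSetsType mu) _ _ _ (fae e)) => t h tl /=.
    by rewrite -ImM_real h// raddfN.
  move=> xl; have [R1 R2] := edge_solution l0 k_gt0 sR aeR xl.
  have [I1 I2] := edge_solution l0 k_gt0 sI aeI xl.
  move: R1 R2 I1 I2 => /= R1 R2 I1 I2.
  have kk : k != 0 by rewrite gt_eqF.
  have E : f1 e 0 / k%:C%C = f1 e 0 * (k^-1)%:C%C by rewrite fmorphV.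
  split.
    apply/eqP; rewrite eq_complex R1 I1 /trigf ReD ImD !ReM_realr !ImM_realr E.
    by rewrite ReM_realr ImM_realr !eqxx.
  apply/eqP; rewrite eq_complex R2 I2 /dtrigf ReD ImD !ReM_realr !ImM_realr E.
  rewrite ReM_realr ImM_realr; apply/andP; split; apply/eqP; field => //.
pose A e := f e 0; pose B e := f1 e 0 / k%:C%C.
pose alpha (c : bond) : C := if c.2 then (A c.1 - 'i%C * B c.1) / 2
  else (A c.1 + 'i%C * B c.1) / 2 * (cis (k * elen c.1))^*%C.
have hinn e : inn alpha (e, false) = (A e + 'i%C * B e) / 2.
  have hcc (t : R) : (cis t)^*%C * cis t = 1 by rewrite mulrC mulC_conj nc_cis expr1n.
  rewrite /inn [alpha (e, false)](_ : _ = (A e + 'i%C * B e) / 2 * (cis (k * elen e))^*%C)//.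
  by rewrite -mulrA hcc mulr1.
have hca e : cos_amp alpha e = A e by rewrite /cos_amp hinn /alpha /=; field.
have hsa e : sin_amp alpha e = B e.
  rewrite /sin_amp hinn /alpha /=.
  transitivity (- ('i%C * 'i%C) * B e); first by field.
  by rewrite ii opprK mul1r.
have fw : f = wave alpha.
  apply/funext => e; apply/funext => x; rewrite /wave hca hsa.
  case: ifP => [xl|/negbT xl]; first by have [] := sol e x xl.
  exact: fon.
exists alpha => //; apply/scattering_iff; split.
  exists phi => -[e s]; have [E0 E1 _ _] := wave_ends alpha e.
  have [F0 F1] := fv e; rewrite /btail /brev /=.
  by case: s => /=; rewrite -?E0 -?E1 -fw.
move=> v; rewrite sum_bonds /btail /brev /=.
have h := fk v.
have z0l (e : edge G) : 0 \in `[0, elen e] by rewrite in_itv/= lexx ltW// elen_gt0.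
have ell (e : edge G) : elen e \in `[0, elen e] by rewrite in_itv/= lexx ltW// elen_gt0.
have d0 e : f1 e 0 = k%:C%C * 'i%C * (alpha (e, true) - inn alpha (e, false)).
  by have [_ _ <- _] := wave_ends alpha e; rewrite hca hsa; have [] := sol e 0 (z0l e).
have d1 e : f1 e (elen e) = - (k%:C%C * 'i%C * (alpha (e, false) - inn alpha (e, true))).
  by have [_ _ _ <-] := wave_ends alpha e; rewrite hca hsa; have [] := sol e _ (ell e).
rewrite (eq_bigr _ (fun e _ => d1 e)) [X in _ - X](eq_bigr _ (fun e _ => d0 e)) in h.
move: h; rewrite sumrN -opprD -!mulr_sumr -mulrDr addrC => /eqP.
rewrite oppr_eq0 !mulf_eq0 (negbTE kC) /=.
have -> : ('i%C == 0 :> C) = false by rewrite eq_complex /= oner_eq0 andbF.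
by move/eqP.
Qed.

(** A wave vanishing at 0 and at a point where sin (k x) is not 0 has amplitudes
    zero. *)
Lemma wave_inj alpha : (forall e x, wave alpha e x = 0) -> forall c, alpha c = 0.
Proof.
move=> h.
have hA e : cos_amp alpha e = 0.
  by have [E0 _ _ _] := wave_ends alpha e; rewrite /cos_amp -E0; exact: h.
have hB e : sin_amp alpha e = 0.
  have l0 := elen_gt0 e.
  pose x := Num.min (elen e) k^-1.
  have x0 : 0 < x by rewrite lt_min l0 invr_gt0.
  have xl : x \in `[0, elen e] by rewrite in_itv/= ltW//= ge_min lexx.
  have := h e x; rewrite /wave xl /trigf hA mul0r add0r => /eqP.
  rewrite mulf_eq0 => /orP[/eqP//|/eqP[]] hs.
  have : 0 < sin (k * x).
    apply: sin_gt0_pi; rewrite mulr_gt0//=.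
    apply: (@le_lt_trans _ _ 1); last by apply: lt_le_trans (pi_ge2 R); rewrite ltr1n.
    by rewrite mulrC -ler_pdivlMr// mul1r ge_min lexx orbT.
  by rewrite hs ltxx.
have ii := sqr_ii.
have key e : alpha (e, true) = 0 /\ inn alpha (e, false) = 0.
  have h1 : alpha (e, true) + inn alpha (e, false) = 0 by exact: hA.
  have h2 : alpha (e, true) - inn alpha (e, false) = 0.
    have := hB e; rewrite /sin_amp => h3.
    apply/eqP; rewrite -oppr_eq0 -mulN1r -ii -mulrA h3 mulr0.
    by [].
  move/subr0_eq: h2 => h2; rewrite h2 in h1 *.
  have : 2 * inn alpha (e, false) = 0 by rewrite -h1; ring.
  by move/eqP; rewrite mulf_eq0 pnatr_eq0 /= => /eqP ->.
move=> [e []]; first by have [] := key e.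
have [_ /eqP] := key e.
by rewrite /inn mulf_eq0 /= (negbTE (cis_neq0 _)) orbF => /eqP.
Qed.

Lemma wave_sum (m : nat) (c : 'I_m -> C) (al : 'I_m -> bond -> C) e x :
  \sum_i c i * wave (al i) e x = wave (fun d => \sum_i c i * al i d) e x.
Proof.
rewrite /wave; case: ifP => _; last by rewrite big1// => i _; rewrite mulr0.
have innE d : inn (fun d => \sum_i c i * al i d) d = \sum_i c i * inn (al i) d.
  by rewrite /inn mulr_suml; apply: eq_bigr => i _; rewrite mulrA.
rewrite /trigf /cos_amp /sin_amp innE -big_split -sumrB /= mulr_sumr !mulr_suml -big_split /=.
by apply: eq_bigr => i _; ring.
Qed.

Definition amp (a : 'rV[C]_nb) : bond -> C := fun c => a 0 (enum_rank c).
Definition unamp (alpha : bond -> C) : 'rV[C]_nb := \row_i alpha (enum_val i).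

Lemma ampK a : unamp (amp a) = a.
Proof. by apply/rowP => i; rewrite !mxE /amp enum_valK. Qed.

Lemma unampK alpha : amp (unamp alpha) = alpha.
Proof. by apply/funext => c; rewrite /amp mxE enum_rankK. Qed.

Lemma wave_eq_evol a : a *m evol scat_mx bond_len k = a <-> wave_eq (amp a).
Proof.
have E j : (a *m evol scat_mx bond_len k) 0 j = \sum_c inn (amp a) c * scat c (enum_val j).
  rewrite mxE -sum_enum_val; apply: eq_bigr => i _.
  by rewrite evol_entry mxE /inn /amp enum_valK mulrA.
split=> [h d|h]; last first.
  by apply/rowP => j; rewrite E -h /amp enum_valK.
by rewrite /amp -{1}h E enum_rankK.
Qed.

Lemma wave_amp0 (a : 'rV[C]_nb) : (forall e x, wave (amp a) e x = 0) -> a = 0.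
Proof.
move=> h; have h0 := wave_inj h; apply/rowP => i; rewrite mxE.
by have := h0 (enum_val i); rewrite /amp enum_valK.
Qed.

(** The eigenspace of Delta_0 at k^2 is parametrized by the bond amplitudes
    fixed by the evolution at k. *)
Theorem multiplicity_mult1 :
  multiplicity G (k ^+ 2)%:C%C (mult1 scat_mx bond_len k).
Proof.
rewrite mult1_rank; last exact: scat_mx_unitary.
set U := evol _ _ _; set K := kermx _.
pose W := row_base K.
have WU i : row i W *m U = row i W.
  have : (row i W <= K)%MS by rewrite (submx_trans (row_sub _ _))// eq_row_base.
  by move/sub_kermxP; rewrite mulmxBr mulmx1 => /subr0_eq.
have sumE (c : 'I_(\rank K) -> C) :
    (fun d => \sum_i c i * amp (row i W) d) = amp ((\row_i c i) *m W).
  by apply/funext => d; rewrite /amp mxE; apply: eq_bigr => i _; rewrite !mxE.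
exists (fun i => wave (amp (row i W))); split.
- by move=> i; apply: wave_eigenfunction; apply/wave_eq_evol.
- move=> c hc.
  have h0 : (\row_i c i) *m W = 0.
    by apply: wave_amp0 => e x; rewrite -sumE -wave_sum.
  have /row_free_inj inj : row_free W by exact: row_base_free.
  have := inj _ (\row_i c i) 0; rewrite h0 mul0mx => /(_ erefl) /rowP h i.
  by have := h i; rewrite !mxE.
move=> f /eigenfunction_wave [alpha ha ->].
have hU : unamp alpha *m U = unamp alpha by apply/wave_eq_evol; rewrite unampK.
have : (unamp alpha <= W)%MS.
  rewrite eq_row_base; apply/sub_kermxP.
  by rewrite mulmxBr mulmx1 hU subrr.
move=> /submxP [D hD]; exists (fun i => D 0 i) => e x.
rewrite wave_sum sumE.
have -> : \row_i D 0 i = D by apply/rowP => i; rewrite mxE.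
by rewrite -hD unampK.
Qed.

End Scattering.

Section DimensionUnique.
Variables (R : realType) (G : qgraph R) (lam : R[i]).
Local Notation C := R[i].

Lemma multiplicity_le m n : multiplicity G lam m -> multiplicity G lam n -> (m <= n)%N.
Proof.
move=> [b [be bfree _]] [b' [b'e _ b'span]].
have [N hN] := choice (fun i => b'span _ (be i)).
pose A : 'M[C]_(m, n) := \matrix_(i, j) N i j.
rewrite leqNgt; apply/negP => nm.
have : (0 < \rank (kermx A))%N.
  by rewrite mxrank_ker subn_gt0 (leq_ltn_trans (rank_leq_col _)).
rewrite lt0n mxrank_eq0 => /rowV0Pn[v /sub_kermxP vA v0].
case/negP: v0; apply/eqP/rowP => i; rewrite mxE.
apply: (bfree (fun i => v 0 i)) => e x.
under eq_bigr => j _ do rewrite hN mulr_sumr.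
rewrite exchange_big /= big1// => j _.
under eq_bigr => l _ do rewrite mulrA.
rewrite -mulr_suml; have /rowP/(_ j) := vA; rewrite !mxE => h.
suff -> : \sum_(l < m) v 0 l * N l j = 0 by rewrite mul0r.
by rewrite -[RHS]h; apply: eq_bigr => l _; rewrite mxE.
Qed.

Lemma multiplicity_unique m n : multiplicity G lam m -> multiplicity G lam n -> m = n.
Proof. by move=> hm hn; apply/eqP; rewrite eqn_leq !multiplicity_le. Qed.

End DimensionUnique.

Lemma isospectral_mult1 (R : realType) (G H : qgraph R) :
  (forall v : vertex G, degree v != 0%N) -> (forall v : vertex H, degree v != 0%N) ->
  isospectral G H -> forall k : R, 0 < k ->
  mult1 (scat_mx G) (@bond_len R G) k = mult1 (scat_mx H) (@bond_len R H) k.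
Proof.
move=> dG dH iso k k0; apply: multiplicity_unique (multiplicity_mult1 dH k0).
by apply/iso; exact: multiplicity_mult1.
Qed.

(** * The cyclomatic number is determined by the spectrum *)

Section Cyclomatic.
Variables (R : realType) (G : qgraph R).
Local Notation C := R[i].
Local Notation bond := (bond G).
Hypothesis G_connected : graph_connected G.
Hypothesis deg_neq0 : forall v : vertex G, degree v != 0%N.

Lemma connected_const (T : eqType) (phi : vertex G -> T) :
  (forall e : edge G, phi (src e) = phi (tgt e)) -> forall v w, phi v = phi w.
Proof.
move=> h v w; have [_ /(_ v w) /connectP[p]] := G_connected.
elim: p v => [|x p IH] v /=; first by move=> _ ->.
move=> /andP[/existsP[e he] hp] hw; rewrite -(IH x hp hw).
by case/orP: he => /andP[/eqP <- /eqP <-].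
Qed.

Local Notation nV := #|vertex G|.
Local Notation nE := #|edge G|.

Definition incidence : 'M[C]_(nE, nV) := \matrix_(e, v)
  ((tgt (enum_val e : edge G) == enum_val v)%:R - (src (enum_val e : edge G) == enum_val v)%:R).

Lemma sum_delta_enum (T : finType) (x : T) (F : 'I_#|T| -> C) :
  \sum_i F i * (x == enum_val i)%:R = F (enum_rank x).
Proof.
rewrite (bigD1 (enum_rank x)) //= enum_rankK eqxx mulr1 big1 ?addr0// => i hi.
case: eqP => [E|]; last by rewrite mulr0.
by rewrite E enum_valK eqxx in hi.
Qed.

(** The potentials killed by the coboundary of a connected graph are constant. *)
Lemma rank_incidence : (\rank incidence).+1 = nV.
Proof.
have [V0 _] := G_connected.
have : \rank (kermx incidence^T) = 1%N.
  have E : (kermx incidence^T :=: (const_mx 1 : 'rV[C]_nV))%MS.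
    apply/eqmxP/andP; split.
      apply/row_subP => i; set x := row i _.
      have hx : x *m incidence^T = 0 by apply/sub_kermxP; exact: row_sub.
      have hxe (e : edge G) : x 0 (enum_rank (src e)) = x 0 (enum_rank (tgt e)).
        have /rowP/(_ (enum_rank e)) := hx; rewrite !mxE.
        under eq_bigr => v _ do rewrite !mxE enum_rankK mulrBr.
        by rewrite sumrB !sum_delta_enum => /subr0_eq ->.
      have hc := connected_const (phi := fun v => x 0 (enum_rank v)) hxe.
      pose v0 := enum_val (Ordinal V0).
      have -> : x = x 0 (enum_rank v0) *: (const_mx 1 : 'rV[C]_nV).
        apply/rowP => j; rewrite [RHS](_ : _ = x 0 (enum_rank v0)).
          by rewrite -(hc (enum_val j)) enum_valK.
        by rewrite !mxE mulr1.
      by rewrite scalemx_sub.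
    apply/sub_kermxP/rowP => e; rewrite !mxE.
    under eq_bigr => v _ do rewrite !mxE mulrBr.
    by rewrite sumrB !(sum_delta_enum _ (fun=> 1)) subrr.
  rewrite E rank_rV; case: eqP => // /rowP/(_ (Ordinal V0))/eqP.
  by rewrite !mxE oner_eq0.
rewrite mxrank_ker mxrank_tr => h.
by move: h; have := rank_leq_col incidence; case: (_ - _)%N (subnK (rank_leq_col incidence)) => [|[|m]] //= <-.
Qed.

(** The amplitude vector of a constant and a flow, see [fixed_at_0]. *)
Definition pot_flow : 'M[C]_(1 + nE, nb G) :=
  col_mx (const_mx 1) (\matrix_(e, j) if (enum_val j : bond).1 == enum_val e
    then (if (enum_val j : bond).2 then 1 else -1) else 0).

Lemma pot_flowE (x : 'rV[C]_(1 + nE)) (c : bond) : amp (x *m pot_flow) c =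
  x 0 (lshift _ 0) + (if c.2 then 1 else -1) * x 0 (rshift _ (enum_rank c.1)).
Proof.
rewrite /amp mxE big_split_ord /= big_ord1 col_mxEu mxE mulr1; congr (_ + _).
under eq_bigr => e _ do rewrite col_mxEd mxE enum_rankK.
rewrite (bigD1 (enum_rank c.1)) //= enum_rankK eqxx mulrC big1 ?addr0// => e he.
case: eqP => [E|]; last by rewrite mulr0.
by rewrite E enum_valK eqxx in he.
Qed.

Lemma flow_incidence (w : 'rV[C]_nE) : w *m incidence = 0 <->
  forall v : vertex G, \sum_(e | src e == v) w 0 (enum_rank e) =
     \sum_(e | tgt e == v) w 0 (enum_rank e).
Proof.
have E v : (w *m incidence) 0 (enum_rank v) =
   \sum_(e | tgt e == v) w 0 (enum_rank e) - \sum_(e | src e == v) w 0 (enum_rank e).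
  rewrite mxE [X in _ = X - _]big_mkcond [X in _ = _ - X]big_mkcond -sumrB.
  rewrite [RHS](reindex (@enum_val _ (edge G)))/=; last first.
    by exists enum_rank => x _; rewrite ?enum_valK ?enum_rankK.
  apply: eq_bigr => e _; rewrite mxE enum_rankK enum_valK mulrBr.
  by case: eqP; case: eqP; rewrite ?mulr1 ?mulr0.
split=> [h v|h].
  by apply/esym/subr0_eq; rewrite -E h mxE.
apply/rowP => j; rewrite -[j]enum_valK E h mxE subrr.
by [].
Qed.

(** At k = 0 the two amplitudes of an edge have the same sum for all edges, by
    continuity and connectedness, and half their difference is a flow, by the
    Kirchhoff condition. *)
Lemma fixed_at_0 (a : 'rV[C]_(nb G)) : a *m scat_mx G = a <->
  exists2 x : 'rV[C]_(1 + nE), rsubmx x *m incidence = 0 & a = x *m pot_flow.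
Proof.
have inn0 c : inn 0 (amp a) c = amp a c by rewrite /inn mul0r cis0 mulr1.
have E0 : a *m scat_mx G = a <-> forall d, amp a d = \sum_c amp a c * scat c d.
  have -> : scat_mx G = evol (scat_mx G) (@bond_len R G) 0.
    by rewrite /evol phase0 mul1mx.
  rewrite wave_eq_evol /wave_eq; split=> h d; rewrite h; apply: eq_bigr => c _;
  by rewrite inn0.
rewrite E0 (scattering_iff deg_neq0); split.
  move=> [[phi hphi] hcur].
  have hc (e : edge G) : phi (src e) = phi (tgt e).
    have := hphi (e, true); have := hphi (e, false); rewrite /btail /brev /= => <- <-.
    by rewrite addrC.
  have [V0 _] := G_connected; pose v0 := enum_val (Ordinal V0).
  have hv v : phi v = phi v0 by exact: connected_const.
  pose w : 'rV[C]_nE := \row_e ((amp a (enum_val e, true) - amp a (enum_val e, false)) / 2).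
  exists (row_mx (const_mx (phi v0 / 2)) w).
    rewrite row_mxKr; apply/flow_incidence => v; have := hcur v.
    rewrite sum_bonds /btail /brev /= => h.
    under eq_bigr => e _ do rewrite mxE enum_rankK.
    under [RHS]eq_bigr => e _ do rewrite mxE enum_rankK.
    rewrite -!mulr_suml; congr (_ / _).
    apply/eqP; rewrite -subr_eq0 -sumrN; apply/eqP; rewrite -[RHS]h; congr (_ + _).
    by apply: eq_bigr => e _; rewrite opprB.
  rewrite -[LHS]ampK -[RHS]ampK; congr unamp; apply/funext => -[e s].
  rewrite pot_flowE row_mxEl row_mxEr !mxE enum_rankK /=.
  have := hphi (e, true); rewrite /btail /brev /= hv => <-.
  by case: s; field.
move=> [x hx ->].
move: hx => /flow_incidence hx; split.
  exists (fun=> 2 * x 0 (lshift _ 0)) => d; rewrite !pot_flowE /=.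
  by case: d => e [] /=; ring.
move=> v; rewrite sum_bonds /btail /brev /=.
have h := hx v.
have E1 e : amp (x *m pot_flow) (e, true) - amp (x *m pot_flow) (e, false) =
   2 * (rsubmx x) 0 (enum_rank e) by rewrite !pot_flowE /= mxE; ring.
have E2 e : amp (x *m pot_flow) (e, false) - amp (x *m pot_flow) (e, true) =
   - (2 * (rsubmx x) 0 (enum_rank e)) by rewrite !pot_flowE /= mxE; ring.
rewrite (eq_bigr _ (fun e _ => E1 e)) [X in _ + X](eq_bigr _ (fun e _ => E2 e)).
by rewrite sumrN -!mulr_sumr h subrr.
Qed.

(** One dimension for the constant and |E| - |V| + 1 for the flows. *)
Lemma mult1_0 : (mult1 (scat_mx G) (@bond_len R G) 0 + #|vertex G| = #|edge G| + 2)%N.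
Proof.
rewrite (mult1_rank _ (scat_mx_unitary deg_neq0)).
have -> : evol (scat_mx G) (@bond_len R G) 0 = scat_mx G by rewrite /evol phase0 mul1mx.
pose Z := kermx incidence.
pose X : 'M[C]_(1 + nE, 1 + nE) := block_mx 1%:M 0 0 Z.
have -> : \rank (kermx (scat_mx G - 1%:M)) = \rank (X *m pot_flow).
  apply/eqmx_rank/andP; split; apply/row_subP => i.
    set a := row i _.
    have : a *m scat_mx G = a.
      apply/eqP; rewrite -subr_eq0; apply/eqP.
      rewrite -[X in _ - X = _]mulmx1 -mulmxBr; apply/sub_kermxP; exact: row_sub.
    move=> /fixed_at_0[x hx ->]; apply: submxMr.
    have /submxP[D hD] : (rsubmx x <= Z)%MS by apply/sub_kermxP.
    apply/submxP; exists (row_mx (lsubmx x) D).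
    by rewrite /X mul_row_block mulmx1 !mulmx0 addr0 add0r -hD hsubmxK.
  rewrite row_mul; set x := row i X.
  apply/sub_kermxP; rewrite mulmxBr mulmx1.
  suff -> : x *m pot_flow *m scat_mx G = x *m pot_flow by rewrite subrr.
  apply/fixed_at_0; exists x => //.
  have -> : rsubmx x = row i (col_mx 0 Z).
    by rewrite /x /X block_mxEh row_row_mx row_mxKr.
  rewrite -row_mul mul_col_mx mul0mx mulmx_ker.
  by rewrite col_mx0 row0.
have hfree : row_free pot_flow.
  rewrite -kermx_eq0 -submx0; apply/rV_subP => x /sub_kermxP hx.
  have h c : x 0 (lshift _ 0) + (if c.2 then 1 else -1) * x 0 (rshift _ (enum_rank c.1)) = 0.
    by rewrite -pot_flowE hx /amp mxE.
  have he e : x 0 (lshift _ 0) = 0 /\ x 0 (rshift _ (enum_rank e)) = 0.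
    have := h (e, true); have := h (e, false); rewrite /= mulN1r mul1r.
    move: (x 0 _) (x 0 _) => y z /subr0_eq -> /eqP.
    by rewrite -mulr2n mulrn_eq0 /= => /eqP ->.
  rewrite submx0; apply/eqP/rowP => j; rewrite mxE.
  case: (split_ordP j) => i ->; last by have [_] := he (enum_val i); rewrite enum_valK.
  have [V0 _] := G_connected.
  have : (0 < #|[pred c : bond | btail c == enum_val (Ordinal V0)]|)%N.
    by rewrite card_out lt0n.
  by case/card_gt0P => c _; rewrite ord1; have [] := he c.1.
rewrite mxrankMfree// rank_diag_block_mx mxrank1 mxrank_ker.
have := rank_incidence; have := rank_leq_row incidence; lia.
Qed.

End Cyclomatic.

(** * Shortest closed walks that leave a set of edges *)

Section BondWalks.
Variables (R : realType) (G : qgraph R).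
Local Notation C := R[i].
Local Notation bond := (bond G).
Implicit Types (c d : bond) (s r : seq bond).
Hypothesis deg_ge3 : forall v : vertex G, (3 <= degree v)%N.

Definition conn c d : bool := bhead c == btail d.
Definition blen s : R := \sum_(c <- s) elen c.1.

Fixpoint bpath_weight c s : C :=
  if s is d :: s' then scat c d * bpath_weight d s' else 1.
Definition bcycle_weight s : C :=
  if s is x :: s' then bpath_weight (last x s') s else 1.

Lemma cycle_weight_bonds (t : seq 'I_(nb G)) :
  cycle_weight (scat_mx G) t = bcycle_weight (map enum_val t).
Proof.
have E i (s : seq 'I_(nb G)) : path_weight (scat_mx G) i s = bpath_weight (enum_val i) (map enum_val s).
  by elim: s i => //= x s IH i; rewrite IH mxE.
by case: t => //= x t; rewrite last_map E mxE.
Qed.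

Lemma walk_len_bonds (t : seq 'I_(nb G)) :
  walk_len (@bond_len R G) t = blen (map enum_val t).
Proof. by rewrite /walk_len /blen big_map. Qed.

Lemma scat_disconnected c d : ~~ conn c d -> scat c d = 0.
Proof.
rewrite /conn /scat => /negbTE h; rewrite h sub0r.
case: eqP => [E|]; last by rewrite oppr0.
by rewrite E btail_rev eqxx in h.
Qed.

(** Since degrees are at least 3, 2 / deg - 1 < 0 < 2 / deg: amplitudes are
    positive except for turning back. *)
Lemma scat_forward c d : conn c d -> d != brev c -> 0 < scat c d.
Proof.
rewrite /conn /scat => -> /negbTE ->; rewrite subr0 divr_gt0//.
by rewrite ltr0n (leq_trans _ (deg_ge3 _)).
Qed.

Lemma scat_back c : scat c (brev c) < 0.
Proof.
rewrite /scat btail_rev !eqxx subr_lt0 ltr_pdivrMr ?mul1r ?ltr_nat//.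
by rewrite ltr0n (leq_trans _ (deg_ge3 _)).
Qed.

Lemma bpath_weight_rcons c s x :
  bpath_weight c (rcons s x) = bpath_weight c s * scat (last c s) x.
Proof.
elim: s c => [|y s IH] c /=; first by rewrite mulr1 mul1r.
by rewrite IH mulrA.
Qed.

Lemma bcycle_rot n s : bcycle_weight (rot n s) = bcycle_weight s.
Proof.
have one t : bcycle_weight (rot 1 t) = bcycle_weight t.
  case: t => // x [|y t] //; rewrite rot1_cons /= last_rcons bpath_weight_rcons.
  by ring.
elim: n => [|n IH] in s *; first by rewrite rot0.
have [h|h] := ltnP n (size s); last by rewrite rot_oversize// ltnW.
by rewrite -addn1 rotD ?addn1// IH one.
Qed.

Lemma bcycle_open s : ~~ cycle conn s -> bcycle_weight s = 0.
Proof.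
case: s => // x s /=; rewrite rcons_path.
have E c t : ~~ path conn c t -> bpath_weight c t = 0.
  elim: t c => //= y t IH c; rewrite negb_and => /orP[h|/IH ->].
    by rewrite scat_disconnected// mul0r.
  by rewrite mulr0.
rewrite negb_and => /orP[h|h]; last by rewrite scat_disconnected// mul0r.
by rewrite E// mulr0.
Qed.

Definition forward c d : bool := conn c d && (d != brev c).

Lemma bcycle_forward s : cycle forward s -> 0 < bcycle_weight s.
Proof.
case: s => // x s /=; rewrite rcons_path => /andP[hp /andP[h1 h2]].
have E c t : path forward c t -> 0 < bpath_weight c t.
  elim: t c => //= y t IH c /andP[/andP[a b] hp'].
  by rewrite mulr_gt0 ?scat_forward ?IH.
by rewrite mulr_gt0 ?scat_forward ?E.
Qed.

Lemma path_break (T : Type) (e : rel T) (x : T) p : ~~ path e x p ->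
  exists p1 y z p2, x :: p = p1 ++ y :: z :: p2 /\ ~~ e y z.
Proof.
elim: p x => //= z p IH x; rewrite negb_and => /orP[h|/IH].
  by exists [::], x, z, p.
move=> [p1 [y [z' [p2 [E h]]]]]; exists (x :: p1), y, z', p2; split=> //=.
by rewrite E.
Qed.

(** Rotate the place where the walk turns back to the front. *)
Lemma backtrack s : s != [::] -> cycle conn s -> ~~ cycle forward s ->
  exists n c r, rot n s = c :: brev c :: r.
Proof.
case: s => // x q _ /= hc hb.
have [p1 [y [z [p2 [E hyz]]]]] := path_break hb.
have hz : conn y z -> z = brev y.
  by move=> h; move: hyz; rewrite /forward h /= negbK => /eqP.
have hconn : conn y z.
  have h0 : sorted conn (x :: rcons q x) by [].
  move: h0; rewrite E; case: p1 {E} => [|x1 p1] /=; first by case/andP.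
  by rewrite cat_path => /andP[_] /= /and3P[].
rewrite (hz hconn) in E; move: E.
case: (lastP p2) => [|p2' x'] E.
  move: E; rewrite -[x :: rcons q x]/(rcons (x :: q) x).
  rewrite -[p1 ++ _]/(p1 ++ ([:: y] ++ [:: brev y])) catA !cats1.
  move=> /rcons_inj; case=> E1 E2.
  case: p1 E1 => [|x1 p1] /=; case=> Ex Eq.
    by have := brev_neq y; rewrite -E2 Ex eqxx.
  exists (size (x1 :: p1)), y, p1.
  have -> : x :: q = (x1 :: p1) ++ [:: y] by rewrite Eq Ex cats1.
  by rewrite rot_size_cat /= -Ex E2.
move: E; rewrite -[x :: rcons q x]/(rcons (x :: q) x) -!rcons_cons -rcons_cat.
move=> /rcons_inj; case=> -> _; exists (size p1), y, (p2' ++ p1).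
by rewrite rot_size_cat.
Qed.

Lemma blen_rot n s : blen (rot n s) = blen s.
Proof. by apply: perm_big; rewrite perm_rot. Qed.

Lemma blen_gt0 s : s != [::] -> 0 < blen s.
Proof.
case: s => // x s _; rewrite /blen big_cons ltr_pwDl ?elen_gt0//.
by apply: sumr_ge0 => c _; rewrite ltW// elen_gt0.
Qed.

Lemma bounce_closed c : cycle conn [:: c; brev c].
Proof. by rewrite /= /conn btail_rev bhead_rev !eqxx. Qed.

Definition leaves (K : {set edge G}) : pred (seq bond) :=
  fun s => [&& s != [::], cycle conn s & has (fun c => c.1 \notin K) s].

Lemma leaves_rot K n s : leaves K (rot n s) = leaves K s.
Proof.
rewrite /leaves rot_cycle has_rot; congr (_ && _).
by rewrite -!size_eq0 size_rot.
Qed.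

(** A shortest closed walk leaving K can only turn back by bouncing on a
    single edge outside K: cutting out any other backtracking would give
    a shorter one. Hence its amplitude is positive. *)
Lemma shortest_weight_gt0 (K : {set edge G}) (nu : R) :
  (forall s, leaves K s -> nu <= blen s) ->
  forall s, leaves K s -> blen s = nu -> 0 < bcycle_weight s.
Proof.
move=> hmin s hs snu.
have [hf|hb] := boolP (cycle forward s); first exact: bcycle_forward.
have /and3P[s0 sc _] := hs.
have [n [c [r E]]] := backtrack s0 sc hb.
rewrite -(bcycle_rot n); move: hs snu; rewrite -(leaves_rot K n) -(blen_rot n) E.
move=> /and3P[_ hc hK] hlen.
case: r => [|d r] in hc hK hlen E *.
  have := scat_back (brev c); rewrite brevK => hb'.
  by rewrite /= mulr1 nmulr_rgt0 ?scat_back.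
exfalso; have hlen2 : blen [:: c, brev c, d & r] = blen [:: c; brev c] + blen (d :: r).
  by rewrite /blen -big_cat.
have hr : cycle conn (d :: r).
  move: hc; rewrite /= !rcons_path /= => /and3P[_ h1 /andP[h2 h3]].
  rewrite h2 /=; move: h1 h3; rewrite /conn bhead_rev => /eqP <- /eqP ->.
  by rewrite eqxx.
have [cK|cK] := boolP (c.1 \in K).
  have : leaves K (d :: r).
    by rewrite /leaves hr /=; move: hK; rewrite /= cK.
  move=> /hmin; rewrite -hlen hlen2 gerDr leNgt blen_gt0//.
have : leaves K [:: c; brev c] by rewrite /leaves bounce_closed /= cK.
move=> /hmin; rewrite -hlen hlen2 gerDl leNgt blen_gt0//.
Qed.

Lemma blen_ge_size s : (forall e : edge G, 1 <= elen e) -> (size s)%:R <= blen s.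
Proof.
move=> h; rewrite /blen; elim: s => [|x s IH]; first by rewrite big_nil.
by rewrite big_cons /= -natr1 addrC lerD.
Qed.

(** Edges have length at least 1, so only finitely many walks are shorter than
    the bounce on e. *)
Lemma shortest_leaving (K : {set edge G}) (e : edge G) :
  (forall e : edge G, 1 <= elen e) -> e \notin K ->
  exists2 s, leaves K s & forall s', leaves K s' -> blen s <= blen s'.
Proof.
move=> h1 eK; pose s0 : seq bond := [:: (e, true); brev (e, true)].
have s0K : leaves K s0 by rewrite /leaves bounce_closed /= eK.
pose N := (Num.truncn (blen s0)).+1.
pose T := {m : 'I_N.+2 & m.-tuple bond}.
have s0N : (size s0 < N.+2)%N by [].
pose i0 : T := Tagged (fun m : 'I_N.+2 => m.-tuple bond) (in_tuple s0 : (Ordinal s0N).-tuple bond).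
pose P (t : T) := leaves K (tagged t).
pose F (t : T) := blen (tagged t).
have [t tP tmin] := @arg_minP _ R T i0 P F s0K.
exists (tagged t) => // s' hs'.
have [hlt|hge] := ltnP (size s') N.+2.
  exact: (tmin (Tagged (fun m : 'I_N.+2 => m.-tuple bond)
    (in_tuple s' : (Ordinal hlt).-tuple bond))).
apply: (@le_trans _ _ (blen s0)); first exact: (tmin i0 s0K).
apply: le_trans (blen_ge_size s' h1).
apply: (@le_trans _ _ N%:R); first exact/ltW/truncnS_gt.
by rewrite ler_nat (leq_trans _ hge)// ltnW.
Qed.

Lemma blen_count (P : pred bond) s : (forall e : edge G, 1 <= elen e) ->
  blen [seq c <- s | P c] <= blen s.
Proof.
move=> h1; rewrite /blen big_filter big_mkcond; apply: ler_sum => c _.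
by case: ifP => _ //; rewrite ltW// elen_gt0.
Qed.

(** The data that determine the length of f once those of the edges in K are
    known: nu is the minimum of 2 l(f) and of the lengths of the closed walks
    that pass through f once and otherwise stay in K. *)
Definition next_edge (K : {set edge G}) (f : edge G) (nu : R) : Prop :=
  [/\ f \notin K, nu <= 2 * elen f,
    forall c r, c.1 = f -> all (fun c' => c'.1 \in K) r -> cycle conn (c :: r) ->
      nu <= blen (c :: r)
  & nu = 2 * elen f \/ exists c r, [/\ c.1 = f, all (fun c' => c'.1 \in K) r,
      cycle conn (c :: r) & blen (c :: r) = nu]].

(** A shortest closed walk leaving K either passes through exactly one edge
    outside K, once, or is as long as a bounce on the shortest of its edges
    outside K. *)
Lemma next_edge_exists (K : {set edge G}) (s : seq bond) :
  (forall e : edge G, 1 <= elen e) ->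
  leaves K s -> (forall s', leaves K s' -> blen s <= blen s') ->
  exists f, next_edge K f (blen s).
Proof.
move=> h1 hs hmin.
have bounce c : c.1 \notin K -> blen s <= 2 * elen c.1.
  move=> cK; have -> : 2 * elen c.1 = blen [:: c; brev c].
    by rewrite /blen !big_cons big_nil /=; ring.
  by apply: hmin; rewrite /leaves bounce_closed /= cK.
have walk (c : bond) r : c.1 \notin K -> cycle conn (c :: r) -> blen s <= blen (c :: r).
  by move=> cK hc; apply: hmin; rewrite /leaves hc /= cK.
pose us := [seq c <- s | c.1 \notin K].
have usK c : c \in us -> c.1 \notin K by rewrite mem_filter => /andP[].
have /and3P[_ sc] := hs; rewrite has_count -size_filter -/us.
have lus := blen_count (fun c => c.1 \notin K) s h1; rewrite -/us in lus.
case Eus: us => [|c [|c' us']] // _.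
  have cs : c \in s.
    have : c \in us by rewrite Eus mem_head.
    by rewrite mem_filter => /andP[].
  have cK : c.1 \notin K by apply: usK; rewrite Eus mem_head.
  have [n r Er] := rot_to cs.
  have hc : cycle conn (c :: r) by rewrite -Er rot_cycle.
  exists c.1; split=> //; first exact: bounce.
    by move=> d r' dc _; apply: walk; rewrite dc.
  right; exists c, r; split=> //; last by rewrite -Er blen_rot.
  have : perm_eq [seq c <- c :: r | c.1 \notin K] us.
    by rewrite /us -Er; apply: perm_filter; rewrite perm_rot.
  rewrite Eus /= cK => /perm_size /= [/eqP]; rewrite size_filter -leqn0 leqNgt -has_count.
  by rewrite has_predC negbK.
have c1K : c.1 \notin K by apply: usK; rewrite Eus mem_head.
have c2K : c'.1 \notin K by apply: usK; rewrite Eus !inE eqxx orbT.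
have hlen : elen c.1 + elen c'.1 <= blen s.
  apply: le_trans lus; rewrite Eus /blen !big_cons addrA lerDl.
  by apply: sumr_ge0 => x _; rewrite ltW// elen_gt0.
have bounce_on (d : bond) : d.1 \notin K -> 2 * elen d.1 <= blen s -> exists f, next_edge K f (blen s).
  move=> dK hd; exists d.1; split=> //; first exact: bounce.
    by move=> x r' xd _; apply: walk; rewrite xd.
  by left; apply/eqP; rewrite eq_le hd bounce.
have [hcc|hcc] := leP (elen c.1) (elen c'.1).
  by apply: (bounce_on c) => //; lra.
by apply: (bounce_on c') => //; lra.
Qed.

End BondWalks.

(** * Lengths of the next edge from a word in known lengths *)

Definition word_len (R : realType) (G : qgraph R) (w : seq (edge G)) : R :=
  \sum_(e <- w) elen e.

Lemma sum_bond_len (R : realType) (G : qgraph R) :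
  \sum_i @bond_len R G i = 2 * total_length G.
Proof.
rewrite /bond_len -(big_enum_val (fun c : bond G => elen c.1)).
by rewrite (sum_bonds (fun c : bond G => elen c.1) predT) /= /total_length; ring.
Qed.

Lemma elen_le_total (R : realType) (G : qgraph R) (e : edge G) :
  elen e <= total_length G.
Proof.
rewrite /total_length (bigD1 e)//= lerDl sumr_ge0// => i _.
by rewrite ltW// elen_gt0.
Qed.

Section Isospectral.
Variables (R : realType) (G H : qgraph R).
Hypothesis degG : forall v : vertex G, (3 <= degree v)%N.
Hypothesis degH : forall v : vertex H, (3 <= degree v)%N.
Hypothesis elenG : forall e : edge G, 1 <= elen e.
Hypothesis elenH : forall e : edge H, 1 <= elen e.
Hypothesis same_total : total_length G = total_length H.
Hypothesis same_spec : isospectral G H.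

Let degG0 (v : vertex G) : degree v != 0%N.
Proof. by rewrite -lt0n (leq_trans _ (degG v)). Qed.

Let degH0 (v : vertex H) : degree v != 0%N.
Proof. by rewrite -lt0n (leq_trans _ (degH v)). Qed.

Let b := 1 + total_length G.

Let b_ge1 : 1 <= b.
Proof. by rewrite lerDl sumr_ge0// => i _; rewrite ltW// elen_gt0. Qed.

Let lenG_le j : @bond_len R G j <= b.
Proof. by apply: (le_trans (elen_le_total _)); rewrite lerDr ler01. Qed.

Let lenH_le j : @bond_len R H j <= b.
Proof. by rewrite /b same_total (le_trans (elen_le_total _))// lerDr ler01. Qed.

Let same_bond_total : \sum_i @bond_len R G i = \sum_i @bond_len R H i.
Proof. by rewrite !sum_bond_len same_total. Qed.

(** The multiplicity of the eigenvalue 1 at k = 0 is |E| - |V| + 2 but is not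
    the multiplicity of the eigenvalue 0 of the Laplacian; it is recovered from
    the positive spectrum. *)
Lemma isospectral_card (cG : graph_connected G) (cH : graph_connected H) :
  (#|edge G| + #|vertex H| = #|edge H| + #|vertex G|)%N.
Proof.
have e : mult1 (scat_mx G) (@bond_len R G) 0 = mult1 (scat_mx H) (@bond_len R H) 0.
  apply: (mult1_at_0 (scat_mx_unitary degG0) (scat_mx_unitary degH0) ltr01 b_ge1
    (fun j => elenG _) lenG_le (fun j => elenH _) lenH_le same_bond_total
    (isospectral_mult1 degG0 degH0 same_spec));
  by move=> i j; rewrite mxE scat_real.
have := mult1_0 cG degG0; have := mult1_0 cH degH0; rewrite e; clear.
by move: (mult1 _ _ _) => m; lia.
Qed.

(** Either the shortest closed walks leaving K compete with a closed walk inside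
    K, or their amplitudes all add up with the same sign and the reference graph
    must have a closed walk of that length. *)
Lemma next_edge_word (K : {set edge H}) (e : edge H) : e \notin K ->
  exists f nu, next_edge K f nu /\
    ((exists w : seq (edge H), [/\ w != [::], all (mem K) w & word_len w = nu]) \/
     (exists w : seq (edge G), w != [::] /\ word_len w = nu)).
Proof.
move=> eK; have [s hs smin] := shortest_leaving elenH eK.
have [f hf] := next_edge_exists elenH hs smin.
exists f, (blen s); split=> //.
have edges (Q : qgraph R) (t : seq (bond Q)) : word_len [seq c.1 | c <- t] = blen t.
  by rewrite /word_len big_map.
have [inK|outK] := pselect (exists t : seq (bond H),
    [/\ t != [::], cycle (@conn R H) t, all (fun c => c.1 \in K) t & blen t = blen s]).
  left; case: inK => t [t0 _ tK tl]; exists [seq c.1 | c <- t].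
  by split; rewrite ?edges// ?all_map//; case: (t) t0.
right; pose t0 := [seq enum_rank c | c <- s] : seq 'I_(nb H).
have t0E : map enum_val t0 = s by apply: mapK => c; rewrite enum_rankK.
have /and3P[s0 _ _] := hs.
have pos : 0 < cycle_weight (scat_mx H) t0.
  by rewrite cycle_weight_bonds t0E; apply: (shortest_weight_gt0 degH smin).
have [|||t tn [tl _]] := closed_walk_transfer (scat_mx_unitary degG0)
  (scat_mx_unitary degH0) ltr01 b_ge1 (fun j => elenG _) lenG_le (fun j => elenH _)
  lenH_le same_bond_total (isospectral_mult1 degG0 degH0 same_spec)
  (nu := blen s) (t0 := t0) _ _ pos.
- by rewrite /t0; case: (s) s0.
- by rewrite walk_len_bonds t0E.
- move=> t tn tl; rewrite cycle_weight_bonds; rewrite walk_len_bonds in tl.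
  have [hc|hc] := boolP (cycle (@conn R H) (map enum_val t)); last by rewrite bcycle_open.
  apply/ltW/(shortest_weight_gt0 degH smin) => //.
  rewrite /leaves hc; case: (t) tn tl hc => // c t' _ tl hc; apply/negPn/negP => h.
  apply: outK; exists (map enum_val (c :: t')); split=> //.
  apply/allP => x hx; apply/negPn/negP => xK.
  by move/negP: h; apply; apply/hasP; exists x.
exists [seq c.1 | c <- map enum_val t]; split; last by rewrite edges -walk_len_bonds.
by case: (t) tn.
Qed.

End Isospectral.

(** * Rebuilding a graph from its certificate *)

(** A certificate lists the edges in the order in which their lengths are
    found; a letter (b, i) of a word stands for the i-th edge of that list
    if b holds, and otherwise for the i-th edge of the reference graph. *)
Section Certificate.
Variables (R : realType) (G H : qgraph R).

Definition letter_len (fs : seq (edge H)) (b : bool) (i : nat) : R :=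
  nth 0 (if b then map elen fs else map elen (enum (edge G))) i.

Definition certificate (fs : seq (edge H)) (ws : seq (bool * seq nat)) : Prop :=
  [/\ uniq fs, forall e, e \in fs, size ws = size fs
    & forall f0 j, (j < size fs)%N ->
      let w := nth (true, [::]) ws j in
      [/\ next_edge [set e in take j fs] (nth f0 fs j)
            (\sum_(i <- w.2) letter_len fs w.1 i),
          w.2 != [::]
        & all (fun i => i < (if w.1 then j else #|edge G|))%N w.2]].

Hypothesis next : forall (K : {set edge H}) (e : edge H), e \notin K ->
  exists f nu, next_edge K f nu /\
    ((exists w : seq (edge H), [/\ w != [::], all (mem K) w & word_len w = nu]) \/
     (exists w : seq (edge G), w != [::] /\ word_len w = nu)).

Lemma letter_len_prefix fs gs i : (i < size fs)%N ->
  letter_len (fs ++ gs) true i = letter_len fs true i.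
Proof. by move=> h; rewrite /letter_len map_cat nth_cat size_map h. Qed.

(** Edges are added one at a time; words found earlier keep their meaning because
    the list grows at its end. *)
Lemma certificate_exists : exists fs ws, certificate fs ws.
Proof.
suff build n : (n <= #|edge H|)%N -> exists fs ws, [/\ uniq fs, size fs = n,
    size ws = size fs & forall f0 j, (j < size fs)%N ->
      let w := nth (true, [::]) ws j in
      [/\ next_edge [set e in take j fs] (nth f0 fs j)
            (\sum_(i <- w.2) letter_len fs w.1 i),
          w.2 != [::]
        & all (fun i => i < (if w.1 then j else #|edge G|))%N w.2]].
  have [fs [ws [u sz szw h]]] := build _ (leqnn _); exists fs, ws; split=> // e.
  have /subset_cardP h' : #|fs| = #|edge H| by rewrite (card_uniqP u).
  by rewrite (h' (subset_predT _)).
elim: n => [_|n IH lt_n]; first by exists [::], [::]; split.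
have [fs [ws [u sz szw h]]] := IH (ltnW lt_n).
have [e eK] : exists e, e \notin [set e in fs]%SET.
  apply/existsP; rewrite -negb_forall; apply/negP => /forallP hall.
  have : (#|edge H| <= size fs)%N.
    rewrite cardE; apply: uniq_leq_size (enum_uniq _) _ => x _.
    by have := hall x; rewrite inE.
  by rewrite sz leqNgt lt_n.
have [f [nu [hf hw]]] := next eK.
have fK : f \notin fs by case: hf; rewrite inE.
have [w [wnu wn wall]] : exists w : bool * seq nat,
    [/\ \sum_(i <- w.2) letter_len fs w.1 i = nu, w.2 != [::]
      & all (fun i => i < (if w.1 then n else #|edge G|))%N w.2].
  case: hw => [[w [wn wK wl]]|[w [wn wl]]].
    exists (true, [seq index x fs | x <- w]); split=> /=.
    - rewrite -wl /word_len big_map big_seq [RHS]big_seq; apply: eq_bigr => x xw.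
      have := allP wK x xw; rewrite /= inE => xfs.
      by rewrite /letter_len (nth_map f) ?nth_index// index_mem.
    - by case: (w) wn.
    - rewrite all_map; apply/allP => x xw /=.
      by have := allP wK x xw; rewrite /= inE -sz index_mem.
  exists (false, [seq nat_of_ord (enum_rank x) | x <- w]); split=> /=.
  - rewrite -wl /word_len big_map; apply: eq_bigr => x _.
    rewrite /letter_len (nth_map x) -?cardE// nth_enum_rank//.
  - by case: (w) wn.
  - by rewrite all_map; apply/allP => x xw /=.
exists (rcons fs f), (rcons ws w); split.
- by rewrite rcons_uniq fK.
- by rewrite size_rcons sz.
- by rewrite !size_rcons szw.
move=> f0 j; rewrite size_rcons ltnS leq_eqVlt => /orP[/eqP ->|jn].
  rewrite !nth_rcons szw ltnn eqxx -cats1 take_size_cat//; split=> //.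
    rewrite (_ : \sum_(_ <- _) _ = nu)// -wnu big_seq [RHS]big_seq.
    apply: eq_bigr => i iw; have := allP wall i iw.
    by case: (w.1) => // hi; rewrite letter_len_prefix// sz.
  by rewrite sz.
have := h f0 j jn; rewrite /= !nth_rcons szw jn => -[h1 h2 h3]; split=> //.
rewrite -cats1 takel_cat 1?ltnW//.
rewrite (_ : \sum_(_ <- _) _ =
  \sum_(i <- (nth (true, [::]) ws j).2) letter_len fs (nth (true, [::]) ws j).1 i)//.
rewrite big_seq [RHS]big_seq.
apply: eq_bigr => i iw; have := allP h3 i iw.
by case: (_.1) => // hi; rewrite letter_len_prefix// (ltn_trans hi).
Qed.

End Certificate.

(** On both sides nu is the same minimum, over combinatorially the same walks, of
    quantities that increase with the length of f: the walk attaining it on one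
    side bounds nu on the other. *)
Lemma next_edge_mono (R : realType) (H1 H2 : qgraph R)
    (gE : edge H1 -> edge H2) (gV : vertex H1 -> vertex H2)
    (K1 : {set edge H1}) (K2 : {set edge H2}) (f : edge H1) (nu : R) :
  (forall e, src (gE e) = gV (src e)) -> (forall e, tgt (gE e) = gV (tgt e)) ->
  (forall e, e \in K1 -> gE e \in K2 /\ elen (gE e) = elen e) ->
  next_edge K1 f nu -> next_edge K2 (gE f) nu -> elen f <= elen (gE f).
Proof.
move=> hsrc htgt hK [_ _ _ attained] [_ bounce walk _].
case: attained => [nuE|[c [r [cf rK hc nuE]]]]; first by move: bounce; rewrite nuE; lra.
pose g (c : bond H1) : bond H2 := (gE c.1, c.2).
have hconn a b : conn a b -> conn (g a) (g b).
  move=> /eqP; rewrite /conn /bhead /btail /=.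
  by case: (a.2); case: (b.2); rewrite ?hsrc ?htgt => ->; rewrite eqxx.
have hc' : cycle (@conn R H2) (map g (c :: r)) by apply: homo_cycle hc.
have hb : blen (map g r) = blen r.
  rewrite /blen big_map big_seq [RHS]big_seq; apply: eq_bigr => x xr.
  by have [_ ->] := hK _ (allP rK x xr).
have hr : all (fun c' : bond H2 => c'.1 \in K2) (map g r).
  by rewrite all_map; apply/allP => x xr /=; have [] := hK _ (allP rK x xr).
have : nu <= blen (g c :: map g r) by apply: walk hr hc'; rewrite /= cf.
by rewrite -nuE /blen !big_cons -!/(blen _) hb /= cf lerD2r.
Qed.

Section SameCertificate.
Variables (R : realType) (G H1 H2 : qgraph R).
Variables (fs1 : seq (edge H1)) (fs2 : seq (edge H2)) (ws : seq (bool * seq nat)).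
Variables (e1 : edge H1) (e2 : edge H2).
Hypothesis cert1 : certificate G fs1 ws.
Hypothesis cert2 : certificate G fs2 ws.
Hypothesis same_card : #|vertex H1| = #|vertex H2|.
Local Notation f1 j := (nth e1 fs1 j).
Local Notation f2 j := (nth e2 fs2 j).
Hypothesis same_src : forall j, (j < size fs1)%N ->
  enum_rank (src (f1 j)) = enum_rank (src (f2 j)) :> nat.
Hypothesis same_tgt : forall j, (j < size fs1)%N ->
  enum_rank (tgt (f1 j)) = enum_rank (tgt (f2 j)) :> nat.

Let gV (v : vertex H1) : vertex H2 := enum_val (cast_ord same_card (enum_rank v)).
Let gV' (v : vertex H2) : vertex H1 := enum_val (cast_ord (esym same_card) (enum_rank v)).
Let gE (e : edge H1) : edge H2 := f2 (index e fs1).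
Let gE' (e : edge H2) : edge H1 := f1 (index e fs2).

Let same_size : size fs1 = size fs2.
Proof. by case: cert1 => _ _ <- _; case: cert2. Qed.

Let gVK : cancel gV gV'.
Proof. by move=> v; rewrite /gV' /gV enum_valK cast_ordK enum_rankK. Qed.

Let gVK' : cancel gV' gV.
Proof. by move=> v; rewrite /gV' /gV enum_valK cast_ordKV enum_rankK. Qed.

Let index1 e : (index e fs1 < size fs1)%N.
Proof. by rewrite index_mem; case: cert1. Qed.

Let index2 e : (index e fs2 < size fs2)%N.
Proof. by rewrite index_mem; case: cert2. Qed.

Let gE_nth j : (j < size fs1)%N -> gE (f1 j) = f2 j.
Proof. by move=> h; rewrite /gE index_uniq//; case: cert1. Qed.

Let gE'_nth j : (j < size fs1)%N -> gE' (f2 j) = f1 j.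
Proof. by move=> h; rewrite /gE' index_uniq -?same_size//; case: cert2. Qed.

Let gEK : cancel gE gE'.
Proof.
move=> e; rewrite /gE gE'_nth ?index1// nth_index//.
by case: cert1.
Qed.

Let gEK' : cancel gE' gE.
Proof.
move=> e; rewrite /gE' gE_nth ?same_size ?index2// nth_index//.
by case: cert2.
Qed.

Let gV_rank (v : vertex H1) (w : vertex H2) :
  enum_rank v = enum_rank w :> nat -> w = gV v.
Proof.
move=> h; rewrite /gV (_ : cast_ord _ _ = enum_rank w) ?enum_rankK//.
exact/val_inj.
Qed.

Let gE_src e : src (gE e) = gV (src e).
Proof.
have e_in : e \in fs1 by case: cert1.
by apply: gV_rank; rewrite -{1}(nth_index e1 e_in) same_src ?index1.
Qed.

Let gE_tgt e : tgt (gE e) = gV (tgt e).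
Proof.
have e_in : e \in fs1 by case: cert1.
by apply: gV_rank; rewrite -{1}(nth_index e1 e_in) same_tgt ?index1.
Qed.

Let gE'_src e : src (gE' e) = gV' (src e).
Proof. by rewrite -{2}[e]gEK' gE_src gVK. Qed.

Let gE'_tgt e : tgt (gE' e) = gV' (tgt e).
Proof. by rewrite -{2}[e]gEK' gE_tgt gVK. Qed.

Let same_elen j : (j < size fs1)%N -> elen (f1 j) = elen (f2 j).
Proof.
elim/ltn_ind: j => j IH hj.
have [u1 _ _ /(_ e1 j hj) [n1 _ w1]] := cert1.
have [u2 _ _] := cert2; rewrite -same_size => /(_ e2 j hj) [n2 _ _].
have letters : \sum_(i <- (nth (true, [::]) ws j).2) letter_len G fs1 (nth (true, [::]) ws j).1 i
    = \sum_(i <- (nth (true, [::]) ws j).2) letter_len G fs2 (nth (true, [::]) ws j).1 i.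
  rewrite big_seq [RHS]big_seq; apply: eq_bigr => i iw; have := allP w1 i iw.
  rewrite /letter_len; case: (_.1) => // ij.
  by rewrite (nth_map e1) ?(nth_map e2) -?same_size ?(ltn_trans ij)// IH// (ltn_trans ij).
rewrite -letters in n2.
have take1 e : e \in take j fs1 -> exists2 i, (i < j)%N & e = f1 i.
  move=> h; exists (index e (take j fs1)).
    by rewrite -{2}(size_takel (ltnW hj)) index_mem.
  by rewrite -(nth_take e1 (n0 := j)) ?nth_index// -{2}(size_takel (ltnW hj)) index_mem.
have hj2 : (j < size fs2)%N by rewrite -same_size.
have take2 e : e \in take j fs2 -> exists2 i, (i < j)%N & e = f2 i.
  move=> h; exists (index e (take j fs2)).
    by rewrite -{2}(size_takel (ltnW hj2)) index_mem.
  by rewrite -(nth_take e2 (n0 := j)) ?nth_index// -{2}(size_takel (ltnW hj2)) index_mem.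
have mem1 i : (i < j)%N -> f1 i \in take j fs1.
  by move=> h; rewrite -(nth_take e1 h) mem_nth// size_takel// ltnW.
have mem2 i : (i < j)%N -> f2 i \in take j fs2.
  by move=> h; rewrite -(nth_take e2 h) mem_nth// size_takel// ltnW.
apply/le_anti/andP; split.
  rewrite -(gE_nth hj) in n2 *; apply: (next_edge_mono gE_src gE_tgt _ n1 n2) => e.
  rewrite !inE => /take1 [i ij ->]; have h := ltn_trans ij hj.
  by rewrite gE_nth//; split; [apply: mem2|rewrite IH].
rewrite -(gE'_nth hj) in n1 *; apply: (next_edge_mono gE'_src gE'_tgt _ n2 n1) => e.
rewrite !inE => /take2 [i ij ->]; have h := ltn_trans ij hj.
by rewrite gE'_nth//; split; [apply: mem1|rewrite IH].
Qed.

Lemma certificate_iso : qgraph_iso H1 H2.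
Proof.
exists gV, gE; split.
- by exists gV'.
- by exists gE'.
- by move=> e; left; rewrite gE_src gE_tgt.
move=> e; have e_in : e \in fs1 by case: cert1.
by rewrite /gE -same_elen ?index1// nth_index.
Qed.

End SameCertificate.

(** * Encoding certificates in a finite type *)

(** Each letter carries the information whether its word ends there, so that a
    concatenation of words can be cut up again. *)
Fixpoint mark_end (w : seq nat) : seq (nat * bool) :=
  if w is x :: w' then (x, nilp w') :: mark_end w' else [::].

Lemma size_mark_end w : size (mark_end w) = size w.
Proof. by elim: w => //= x w ->. Qed.

Lemma mark_end_cat_inj w w' r r' : w != [::] -> w' != [::] ->
  mark_end w ++ r = mark_end w' ++ r' -> w = w' /\ r = r'.
Proof.
elim: w w' => // x [|y w] IH [|x' w'] // _ _.
  by case: w' => [|y' w'] //=; case=> -> ->.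
move=> E; have [<- w'n] : x = x' /\ false = nilp w' by case: E.
have hr : mark_end (y :: w) ++ r = mark_end w' ++ r' := congr1 behead E.
by have [||<- <-] := IH w' _ _ hr; last split => //; case: (w') w'n.
Qed.

Definition letters_of (ws : seq (bool * seq nat)) : seq (nat * bool) :=
  flatten [seq mark_end w.2 | w <- ws].

(** The number of words and the kinds of their letters are recorded
    separately. *)
Lemma letters_inj (ws ws' : seq (bool * seq nat)) r r' :
  size ws = size ws' -> all (fun w => w.2 != [::]) ws ->
  all (fun w => w.2 != [::]) ws' ->
  map fst ws = map fst ws' ->
  letters_of ws ++ r = letters_of ws' ++ r' -> ws = ws'.
Proof.
rewrite /letters_of; elim: ws ws' => [|[b w] ws IH] [|[b' w'] ws'] //= [sz] /andP[w0 h].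
move=> /andP[w0' h'] [<- hb]; rewrite -!catA => /(mark_end_cat_inj w0 w0')[<- hr].
by rewrite (IH ws').
Qed.

Definition code_type (M W N : nat) : finType :=
  ({ffun 'I_M -> 'I_W.+1 * 'I_W.+1} * {ffun 'I_M -> bool}
    * {ffun 'I_N -> 'I_M.-1.+1 * bool})%type.

Lemma card_code_type M W N : (0 < M)%N ->
  #|code_type M W N| = ((W.+1 ^ 2) ^ M * 2 ^ M * (2 * M) ^ N)%N.
Proof.
move=> M0; rewrite !card_prod !card_ffun !card_prod !card_ord card_bool prednK//.
by rewrite mulnn [(M * 2)%N]mulnC.
Qed.

(** Label 0 marks the places beyond the last edge. *)
Definition code (R : realType) (H : qgraph R) (M W N : nat) (e0 : edge H)
    (fs : seq (edge H)) (ws : seq (bool * seq nat)) : code_type M W N :=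
  ([ffun j : 'I_M => if (j < size fs)%N then
       (inord (enum_rank (src (nth e0 fs j))).+1,
        inord (enum_rank (tgt (nth e0 fs j))).+1)
     else (ord0, ord0)],
   [ffun j : 'I_M => (nth (true, [::]) ws j).1],
   [ffun i : 'I_N => (inord (nth (0%N, false) (letters_of ws) i).1,
                      (nth (0%N, false) (letters_of ws) i).2)]).

Lemma certificate_size (R : realType) (G H : qgraph R) fs ws :
  @certificate R G H fs ws -> size fs = #|edge H|.
Proof.
case=> u hall _ _; rewrite -(card_uniqP u); apply: eq_card => e.
by rewrite hall.
Qed.

Lemma certificate_words (R : realType) (G H : qgraph R) (e0 : edge H) fs ws :
  @certificate R G H fs ws -> all (fun w => w.2 != [::]) ws.
Proof.
case=> _ _ sz h; apply/(all_nthP (true, [::])) => j; rewrite sz => /(h e0 j).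
by case.
Qed.

Lemma certificate_letters (R : realType) (G H : qgraph R) (e0 : edge H) fs ws M :
  @certificate R G H fs ws -> (#|edge G| <= M)%N -> (#|edge H| <= M)%N ->
  all (fun p => p.1 < M)%N (letters_of ws).
Proof.
move=> cert GM HM; have szE := certificate_size cert.
case: cert => _ _ sz h.
have flat (ss : seq (seq (nat * bool))) (P : pred (nat * bool)) : all P (flatten ss) = all (all P) ss.
  by elim: ss => //= s ss IH; rewrite all_cat IH.
rewrite /letters_of flat all_map; apply/(all_nthP (true, [::])) => j; rewrite sz => hj; have [_ _] := h e0 j hj.
move: (nth _ ws j) => [b w] /= hw.
have : all (fun i => i < M)%N w.
  apply: sub_all hw => i; case: (b) => hi; last exact: leq_trans GM.
  by apply: (ltn_trans hi); rewrite (leq_trans hj)// szE.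
by elim: (w) => //= x w' IH /andP[-> /IH].
Qed.

Lemma code_iso (R : realType) (G H1 H2 : qgraph R) (M W N : nat)
    (e1 : edge H1) (e2 : edge H2) fs1 ws1 fs2 ws2 :
  @certificate R G H1 fs1 ws1 -> @certificate R G H2 fs2 ws2 ->
  (0 < M)%N -> (#|edge G| <= M)%N -> (#|edge H1| <= M)%N -> (#|edge H2| <= M)%N ->
  (#|vertex H1| <= W)%N -> (#|vertex H2| <= W)%N ->
  (size (letters_of ws1) <= N)%N -> (size (letters_of ws2) <= N)%N ->
  (#|edge H1| + #|vertex H2| = #|edge H2| + #|vertex H1|)%N ->
  code M W N e1 fs1 ws1 = code M W N e2 fs2 ws2 -> qgraph_iso H1 H2.
Proof.
move=> c1 c2 M0 GM HM1 HM2 HW1 HW2 N1 N2 same [/ffunP ends /ffunP bits /ffunP letters].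
have sz1 := certificate_size c1; have sz2 := certificate_size c2.
have szw1 : size ws1 = size fs1 by case: c1.
have szw2 : size ws2 = size fs2 by case: c2.
have labelE (Q : qgraph R) (v : vertex Q) : (#|vertex Q| <= W)%N ->
    val (inord (enum_rank v).+1 : 'I_W.+1) = (enum_rank v).+1.
  by move=> h; rewrite /= inordK// ltnS (leq_trans _ h).
have sz : size fs1 = size fs2.
  apply/eqP; rewrite eqn_leq; apply/andP; split; rewrite leqNgt; apply/negP => h.
    have hM : (size fs2 < M)%N by rewrite (leq_trans h)// sz1.
    have := ends (Ordinal hM); rewrite !ffunE /= h ltnn => -[/(congr1 val)].
    by rewrite labelE.
  have hM : (size fs1 < M)%N by rewrite (leq_trans h)// sz2.
  have := ends (Ordinal hM); rewrite !ffunE /= h ltnn => -[/(congr1 val)].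
  by rewrite labelE.
have lettersE : letters_of ws1 ++ nseq (N - size (letters_of ws1)) (0%N, false) =
    letters_of ws2 ++ nseq (N - size (letters_of ws2)) (0%N, false).
  have szN (s : seq (nat * bool)) : (size s <= N)%N ->
      size (s ++ nseq (N - size s) (0%N, false)) = N.
    by move=> h; rewrite size_cat size_nseq subnKC.
  apply: (@eq_from_nth _ (0%N, false)); first by rewrite !szN.
  rewrite szN// => i iN.
  have pad (s : seq (nat * bool)) :
      nth (0%N, false) (s ++ nseq (N - size s) (0%N, false)) i = nth (0%N, false) s i.
    rewrite nth_cat nth_nseq; case: ltnP => // h.
    by rewrite [RHS]nth_default//; case: ifP.
  rewrite !pad; have := letters (Ordinal iN); rewrite !ffunE /= => -[/(congr1 val) h _].
  have lt (s : seq (nat * bool)) : all (fun p => p.1 < M)%N s ->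
      (nth (0%N, false) s i).1 = val (inord (nth (0%N, false) s i).1 : 'I_M.-1.+1).
    move=> hs; rewrite /= inordK// prednK//.
    have [his|his] := ltnP i (size s); last by rewrite nth_default.
    exact: (all_nthP _ hs).
  rewrite [LHS]surjective_pairing [RHS]surjective_pairing; congr (_, _).
    rewrite (lt _ (certificate_letters e1 c1 GM HM1)).
    by rewrite (lt _ (certificate_letters e2 c2 GM HM2)) h.
  by have := letters (Ordinal iN); rewrite !ffunE /= => -[].
have wsE : ws1 = ws2.
  apply: (letters_inj _ _ _ _ lettersE).
  - by rewrite szw1 szw2.
  - exact: (certificate_words e1 c1).
  - exact: (certificate_words e2 c2).
  - apply: (@eq_from_nth _ true); rewrite !size_map szw1 ?szw2// => j hj.
    rewrite !(nth_map (true, [::])) ?szw1 ?szw2 -?sz//.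
    have hM : (j < M)%N by rewrite (leq_trans hj)// sz1.
    by have := bits (Ordinal hM); rewrite !ffunE.
rewrite -wsE in c2.
have sameV : #|vertex H1| = #|vertex H2|.
  by move: same; rewrite -sz1 -sz2 sz => /addnI.
apply: (certificate_iso (e1 := e1) (e2 := e2) c1 c2) => // j hj.
  have hM : (j < M)%N by rewrite (leq_trans hj)// sz1.
  have := ends (Ordinal hM); rewrite !ffunE /= -sz hj => -[/(congr1 val) h _].
  by move: h; rewrite !labelE// => -[].
have hM : (j < M)%N by rewrite (leq_trans hj)// sz1.
have := ends (Ordinal hM); rewrite !ffunE /= -sz hj => -[_ /(congr1 val) h].
by move: h; rewrite !labelE// => -[].
Qed.

(** * Counting *)

Lemma card_injective (I : Type) (F : finType) (f : I -> F) : injective f ->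
  exists2 n, ([set: I] #= `I_n)%card & (n <= #|F|)%N.
Proof.
move=> finj; pose g (i : I) : nat := enum_rank (f i).
have pre : g @^-1` `I_#|F| = [set: I] by apply/seteqP; split => // i _; apply: ltn_ord.
have le : ([set: I] #<= `I_#|F|)%card.
  rewrite -pre; apply: card_ge_preimage => i j _ _ /val_inj /enum_rank_inj; exact: finj.
have /finite_setP[n hn] : finite_set [set: I] by apply: card_le_finite le _; apply: finite_II.
by exists n => //; rewrite -card_le_II -(card_le_eql hn).
Qed.

(** M! >= 2 M absorbs one factor 2 M, and 2^(M + 2 T) <= 8^T <= 9^T <= M^(2 T). *)
Lemma code_count_le (M T : nat) : (3 <= M)%N -> (M <= T)%N ->
  (2 ^ M * (2 * M) ^ (2 * T).+1 <= M`! * M ^ (4 * T))%N.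
Proof.
move=> M3 MT.
have fact : (2 * M <= M`!)%N.
  case: M M3 {MT} => // m m2; rewrite factS mulnC leq_mul2l /=.
  by case: m m2 => // m m1; rewrite factS (leq_trans _ (leq_pmulr _ (fact_gt0 m))).
have pow : (2 ^ (M + 2 * T) <= M ^ (2 * T))%N.
  apply: (@leq_trans (2 ^ (3 * T))); first by rewrite leq_exp2l//; lia.
  rewrite !expnM; apply: (@leq_trans (9 ^ T)); first by case: (T) => // t; rewrite leq_exp2r.
  by case: (T) => // t; rewrite leq_exp2r// (@leq_trans (3 ^ 2))// leq_exp2r.
rewrite expnS expnMn.
have -> : (4 * T = 2 * T + 2 * T)%N by lia.
rewrite expnD.
have -> : (2 ^ M * (2 * M * (2 ^ (2 * T) * M ^ (2 * T))) =
  2 * M * (2 ^ (M + 2 * T) * M ^ (2 * T)))%N by rewrite expnD; ring.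
by rewrite leq_mul// leq_mul2r pow orbT.
Qed.

Lemma code_card_bound (R : realType) (M T : nat) : (3 <= M)%N -> (M <= T)%N ->
  #|code_type M (2 * M %/ 3) (2 * T).+1|%:R <=
    (2 / 3 * M%:R + 1) ^+ (2 * M) * (M`!)%:R * M%:R ^+ (4 * T) :> R.
Proof.
move=> M3 MT; rewrite card_code_type ?(leq_trans _ M3)// -mulnA natrM.
rewrite -expnM natrX -mulrA ler_pM//.
- rewrite lerXn2r ?nnegrE//.
  have h : (2 * M %/ 3)%:R * 3%:R <= 2 * M%:R :> R.
    by rewrite -!natrM ler_nat leq_trunc_div.
  by rewrite -natr1 lerD2r; lra.
- by rewrite -natrX -natrM ler_nat code_count_le.
Qed.

Lemma bound_le_powR (R : realType) (M : nat) (L : R) : 1 <= L -> (3 <= M)%N ->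
  (M <= Num.truncn L)%N ->
  (2 / 3 * M%:R + 1) ^+ (2 * M) * (M`!)%:R * M%:R ^+ (4 * Num.truncn L)
    <= L `^ (7 * L).
Proof.
move=> L1 M3 MT; have L0 : 0 <= L by rewrite (le_trans ler01).
have M3R : 3%:R <= M%:R :> R by rewrite ler_nat.
have TL : (Num.truncn L)%:R <= L by rewrite truncn_le.
apply: (@le_trans _ _ (M%:R ^+ (2 * M) * M%:R ^+ M * M%:R ^+ (4 * Num.truncn L))).
  rewrite ler_pM ?exprn_ge0 ?mulr_ge0 ?exprn_ge0//; last first.
    rewrite ler_pM ?exprn_ge0 ?ler0n//.
    - by rewrite lerXn2r ?nnegrE//; lra.
    - rewrite -natrX ler_nat; elim: (M) => // m IH; rewrite factS expnS leq_mul//.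
      by apply: (leq_trans IH); case: (m) => // k; rewrite leq_exp2r.
rewrite -!exprD; apply: (@le_trans _ _ (M%:R ^+ (7 * Num.truncn L))).
  by apply: ler_weXn2l; [lra|lia].
apply: (@le_trans _ _ (L ^+ (7 * Num.truncn L))).
  rewrite lerXn2r ?nnegrE//; apply: le_trans TL; by rewrite ler_nat.
by rewrite -powR_mulrn// ler_powR// natrM ler_wpM2l.
Qed.

Section GraphBounds.
Variables (R : realType) (H : qgraph R).
Hypothesis elenH : forall e : edge H, 1 <= split_elen e.

Lemma elen_ge1 (e : edge H) : 1 <= elen e.
Proof.
have := elenH e; rewrite /split_elen; case: ifP => // _.
by have := elen_gt0 e; lra.
Qed.

(** Each letter has length at least 1, and the word of an edge f has length at
    most 2 l(f). *)
Lemma letters_size (G : qgraph R) (e0 : edge H) fs ws :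
  (forall e : edge G, 1 <= elen e) -> @certificate R G H fs ws ->
  (size (letters_of ws))%:R <= 2 * total_length H.
Proof.
move=> elenG [u hall sz h].
have -> : size (letters_of ws) = (\sum_(0 <= j < size fs) size (nth (true, [::]) ws j).2)%N.
  rewrite -sz -(big_nth (true, [::]) predT (fun w => size w.2)) /letters_of.
  elim: (ws) => [|w s IH]; first by rewrite big_nil.
  by rewrite big_cons /= size_cat size_mark_end IH.
have -> : total_length H = \sum_(0 <= j < size fs) elen (nth e0 fs j).
  rewrite -(big_nth e0 predT (@elen R H)) big_uniq//= /total_length.
  by apply: eq_bigl => e; rewrite hall.
rewrite natr_sum mulr_sumr big_nat [leRHS]big_nat.
apply: ler_sum => j /andP[_ hj].
have [[_ bounce _ _] _ hw] := h e0 j hj; apply: le_trans bounce.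
rewrite -sum1_size natr_sum big_seq [leRHS]big_seq.
apply: ler_sum => i iw; have := allP hw i iw; rewrite /letter_len.
case: (_.1) => hi; last first.
  have /card_gt0P[g _] : (0 < #|edge G|)%N by apply: leq_ltn_trans hi.
  by rewrite (nth_map g) ?elenG// -cardE.
by rewrite (nth_map e0) ?elen_ge1// (ltn_trans hi).
Qed.

Lemma sum_degree : (\sum_v @degree H v = 2 * #|edge H|)%N.
Proof.
have count (f : edge H -> vertex H) : (\sum_v #|[set e | f e == v]%SET| = #|edge H|)%N.
  rewrite -sum1_card (partition_big f predT)//=.
  apply: eq_bigr => v _; rewrite -sum1_card; apply: eq_bigl => e.
  by rewrite inE.
by rewrite big_split /= !count mul2n addnn.
Qed.

Hypothesis deg_ge3 : forall v : vertex H, (3 <= degree v)%N.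

Lemma vertices_le : (3 * #|vertex H| <= 2 * #|edge H|)%N.
Proof.
rewrite -sum_degree -sum1_card mulnC big_distrl /=.
by apply: leq_sum => v _; rewrite mul1n.
Qed.

Lemma vertices_le_div (M : nat) : (#|edge H| <= M)%N -> (#|vertex H| <= 2 * M %/ 3)%N.
Proof. by move=> h; have := vertices_le; lia. Qed.

Lemma edges_le_length : (#|edge H|)%:R <= total_length H.
Proof.
rewrite -sum1_card natr_sum /total_length; apply: ler_sum => e _; exact: elen_ge1.
Qed.

(** 3 |V| <= 2 |E| amounts to |E| <= 3 chi - 3. *)
Lemma edges_le : (#|edge H| <= minn (Num.truncn (total_length H)) (3 * chi H - 3))%N.
Proof.
rewrite leq_min; apply/andP; split.
  by rewrite truncn_ge_nat ?edges_le_length// (le_trans _ edges_le_length).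
by have := vertices_le; rewrite /chi; lia.
Qed.

Hypothesis vertex_gt0 : (0 < #|vertex H|)%N.

(** With two edges only, both are loops, hence of length at least 2. *)
Lemma min_ge3 : (3 <= minn (Num.truncn (total_length H)) (3 * chi H - 3))%N.
Proof.
have hV := vertices_le; have hE := edges_le.
have [E3|E2] := leqP 3 #|edge H|; first exact: leq_trans hE.
have V1 : #|vertex H| = 1%N by lia.
have Eeq : #|edge H| = 2%N by lia.
rewrite leq_min /chi V1 Eeq andbT.
have loop (e : edge H) : 2 <= elen e.
  have /eqP/fintype1P[v0 hv0] := V1.
  have := elenH e; rewrite /split_elen.
  have -> : src e == tgt e by rewrite [src e]hv0 [tgt e]hv0.
  by lra.
have hL : 4 <= total_length H.
  have -> : 4 = \sum_(e : edge H) 2 :> R by rewrite sumr_const Eeq; ring.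
  by apply: ler_sum => e _; apply: loop.
by rewrite truncn_ge_nat; lra.
Qed.

End GraphBounds.

Lemma degree_ge3 (G : graph) : admissible G -> leafless G ->
  forall v : vertex G, (3 <= degree v)%N.
Proof.
move=> [_ d0 d2] d1 v; have := d0 v; have := d1 v; have := d2 v.
by case: (degree v) => [|[|[|n]]].
Qed.

Unset Implicit Arguments.

Theorem theorem5p17 (R : realType) (I : Type) (G : I -> qgraph R) (L : R)
  (hadm : forall i, admissible (G i))
  (hleaf : forall i, leafless (G i))
  (hniso : forall i j, i <> j -> ~ qgraph_iso (G i) (G j))
  (hspec : forall i j, isospectral (G i) (G j))
  (hmin : forall i, is_min_edge_length (G i) 1)
  (hlen : forall i, total_length (G i) = L) :
  exists n chi0 : nat,
    let M := minn (Num.truncn L) (3 * chi0 - 3) in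
    [/\ ([set: I] #= `I_n)%card,
        forall i, chi (G i) = chi0,
        n%:R <= (2 / 3 * M%:R + 1) ^+ (2 * M) * (M`!)%:R
                  * M%:R ^+ (4 * Num.truncn L) :> R,
        n%:R <= L `^ (7 * L)
      & L `^ (7 * L) = expR (7 * L * ln L)].
Proof.
have powE : L `^ (7 * L) = expR (7 * L * ln L).
  rewrite /powR; case: eqP => // ->.
  by rewrite mulr0 eqxx mul0r expR0.
have [[i0]|noI] := pselect (inhabited I); last first.
  exists 0%N, 0%N; split=> //=.
  - have -> : [set: I] = set0 by apply/seteqP; split => // i _; case: noI; exists.
    by rewrite II0.
  - by move=> i; case: noI; exists.
  - by rewrite !mulr_ge0 ?exprn_ge0 ?ler0n.
  - exact: powR_ge0.
have split1 i (e : edge (G i)) : 1 <= split_elen e by have [_] := hmin i; apply.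
have elen1 i := elen_ge1 (split1 i).
have deg3 i := degree_ge3 (hadm i) (hleaf i).
have conn i : graph_connected (G i) by have [] := hadm i.
have card i j : (#|edge (G i)| + #|vertex (G j)| = #|edge (G j)| + #|vertex (G i)|)%N.
  by apply: isospectral_card => //; rewrite !hlen.
have chiE i : chi (G i) = chi (G i0).
  have := vertices_le (deg3 i); have := vertices_le (deg3 i0); have := card i i0.
  by rewrite /chi; lia.
set T := Num.truncn L; set chi0 := chi (G i0).
pose M := minn T (3 * chi0 - 3).
have V0 i : (0 < #|vertex (G i)|)%N by have [] := conn i.
have EM i : (#|edge (G i)| <= M)%N.
  by have := edges_le (split1 i) (deg3 i); rewrite hlen chiE.
have M3 : (3 <= M)%N by have := min_ge3 (split1 i0) (deg3 i0) (V0 i0); rewrite hlen.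
have MT : (M <= T)%N by rewrite geq_minl.
have L1 : 1 <= L by rewrite -truncn_gt0 -/T; apply: leq_trans MT; apply: leq_trans M3.
have e0 i : edge (G i) by apply: xchoose; have [[e _] _] := hmin i; exists e.
have [f hf] : {f : forall i, seq (edge (G i)) * seq (bool * seq nat) &
    forall i, certificate (G i0) (f i).1 (f i).2}.
  suff h i : {p : seq (edge (G i)) * seq (bool * seq nat) |
      certificate (G i0) p.1 p.2}.
    by exists (fun i => sval (h i)) => i; apply: (svalP (h i)).
  apply: cid; have [|fs [ws h]] := @certificate_exists R (G i0) (G i).
    by move=> K e eK; apply: (next_edge_word _ _ _ _ _ _ eK) => //; rewrite !hlen.
  by exists (fs, ws).
have lettersT i : (size (letters_of (f i).2) <= (2 * T).+1)%N.
  have := letters_size (split1 i) (e0 i) (elen1 i0) (hf i); rewrite hlen => hs.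
  have hT : L < T.+1%:R by apply: truncnS_gt.
  rewrite -ltnS -(ltr_nat R); apply: (le_lt_trans hs).
  have -> : (2 * T).+2%:R = 2 * T.+1%:R :> R by rewrite -natrM; congr (_%:R); lia.
  by rewrite ltr_pM2l.
pose c i := code M (2 * M %/ 3) (2 * T).+1 (e0 i) (f i).1 (f i).2.
have M0 : (0 < M)%N by apply: leq_trans M3.
have VW i := vertices_le_div (deg3 i) (EM i).
have cinj : injective c.
  move=> i j cij; have [//|ij] := pselect (i = j); case: (hniso i j ij).
  exact: (code_iso (hf i) (hf j) M0 (EM i0) (EM i) (EM j) (VW i) (VW j)
    (lettersT i) (lettersT j) (card i j) cij).
have [n hn n_le] := card_injective cinj.
have bound := code_card_bound R M3 MT.
have nR : n%:R <= #|code_type M (2 * M %/ 3) (2 * T).+1|%:R :> R by rewrite ler_nat.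
exists n, chi0; split=> //; first exact: le_trans nR bound.
exact: le_trans (le_trans nR bound) (bound_le_powR L1 M3 MT).
Qed.
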